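(* Let $\Delta$ be a positive integer. Then there exists a constant $C=C(\Delta)$ such that for any (finite) graph $G$ with maximum degree $\Delta$ and any finite abelian group $\Gamma_0$ such that $|\Gamma_0|$ divides $e(G)$, we have $$R(G,\Gamma_0)\le C\cdot v(G).$$
   Context: For a finite graph $G$ and a finite abelian group $\Gamma$ such that $|\Gamma|$ divides the number of edges $e(G)$, the zero-sum Ramsey number $R(G,\Gamma)$ is the minimum positive integer $t$ such that for every edge-colouring $c:E(K_t)\to\Gamma$ of the complete graph $K_t$ there is a copy of $G$ in $K_t$ with $\sum_{e\in E(G)}c(e)=0_\Gamma$ (a zero-sum copy). Here $v(G)$ denotes the number of vertices of $G$. *)

(* Defs.v *)
From HB Require Import structures.
From mathcomp Require Import all_boot all_order all_algebra.

Set Implicit Arguments.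
Unset Strict Implicit.
Unset Printing Implicit Defensive.

Record sgraph := SGraph {
  vertex :> finType;
  adj : rel vertex;
  adj_sym : symmetric adj;
  adj_irrefl : irreflexive adj }.

(* An edge is the two-element set of its endpoints. *)
Definition edges (G : sgraph) : {set {set G}} :=
  [set [set p.1; p.2] | p : G * G & adj p.1 p.2].

Definition edge (G : sgraph) : Type := {A : {set G} | A \in edges G}.

Definition degree (G : sgraph) (x : G) : nat := #|[set y | adj x y]|.

Definition max_degree (G : sgraph) : nat := \max_(x : G) degree x.

Lemma neq_sym (T : eqType) : symmetric (fun x y : T => x != y).
Proof. by move=> x y; rewrite eq_sym. Qed.

Lemma neq_irrefl (T : eqType) : irreflexive (fun x y : T => x != y).
Proof. by move=> x; rewrite eqxx. Qed.

Definition complete_graph (t : nat) : sgraph :=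
  @SGraph 'I_t (fun x y => x != y) (@neq_sym 'I_t) (@neq_irrefl 'I_t).

Definition embedding (G H : sgraph) (f : G -> H) : Prop :=
  injective f /\ forall x y, adj x y -> adj (f x) (f y).

(* For an embedding f, the edge set of the copy f(G) of G in H. *)
Definition copy_edges (G H : sgraph) (f : G -> H) : {set {set H}} :=
  [set f @: A | A : {set G} in edges G].

Definition zero_sum_copy (G H : sgraph) (Gamma : finZmodType)
    (c : edge H -> Gamma) (f : G -> H) : Prop :=
  embedding f /\
  (\sum_(d : {A : {set H} | A \in edges H} | val d \in copy_edges f) c d = 0)%R.

Definition zero_sum_arrow (G : sgraph) (Gamma : finZmodType) (t : nat) : Prop :=
  forall c : edge (complete_graph t) -> Gamma,
    exists f : G -> complete_graph t, zero_sum_copy c f.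

(* R(G, Gamma) = r, as a relation: no t satisfies the arrow property when the
   exponent of Gamma does not divide #|edges G| (take c constant). *)
Definition is_zero_sum_ramsey (G : sgraph) (Gamma : finZmodType) (r : nat) : Prop :=
  [/\ 0 < r, zero_sum_arrow G Gamma r &
      forall t, 0 < t -> zero_sum_arrow G Gamma t -> r <= t].

(* Main.v *)
(* Let Gamma have order n and let k be the colouring.  Pick linearly many "sites":
   far-apart vertices of G of a common degree d with equal neighbour degrees.

   Filling: embed the neighbourhoods of the sites while their centres stay free,
   so that the sums at the centres attain a set A of values, which each step
   enlarges by sumset growth.  Let H be a minimal subgroup that the differences
   of such sums cannot avoid on a large set of vertices.  There A fills a coset
   of H, and k(x,y) = h(x) + h(y) + c modulo H with d h = 0.  The other vertices
   of G are placed in d-subsets of constant degree, each into one class of h,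
   which makes the total sum vanish modulo H; A absorbs the rest.

   There are enough sites if every large set contains a star whose sums take many
   values as its centre varies.  Otherwise k(x,y) = p(x) + p(y) + c'(x,y) on a
   large set, where d p = 0 and every vertex sees boundedly many values of c'.  If
   few elements are killed by d, then p can be made constant, and a local Ramsey
   theorem with linear bound gives a monochromatic copy, whose sum is zero because
   n divides e(G).  Otherwise d Gamma is small compared with Gamma, almost all
   values of c' lie in a subgroup E of order O(|d Gamma|), and E is small enough
   to be filled from the available sites. *)
Require Import Defs.
From HB Require Import structures.
From mathcomp Require Import all_boot all_order all_algebra.
From mathcomp Require Import fingroup.
From mathcomp Require Import zify.
From Stdlib Require Import Classical.

Import GRing.Theory.

Set Implicit Arguments.
Unset Strict Implicit.
Unset Printing Implicit Defensive.

(* [lia] on cardinals: identifies cardinals that are only convertible. *)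
Ltac lia_cards :=
  clear; repeat (let n := fresh "n" in move: #|_| => n); lia.

(** Divisibility makes [Gamma] at most as large as the number of edges, but the number of sites is
    only a fixed fraction of that number and can be much smaller than [Gamma]. A step of the filling
    costs a bounded number of sites, so it has to enlarge A by a large constant [kappa] on average;
    one value per step is affordable only if the group to be filled is small. This shapes the case
    distinction. A site centre has degree d, the number that kills h modulo H. Hence its sum modulo
    H does not depend on its position, and A stays in one coset. By the handshake identity h enters
    the total sum weighted by degrees, which is why vertices are placed in batches of total degree
    divisible by d. The last vertices form no such batch. Their weight is harmless because all
    degrees add up to twice e(G); the deviation of the edges among them is killed by d, and the
    number of these edges is corrected modulo d by holding back some site centres, each with one
    neighbour among them. That d kills this deviation comes from gadgets whose alternative centre
    may use exceptional pairs. *)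

(** * Counting and pigeonhole *)

Lemma pigeonhole_rel (T K : finType) (A : {set T}) (C : {set K})
    (R : T -> K -> bool) :
  A != set0 -> {in A, forall x, exists2 k, k \in C & R x k} ->
  exists2 k, k \in C & #|A| <= #|C| * #|[set x in A | R x k]|.
Proof.
move=> /set0Pn [x0 x0A] RC.
have [k0 k0C _] := RC _ x0A.
pose fib k := #|[set x in A | R x k]|.
case: (@arg_maxnP _ k0 (mem C) fib k0C) => k kC kmax.
exists k => //; rewrite -sum_nat_const.
apply: (@leq_trans (\sum_(i in C) fib i)); last by apply: leq_sum => j /kmax.
rewrite -[#|A|]sum1_card /fib.
under [X in _ <= X]eq_bigr => i _ do rewrite -sum1dep_card big_mkcondr.
rewrite exchange_big /=; apply: leq_sum => x xA.
have [k1 k1C Rk1] := RC _ xA.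
by rewrite (bigD1 k1) //= Rk1.
Qed.

Lemma pigeonhole (T K : finType) (A : {set T}) (F : T -> K) (C : {set K}) :
  A != set0 -> {in A, forall x, F x \in C} ->
  exists2 k, k \in C & #|A| <= #|C| * #|[set x in A | F x == k]|.
Proof.
move=> A0 FC; apply: (@pigeonhole_rel _ _ A C (fun x k => F x == k)) => //.
by move=> x /FC; exists (F x).
Qed.

Lemma card_setU_le (T : finType) (A B : {set T}) : #|A :|: B| <= #|A| + #|B|.
Proof. exact: leq_card_setU. Qed.

Lemma card_bigcup_le (I T : finType) (A : {set I}) (F : I -> {set T}) (n : nat) :
  {in A, forall i, #|F i| <= n} -> #|\bigcup_(i in A) F i| <= #|A| * n.
Proof.
move=> Fn; rewrite -sum_nat_const; elim/big_rec2: _ => [|i B m iA IH]; first by rewrite cards0.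
by apply: leq_trans (card_setU_le _ _) _; rewrite leq_add ?Fn.
Qed.

Lemma subset_of_card (T : finType) (A : {set T}) (m : nat) :
  m <= #|A| -> exists2 B : {set T}, B \subset A & #|B| = m.
Proof.
move=> mA; exists [set x in take m (enum A)].
  by apply/subsetP => x; rewrite inE => /mem_take; rewrite mem_enum.
rewrite cardsE (card_uniqP _) ?take_uniq ?enum_uniq //.
by rewrite size_take -cardE; case: ltngtP mA => // ->.
Qed.

(** * Monochromatic cliques in locally bounded colourings *)

Section LocalClique.
Variable q : nat.

(* The standard Ramsey chain: the colour of a pair is decided by its earlier member. *)
Lemma local_chain (L : nat) :
  exists N, forall (T K : finType) (kap : T -> T -> K) (S : {set T}),
    N <= #|S| -> (forall x, x \in S -> #|[set kap x y | y in S :\ x]| <= q) ->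
    exists s : seq (T * K), [/\ size s = L, uniq (map fst s),
      {subset map fst s <= S} &
      pairwise (fun p p' => kap p.1 p'.1 == p.2) s].
Proof.
elim: L => [|L [N IH]]; first by exists 0 => T K kap S _ _; exists [::].
exists (2 + q * N) => T K kap S NS loc.
have /set0Pn [y yS] : S != set0 by rewrite -card_gt0; lia.
have cA : #|S| = #|S :\ y|.+1 by rewrite (cardsD1 y) yS.
have An0 : S :\ y != set0 by rewrite -card_gt0; lia.
have [|g gC leg] := @pigeonhole _ _ (S :\ y) (kap y)
  [set kap y z | z in S :\ y] An0.
  by move=> z zS; apply: imset_f.
set B := [set x in _ | _] in leg.
have NB : N <= #|B|.
  have := loc y yS; move: leg; set a := #|_|; set b := #|B| => leg aq.
  have : q * N < q * b by apply: leq_trans (leq_mul aq (leqnn b)); lia.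
  by rewrite ltn_mul2l => /andP[_ /ltnW].
have BS : B \subset S by apply/subsetP => x; rewrite !inE => /andP[/andP[]].
have [x xB|s [sz us ss ps]] := IH T K kap B NB.
  have xS := subsetP BS _ xB.
  by apply: leq_trans (loc x xS); apply/subset_leq_card/imsetS/setSD.
exists ((y, g) :: s); split => /=.
- by rewrite sz.
- rewrite us andbT; apply/negP => /ss; by rewrite !inE eqxx.
- move=> x; rewrite inE => /predU1P[->//|/ss xB]; exact: (subsetP BS).
- rewrite ps andbT; apply/allP => p ps'.
  have /ss : p.1 \in map fst s by apply: map_f.
  by rewrite !inE => /andP[_].
Qed.

Definition local_ramsey (r N : nat) (T : finType) : Prop :=
  forall (K : finType) (kap : T -> T -> K) (S : {set T}),
    (forall x y, kap x y = kap y x) -> N <= #|S| ->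
    (forall x, x \in S -> #|[set kap x y | y in S :\ x]| <= q) ->
    exists (P : {set T}) (g : K), [/\ P \subset S, #|P| = r &
      {in P &, forall x y, x != y -> kap x y = g}].

(** The last vertex of a chain sees the chain colour of every earlier member, so these colours all
    lie in its palette of at most [q], and one of them is shared by [r] members. Locality thus
    replaces a bound on the total number of colours. *)
Lemma local_clique (r : nat) : exists N, forall T, local_ramsey r N T.
Proof.
have [N HN] := local_chain (q * r).+2.
exists N => T K kap S ksym NS loc.
have [s [sz us ss ps]] := HN T K kap S NS loc.
case/lastP: s sz us ss ps => [//|s [y g0]].
rewrite size_rcons map_rcons rcons_uniq => -[sz] /andP[ys us] ss.
rewrite pairwise_rcons => /andP[py ps].
have yS : y \in S by apply: ss; rewrite mem_rcons inE eqxx.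
have us2 : uniq s by exact: map_uniq us.
pose A := [set p in s].
have cA : #|A| = (q * r).+1 by rewrite cardsE (card_uniqP us2).
have An0 : A != set0 by rewrite -card_gt0 cA.
have [|g gC leg] := @pigeonhole _ _ A snd [set kap y z | z in S :\ y] An0.
  move=> p; rewrite inE => pins; have := allP py _ pins => /= /eqP <-.
  rewrite ksym; apply: imset_f; rewrite !inE; apply/andP; split.
    by apply/eqP => e; case/negP: ys; rewrite -[(y, g0).1]e; apply: map_f.
  by apply: ss; rewrite mem_rcons inE map_f ?orbT.
set B := [set x in _ | _] in leg.
have rB : r <= #|B|.
  have := loc y yS; move: leg; set a := #|[set _ | _ in _]| => leg aq.
  have : q * r < q * #|B| by apply: leq_trans (leq_mul aq (leqnn #|B|)); lia.
  by rewrite ltn_mul2l => /andP[_ /ltnW].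
have inj1 : {in A &, injective (fst : T * K -> T)}.
  move=> p p'; rewrite !inE => pin p'in e.
  have E x : x \in s -> nth p.1 (map fst s) (index x s) = x.1.
    by move=> xs; rewrite (nth_map p) ?index_mem // nth_index.
  suff /eqP i_eq : index p s == index p' s.
    by rewrite -(nth_index p pin) i_eq nth_index.
  by rewrite -(nth_uniq p.1 _ _ us) ?size_map ?index_mem // !E // e.
have BA : B \subset A by apply/subsetP => x; rewrite inE => /andP[].
have cB : #|[set p.1 | p in B]| = #|B|.
  by apply: card_in_imset => p p' pB p'B; apply: inj1; apply: (subsetP BA).
have [P PB cP] : exists2 P : {set T}, P \subset [set p.1 | p in B] & #|P| = r.
  by apply: subset_of_card; rewrite cB.
have FP x : x \in P -> exists2 p, p \in s & x = p.1 /\ p.2 = g.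
  move=> /(subsetP PB) /imsetP [p]; rewrite !inE => /andP[pin /eqP pg] ->.
  by exists p.
exists P, g; split => //.
  apply/subsetP => x /FP [p pin [-> _]]; apply: ss.
  by rewrite mem_rcons inE map_f ?orbT.
move=> x x' /FP [p pin [-> pg]] /FP [p' p'in [-> p'g]] ne.
have /(pairwiseP p) pw := ps.
wlog lt : p p' pin p'in pg p'g ne pw / index p s < index p' s.
  move=> W; case: (ltngtP (index p s) (index p' s)) => [lt|lt|eq].
  - exact: W pw lt.
  - rewrite ksym; apply: (W p' p) => //; first by rewrite eq_sym.
    by apply/pairwiseP.
  - by move: ne; rewrite -(nth_index p pin) eq nth_index // eqxx.
have := pw (index p s) (index p' s); rewrite !inE !index_mem !nth_index //.
by rewrite -pg => /(_ pin p'in lt)/eqP.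
Qed.
End LocalClique.

Lemma inj_into (I T : finType) (A : {set T}) : #|I| <= #|A| ->
  exists g : I -> T, injective g /\ forall i, g i \in A.
Proof.
case: (set_0Vmem A) => [->|[x0 x0A] cA].
  rewrite cards0 leqn0 => /eqP c0.
  by exists (fun i => match fintype0 i c0 with end); split=> i; case: (fintype0 i c0).
have lt (i : I) : enum_rank i < size (enum A).
  by rewrite -cardE (leq_trans (ltn_ord (enum_rank i))).
exists (fun i => nth x0 (enum A) (enum_rank i)); split.
  move=> i j /eqP; rewrite nth_uniq ?enum_uniq // => /eqP e.
  by apply: enum_rank_inj; apply: val_inj.
by move=> i; rewrite -mem_enum mem_nth.
Qed.

Lemma pos_of_leq_mul m a b : 0 < m -> m <= a * b -> 0 < b.
Proof. by case: b => // m0; rewrite muln0 leqNgt m0. Qed.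

(** * Robust pairs of vertex sets *)

Section Robust.
Variables (T K : finType) (c : T -> T -> K) (pal : T -> {set K}) (W : {set T}).
Hypothesis palP : {in W &, forall x y, (c x y \in pal x) && (c x y \in pal y)}.

Definition cdeg (g : K) (x : T) (Y : {set T}) : nat :=
  #|[set y in Y | c x y == g]|.

(* One-sided lower regularity with [eps = 1/E] and density [1/D]. *)
Definition robust (E D : nat) (g : K) (X Y : {set T}) : bool :=
  [forall Z : {set T}, (Z \subset Y) && (#|Y| <= E * #|Z|) ==>
    (E * #|[set x in X | D * cdeg g x Z < #|Z|]| < #|X|)].

Lemma robust_sub E D E' D' e g (X Y X' Y' : {set T}) :
  robust E D g X Y -> X' \subset X -> Y' \subset Y ->
  #|X| <= e * #|X'| -> #|Y| <= e * #|Y'| -> e * E' <= E -> D <= D' ->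
  robust E' D' g X' Y'.
Proof.
move=> /forallP rb sX sY cX cY eE DD; apply/forallP => Z.
apply/implyP => /andP[ZY' cZ].
have := rb Z; rewrite (subset_trans ZY' sY) /=.
have -> : #|Y| <= E * #|Z| by nia.
set A := [set x in X | _]; set A' := [set x in X' | _] => /= lt.
have : #|A'| <= #|A|.
  apply/subset_leq_card/subsetP => x; rewrite !inE => /andP[/(subsetP sX) -> /=].
  by apply: leq_ltn_trans; apply: leq_mul.
by nia.
Qed.

Variable g : nat -> nat.
Hypothesis g_gt0 : forall D, 0 < g D.

(** [r] counts the colours of a palette not yet known to be rare. A colour that fails to be robust
    has density below [1/(2 * dens r')] on a subpair, and passing to it multiplies the density of
    the earlier rare colours by at most [2 * (r'.+1 * r'.+1) * g (2 * dens r')]. The recursion keeps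
    the total below [1/dens r']. *)
Fixpoint dens r :=
  if r is r'.+1 then 2 * dens r' * (2 * (r'.+1 * r'.+1)) * g (2 * dens r') else 2.

Fixpoint shrink r :=
  if r is r'.+1 then 2 * (r'.+1 * r'.+1) * g (2 * dens r') * shrink r' else 1.

Lemma dens_mono r : dens r <= dens r.+1.
Proof.
rewrite /= -mulnA [2 * dens r]mulnC -mulnA leq_pmulr //.
by rewrite !muln_gt0 g_gt0.
Qed.

Lemma dens_ge2 r : 1 < dens r.
Proof. by elim: r => // r IH; apply: leq_trans IH (dens_mono r). Qed.

Lemma shrink_gt0 r : 0 < shrink r.
Proof. by elim: r => //= r IH; rewrite !muln_gt0 g_gt0 IH. Qed.

(* The colours in [L] are rare between X and Y; each vertex has at most r others.
   Either the most popular remaining colour is robust, or it becomes rare on a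
   large subpair, where it joins [L]. *)
Lemma robust_pair r (X Y : {set T}) (L : {set K}) :
  X \subset W -> Y \subset W -> X != set0 -> Y != set0 ->
  {in X, forall x, #|pal x :\: L| <= r} ->
  {in Y, forall y, #|pal y :\: L| <= r} ->
  {in X, forall x, dens r * #|[set y in Y | c x y \in L]| <= #|Y|} ->
  exists D h (X' Y' : {set T}), [/\ X' \subset X, Y' \subset Y,
    #|X| <= shrink r * #|X'|, #|Y| <= shrink r * #|Y'| & D <= 2 * dens r] /\
   [/\ robust (g D) D h X' Y', {in X', forall x, h \in pal x} &
     {in Y', forall y, h \in pal y}].
Proof.
elim: r X Y L => [|r IH] X Y L XW YW X0 Y0 pX pY light.
  (* With no colour left outside [L], all of [Y] is joined to [x] in rare colours, which
     [dens 0 = 2] forbids. *)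
  case/set0Pn: X0 => x xX; have := light x xX.
  have -> : [set y in Y | c x y \in L] = Y.
    apply/setP => y; rewrite inE; case yY: (y \in Y) => //=.
    have /andP[cx _] := palP (subsetP XW _ xX) (subsetP YW _ yY).
    have := pX x xX; rewrite leqn0 cards_eq0 setD_eq0 => /subsetP; exact.
  by move: Y0; rewrite -card_gt0 /=; lia.
set a := 2 * (r.+1 * r.+1); set Q := dens r; set E := g (2 * Q).
have E0 : 0 < E by apply: g_gt0.
have Q2 : 1 < Q := dens_ge2 r.
have Yp : 0 < #|Y| by rewrite card_gt0.
have Xp : 0 < #|X| by rewrite card_gt0.
have fav x : x \in X -> exists2 h, h \in pal x :\: L & #|Y| <= 2 * r.+1 * cdeg h x Y.
  move=> xX; pose A := [set y in Y | c x y \notin L].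
  have cA : #|Y| = #|[set y in Y | c x y \in L]| + #|A|.
    rewrite -(cardsID [set y | c x y \in L] Y); congr (_ + _); apply: eq_card => y;
    by rewrite !inE // andbC.
  have lt := light x xX; have d2 := dens_ge2 r.+1.
  have YA : #|Y| <= 2 * #|A| by nia.
  have [||h hp hc] := @pigeonhole _ _ A (c x) (pal x :\: L).
  - by rewrite -card_gt0; lia.
  - move=> y; rewrite !inE => /andP[yY ->] /=.
    by have /andP[] := palP (subsetP XW _ xX) (subsetP YW _ yY).
  - exists h => //; have pr := pX x xX.
    have : #|[set y in A | c x y == h]| <= cdeg h x Y.
      apply/subset_leq_card/subsetP => y; rewrite !inE => /andP[/andP[-> _] ->] //.
    move: hc pr; set u := #|_ :\: _|; set v := #|[set _ in A | _]|; nia.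
pose Yh h := [set y in Y | h \in pal y].
(* Each [y] has at most [r.+1] colours outside [L], so few colours lie in the palettes of a fixed
   fraction of [Y]. The pigeonhole over [X] then runs over at most [a] colours, whatever the size of
   [K]. *)
pose Pop := [set h | (h \notin L) && (#|Y| <= 2 * r.+1 * #|Yh h|)].
have cPop : #|Pop| <= a.
  suff : #|Pop| * #|Y| <= a * #|Y| by rewrite leq_pmul2r.
  rewrite -sum_nat_const.
  apply: (@leq_trans (\sum_(h in Pop) 2 * r.+1 * #|Yh h|)).
    by apply: leq_sum => h; rewrite inE => /andP[].
  rewrite -big_distrr /= /a mulnA -[X in _ <= X]mulnA.
  rewrite leq_mul2l /=; apply: (@leq_trans (\sum_(y in Y) #|pal y :\: L|)).
    under eq_bigr => h _ do rewrite -sum1dep_card big_mkcondr.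
    rewrite exchange_big /=; apply: leq_sum => y yY.
    rewrite -big_mkcondr sum1dep_card; apply/subset_leq_card/subsetP => h.
    by rewrite !inE => /andP[/andP[-> _] ->].
  rewrite mulnC -sum_nat_const; apply: leq_sum => y; exact: pY.
have degY h x : x \in X -> cdeg h x Y <= #|Yh h|.
  move=> xX; apply/subset_leq_card/subsetP => y; rewrite !inE => /andP[yY /eqP <-].
  by rewrite yY /=; have /andP[] := palP (subsetP XW _ xX) (subsetP YW _ yY).
have [x xX|h hPop hc] := @pigeonhole_rel _ _ X Pop
    (fun x h => h \in pal x) X0.
  have [h hp hc] := fav x xX; exists h; last by move: hp; rewrite inE => /andP[].
  rewrite inE; move: hp; rewrite inE => /andP[-> _] /=.
  by apply: leq_trans hc _; rewrite leq_mul2l degY.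
set X1 := [set x in X | _] in hc.
have {hPop} [hL Yh1] : h \notin L /\ #|Y| <= 2 * r.+1 * #|Yh h|.
  by move: hPop; rewrite inE => /andP.
set Y1 := Yh h in Yh1.
have cX1 : #|X| <= a * #|X1| by apply: leq_trans hc _; rewrite leq_mul2r cPop orbT.
have cY1 : #|Y| <= a * #|Y1|.
  apply: leq_trans Yh1 _; rewrite leq_mul2r /a; apply/orP; right.
  by rewrite leq_mul2l leq_pmulr.
have X1X : X1 \subset X by apply/subsetP => x; rewrite inE => /andP[].
have Y1Y : Y1 \subset Y by apply/subsetP => x; rewrite inE => /andP[].
have sh := shrink_gt0 r.
have dm := dens_mono r.
have [rb|] := boolP (robust E (2 * Q) h X1 Y1).
  exists (2 * Q), h, X1, Y1; split; split => //.
  - rewrite /= -/a -/Q -/E; apply: leq_trans cX1 _.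
    by rewrite leq_mul2r -mulnA leq_pmulr ?muln_gt0 ?E0 ?orbT.
  - rewrite /= -/a -/Q -/E; apply: leq_trans cY1 _.
    by rewrite leq_mul2r -mulnA leq_pmulr ?muln_gt0 ?E0 ?orbT.
  - by rewrite leq_mul2l.
  - by move=> x; rewrite inE => /andP[].
  - by move=> x; rewrite inE => /andP[].
case/forallPn => Y2; rewrite negb_imply -leqNgt => /andP[/andP[Y2Y1 cY2]].
set X2 := [set x in X1 | _] => cX2.
have X2X1 : X2 \subset X1 by apply/subsetP => x; rewrite inE => /andP[].
have drop (A : {set K}) : h \in A -> #|A :\: L| <= r.+1 -> #|A :\: (h |: L)| <= r.
  move=> hA; rewrite (cardsD1 h (A :\: L)) !inE hL hA /= add1n ltnS.
  by apply: leq_trans; apply/subset_leq_card/subsetP => x; rewrite !inE negb_or -andbA.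
case: (IH X2 Y2 (h |: L)).
- exact: subset_trans X2X1 (subset_trans X1X XW).
- exact: subset_trans Y2Y1 (subset_trans Y1Y YW).
- by rewrite -card_gt0 (pos_of_leq_mul _ cX2) // (pos_of_leq_mul _ cX1).
- by rewrite -card_gt0 (pos_of_leq_mul _ cY2) // (pos_of_leq_mul _ cY1).
- move=> x xX2; have xX1 := subsetP X2X1 _ xX2.
  by apply: drop (pX x (subsetP X1X _ xX1)); move: xX1; rewrite inE => /andP[].
- move=> y yY2; have yY1 := subsetP Y2Y1 _ yY2.
  by apply: drop (pY y (subsetP Y1Y _ yY1)); move: yY1; rewrite inE => /andP[].
- move=> x xX2; have xX := subsetP X1X _ (subsetP X2X1 _ xX2).
  have := light x xX; set l := #|_|.
  have : 2 * Q * cdeg h x Y2 < #|Y2| by move: xX2; rewrite inE => /andP[].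
  have : #|[set y in Y2 | c x y \in h |: L]| <= cdeg h x Y2 + l.
    apply: leq_trans (leq_card_setU _ _); apply/subset_leq_card/subsetP => y.
    rewrite !inE => /andP[yY2 /orP[->|->]]; first by rewrite yY2.
    by rewrite (subsetP Y1Y) ?orbT // (subsetP Y2Y1).
  move=> l1 l2; rewrite [dens _.+1]/= -/a -/Q -/E => l3.
  have l4 : a * E * (2 * Q * l) <= a * E * #|Y2|.
    apply: (@leq_trans (2 * Q * a * E * l)).
      by rewrite mulnA [a * E * _]mulnC mulnA.
    by rewrite (leq_trans l3) // (leq_trans cY1) // -mulnA leq_mul2l cY2 orbT.
  have aE : 0 < a * E by rewrite !muln_gt0 E0.
  have l5 : 2 * Q * l <= #|Y2| by rewrite -(leq_pmul2l aE).
  by have := leq_mul (leqnn Q) l1; move: l2 l5; clear; lia.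
move=> D [k [X' [Y' [[sX sY cX cY DD] [rb hX hY]]]]].
exists D, k, X', Y'; split; split => //.
- exact: subset_trans sX (subset_trans X2X1 X1X).
- exact: subset_trans sY (subset_trans Y2Y1 Y1Y).
- rewrite /= -/a -/Q -/E -!(mulnA a); apply: leq_trans cX1 _.
  rewrite leq_mul2l -mulnA; apply/orP; right.
  by apply: leq_trans cX2 _; rewrite leq_mul2l cX orbT.
- rewrite /= -/a -/Q -/E -!(mulnA a); apply: leq_trans cY1 _.
  rewrite leq_mul2l -mulnA; apply/orP; right.
  by apply: leq_trans cY2 _; rewrite leq_mul2l cY orbT.
- by apply: leq_trans DD _; rewrite leq_mul2l.
Qed.

End Robust.

Definition robust_for (T K : finType) (c : T -> T -> K) (pal : T -> {set K})
    (E D : nat) (h : K) (X Y : {set T}) : bool :=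
  [&& robust c E D h X Y, [forall x in X, h \in pal x] & [forall y in Y, h \in pal y]].

(** The pairs are treated one after another, and each must survive the shrinking caused by the later
    ones. So the regularity asked of the current pair contains the later shrinking [eta] and the
    final demand [G]; this is why [robust_pair] takes a function of the density. The lower bound
    [D0] ensures that later pairs only raise [D]. *)
Lemma robust_family (q m : nat) (G : nat -> nat) (ps : seq ('I_m * 'I_m)) :
  {homo G : a b / a <= b} -> (forall D, 0 < G D) -> all (fun p => p.1 != p.2) ps ->
  exists eta B : nat -> nat, (forall D0, 0 < eta D0) /\
  forall (T K : finType) (c : T -> T -> K) (pal : T -> {set K}) (W : {set T}),
    {in W &, forall x y, (c x y \in pal x) && (c x y \in pal y)} ->
    {in W, forall x, #|pal x| <= q} ->
  forall D0 (V : 'I_m -> {set T}), (forall a, V a \subset W) -> (forall a, V a != set0) ->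
  exists (V' : 'I_m -> {set T}) D, [/\ D0 <= D <= B D0, forall a, V' a \subset V a,
    forall a, #|V a| <= eta D0 * #|V' a| &
    all (fun p => [exists h, robust_for c pal (G D) D h (V' p.1) (V' p.2)]) ps].
Proof.
move=> Gm G0; elim: ps => [_|[a b] ps IH /= /andP[ab /IH [eta [B [eta0 HB]]]]].
  exists (fun=> 1), id; split=> // T K c pal W _ _ D0 V _ _.
  by exists V, D0; split=> // [|a]; rewrite ?leqnn ?mul1n.
pose g D0 D := eta (maxn D D0) * G (B (maxn D D0)).
have g0 D0 D : 0 < g D0 D by rewrite muln_gt0 eta0 G0.
pose M D0 := maxn (2 * dens (g D0) q) D0.
(* Nothing is known about monotonicity of [eta] and [B], so the sum over all admissible arguments
   serves as upper bound. *)
exists (fun D0 => shrink (g D0) q * \sum_(i < (M D0).+1) eta i),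
       (fun D0 => \sum_(i < (M D0).+1) B i).
have sumM (F : nat -> nat) D0 D : D <= M D0 -> F D <= \sum_(i < (M D0).+1) F i.
  by move=> DM; rewrite (bigD1 (inord D)) //= inordK // leq_addr.
split=> [D0|T K c pal W palP pal_le D0 V VW V0].
  by rewrite muln_gt0 shrink_gt0 //; apply: leq_trans (eta0 0) (sumM eta D0 0 _).
have [|||D [h [X [Y [[sX sY cX cY DD] [rb hX hY]]]]]] :=
    robust_pair palP (g0 D0) (L := set0) (VW a) (VW b) (V0 a) (V0 b) (r := q).
- by move=> x xV; rewrite setD0 pal_le // (subsetP (VW a)).
- by move=> x xV; rewrite setD0 pal_le // (subsetP (VW b)).
- move=> x xV; rewrite (_ : [set _ in _ | _] = set0) ?cards0 ?muln0 //.
  by apply/setP => y; rewrite !inE andbF.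
pose V1 i := if i == a then X else if i == b then Y else V i.
have V1V i : V1 i \subset V i.
  by rewrite /V1; case: eqP => [->|_] //; case: eqP => [->|_].
have cV1 i : #|V i| <= shrink (g D0) q * #|V1 i|.
  rewrite /V1; case: eqP => [->|_] //; case: eqP => [->|_] //.
  by rewrite leq_pmull ?shrink_gt0.
have [i|i|V' [D' [/andP[DD' D'B] V'1 cV' rbV']]] := HB T K c pal W palP pal_le (maxn D D0) V1.
- exact: subset_trans (V1V i) (VW i).
- rewrite -card_gt0; apply: pos_of_leq_mul (cV1 i); by rewrite card_gt0.
have DM : maxn D D0 <= M D0 by rewrite /M geq_max !leq_max DD leqnn orbT.
have V1a : V1 a = X by rewrite /V1 eqxx.
have V1b : V1 b = Y by rewrite /V1 eqxx eq_sym (negPf ab).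
move: DD'; rewrite geq_max => /andP[DD' D0D'].
exists V', D'; split.
- by rewrite D0D' /=; apply: leq_trans D'B (sumM B _ _ DM).
- by move=> i; apply: subset_trans (V'1 i) (V1V i).
- move=> i; apply: leq_trans (cV1 i) _; rewrite -mulnA leq_mul2l; apply/orP; right.
  by apply: leq_trans (cV' i) _; rewrite leq_mul2r (sumM eta _ _ DM) orbT.
- rewrite /= rbV' andbT; apply/existsP; exists h.
  have sa : V' a \subset X by rewrite -V1a.
  have sb : V' b \subset Y by rewrite -V1b.
  apply/and3P; split.
  + apply: (robust_sub rb sa sb) DD'; rewrite -?V1a -?V1b ?cV' //.
    by rewrite leq_mul2l Gm ?orbT.
  + by apply/forall_inP => x /(subsetP sa) /hX.
  + by apply/forall_inP => x /(subsetP sb) /hY.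
Qed.

(** * A local Ramsey theorem with linear bound *)

Definition nbrs (G : sgraph) (x : G) : {set G} := [set y | adj x y].

Lemma card_nbrs (G : sgraph) (x : G) : #|nbrs x| <= max_degree G.
Proof. exact: (leq_bigmax x). Qed.

Lemma proper_coloring (G : sgraph) (I : finType) (P : {set I}) :
  max_degree G < #|P| ->
  exists2 col : G -> I, forall x, col x \in P & forall x y, adj x y -> col x != col y.
Proof.
move=> dP.
suff /(_ setT) [col cP pr] : forall S : {set G}, exists2 col : G -> I,
    forall x, col x \in P & {in S &, forall x y, adj x y -> col x != col y}.
  by exists col => // x y; apply: pr; rewrite inE.
move=> S; move: {2}#|S| (erefl #|S|) => n; elim: n S => [|n IH] S cS.
  have /set0Pn [i iP] : P != set0 by rewrite -card_gt0; lia.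
  exists (fun=> i) => // x y; by rewrite (cards0_eq cS) inE.
have /set0Pn [x xS] : S != set0 by rewrite -card_gt0 cS.
have [|col colP pr] := IH (S :\ x); first by move: cS; rewrite (cardsD1 x) xS => -[].
have /subsetPn [i iP ic] : ~~ (P \subset col @: nbrs x).
  apply: contraL dP => /subset_leq_card; rewrite -leqNgt => le.
  by apply: leq_trans le (leq_trans (leq_imset_card _ _) (card_nbrs x)).
exists (fun y => if y == x then i else col y) => [y|y z yS zS yz].
  by case: ifP.
have ne : y != z by apply: contraTneq yz => ->; rewrite adj_irrefl.
case: (eqVneq y x) yz ne => [->|yx] yz ne; case: (eqVneq z x) => zx.
- by rewrite zx eqxx in ne.
- by apply: contraNneq ic => ->; apply: imset_f; rewrite inE.
- rewrite eq_sym; apply: contraNneq ic => ->; apply: imset_f; rewrite inE adj_sym.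
  by rewrite -zx.
- by apply: pr; rewrite ?inE ?yx ?zx.
Qed.

Section Embedding.
Variables (G : sgraph) (T K : finType) (c : T -> T -> K) (I : nat).
Variables (col : G -> 'I_I) (V : 'I_I -> {set T}) (h : K) (dl D : nat) (x0 : T).
Hypothesis csym : forall x y, c x y = c y x.
Hypothesis colP : forall x y : G, adj x y -> col x != col y.
Hypothesis degG : max_degree G <= dl.
Hypothesis D0 : 0 < D.
Let E := 2 * dl.+1 * D ^ dl.
Hypothesis rbV : forall x y : G, col x < col y -> robust c E D h (V (col x)) (V (col y)).
Hypothesis Vbig : forall x : G, 2 * D ^ dl * #|G| <= #|V (col x)|.

Definition cand (f : G -> T) (S : {set G}) (y : G) : {set T} :=
  [set v in V (col y) | [forall x in S, adj x y ==> (c (f x) v == h)]].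

(** Vertices are embedded in the order of their colours, so every unembedded neighbour lies in a
    later part and one-sided regularity suffices. Each embedded neighbour shrinks a candidate set by
    a factor of at most [D]. *)
Lemma greedy_embedding (S : {set G}) :
  {in S, forall x, {in ~: S, forall y, col x <= col y}} ->
  exists f : G -> T, [/\ {in S &, injective f}, {in S, forall x, f x \in V (col x)},
    {in S &, forall x y, adj x y -> c (f x) (f y) = h} &
    {in ~: S, forall y, #|V (col y)| <= D ^ #|S :&: nbrs y| * #|cand f S y|}].
Proof.
move: {2}#|S| (erefl #|S|) => n; elim: n S => [|n IH] S cS down.
  rewrite (cards0_eq cS); exists (fun=> x0); split=> [x y|x|x y|y _]; rewrite ?inE //.
  rewrite set0I cards0 expn0 mul1n; apply/subset_leq_card/subsetP => v vV.
  by rewrite inE vV /=; apply/forall_inP => x; rewrite inE.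
have /set0Pn [z0 z0S] : S != set0 by rewrite -card_gt0 cS.
case: (@arg_maxnP _ z0 (mem S) (fun x => col x) z0S) => x xS0 xmax.
have {xS0} xS : x \in S := xS0.
set S' := S :\ x.
have S'S y : y \in S' -> y \in S by rewrite inE => /andP[].
have cS' : #|S'| = n by move: cS; rewrite (cardsD1 x) xS => -[].
have [|f [finj fV fE fC]] := IH S' cS'.
  move=> y /S'S yS z; rewrite !inE negb_and negbK => /predU1P[->|zS].
    exact: xmax.
  by apply: (down y yS); rewrite inE.
have xS' : x \in ~: S' by rewrite !inE eqxx.
have S'N y : y \notin S -> y \in ~: S' by move=> yS; rewrite !inE negb_and yS orbT.
pose N := nbrs x :\: S.
have cN : #|N| <= dl.
  apply: leq_trans degG; apply: leq_trans (card_nbrs x).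
  exact/subset_leq_card/subsetDl.
pose bad y := [set v in V (col x) | D * cdeg c h v (cand f S' y) < #|cand f S' y|].
have expD y : D ^ #|S' :&: nbrs y| <= D ^ dl.
  apply: leq_pexp2l => //; apply: leq_trans degG; apply: leq_trans (card_nbrs y).
  exact/subset_leq_card/subsetIr.
have badE y : y \in N -> E * #|bad y| < #|V (col x)|.
  rewrite !inE => /andP[yS xy].
  have lt : col x < col y.
    rewrite ltn_neqAle (down x xS y) ?inE // andbT; exact: colP xy.
  have /forallP /(_ (cand f S' y)) := rbV lt; move/implyP; apply.
  apply/andP; split; first by apply/subsetP => v; rewrite inE => /andP[].
  apply: leq_trans (fC y (S'N y yS)) _; rewrite leq_mul2r; apply/orP; right.
  by apply: leq_trans (expD y) _; rewrite leq_pmull.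
pose badU := \bigcup_(y in N) bad y.
(* The factor [2 * dl.+1] of [E] is spent here: the later neighbours spoil at most half of the
   smallest possible candidate set, and [Vbig] reserves the other half for injectivity. *)
have cbadU : 2 * D ^ dl * #|badU| <= #|V (col x)|.
  suff: dl.+1 * (2 * D ^ dl * #|badU|) <= dl.+1 * #|V (col x)| by rewrite leq_pmul2l.
  have : E * #|badU| <= #|N| * #|V (col x)|.
    rewrite -sum_nat_const; apply: (@leq_trans (\sum_(y in N) E * #|bad y|)).
      rewrite -big_distrr leq_mul2l /badU; apply/orP; right.
      elim/big_rec2: _ => [|y u A yN le]; first by rewrite cards0.
      by apply: leq_trans (leq_card_setU _ _) _; rewrite leq_add2l.
    by apply: leq_sum => y /badE /ltnW.
  rewrite mulnA [dl.+1 * _]mulnA [dl.+1 * 2]mulnC -/E => le; apply: leq_trans le _.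
  by rewrite leq_mul2r (leq_trans cN) ?orbT.
have cused : #|f @: S'| < #|G|.
  apply: leq_ltn_trans (leq_imset_card _ _) _; rewrite cS' -ltnS -cS ltnS.
  exact: max_card.
have [v vC vB] : exists2 v, v \in cand f S' x & v \notin badU :|: f @: S'.
  apply/subsetPn; apply/negP => /subset_leq_card le.
  have le2 := leq_trans le (leq_card_setU _ _).
  have le3 := leq_trans (fC x xS') (leq_mul (expD x) le2).
  have D1 : 0 < D ^ dl by rewrite expn_gt0 D0.
  have := Vbig x; move: cbadU le3 cused D1.
  set e := D ^ dl; set a := #|badU|; set b := #|f @: S'|; set g := #|G|.
  set w := #|V _|; clear => h1 h2 h3 h4 h5.
  have := leq_mul (leqnn (2 * e)) h3; nia.
have vV : v \in V (col x) by move: vC; rewrite inE => /andP[].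
have vh y : y \in S' -> adj y x -> c (f y) v = h.
  by move: vC; rewrite inE => /andP[_ /forall_inP C] yS' yx; have := C y yS'; rewrite yx => /eqP.
move: vB; rewrite inE negb_or => /andP[vB vS'].
pose f' y := if y == x then v else f y.
have f'x : f' x = v by rewrite /f' eqxx.
have f'S y : y \in S' -> f' y = f y by rewrite /f' !inE => /andP[/negPf ->].
have SP y : y \in S -> y = x \/ y \in S'.
  by move=> yS; rewrite inE in_set1 yS andbT; case: eqP; [left|right].
exists f'; split.
- move=> y z /SP[->|yS'] /SP[->|zS'] //; rewrite ?f'x ?f'S //.
  + by move=> vz; case/negP: vS'; rewrite vz imset_f.
  + by move=> vz; case/negP: vS'; rewrite -vz imset_f.
  + exact: finj.
- by move=> y /SP[->|yS']; rewrite ?f'x ?f'S //; apply: fV.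
- move=> y z /SP[->|yS'] /SP[->|zS'] yz; rewrite ?f'x ?f'S //.
  + by rewrite adj_irrefl in yz.
  + by rewrite csym vh // adj_sym.
  + exact: vh.
  + exact: fE.
- move=> y; rewrite inE => yS.
  have yx : (y == x) = false by apply: contraNF yS => /eqP ->.
  case xy: (adj x y); last first.
    rewrite (_ : S :&: nbrs y = S' :&: nbrs y); last first.
      apply/setP => z; rewrite !inE; case: eqP => //= ->.
      by rewrite adj_sym xy !andbF.
    rewrite (_ : cand f' S y = cand f S' y); first exact: fC (S'N y yS).
    apply/setP => w; rewrite !inE; congr (_ && _); apply/forall_inP/forall_inP.
      by move=> C z zS'; have := C z (S'S z zS'); rewrite f'S.
    by move=> C z /SP[->|zS']; [rewrite xy|rewrite f'S //; apply: C].
  have yN : y \in N by rewrite !inE yS.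
  have : v \notin bad y by apply: contra vB => vb; apply/bigcupP; exists y.
  rewrite inE vV /= -leqNgt => deg.
  rewrite (cardsD1 x) !inE xS adj_sym xy /= add1n.
  rewrite (_ : (S :&: nbrs y) :\ x = S' :&: nbrs y); last by rewrite setIDAC.
  rewrite expnSr -mulnA; apply: leq_trans (fC y (S'N y yS)) _.
  rewrite leq_mul2l; apply/orP; right; apply: leq_trans deg _.
  rewrite leq_mul2l; apply/orP; right; apply/subset_leq_card/subsetP => w.
  rewrite !inE => /andP[/andP[-> /forall_inP C] /eqP vw] /=.
  apply/forall_inP => z /SP[->|zS']; first by rewrite f'x vw eqxx implybT.
  by rewrite f'S //; apply: C.
Qed.

End Embedding.

(** The colour of a robust pair of parts lies in the palette of each of their vertices, so the
    induced colouring of the indices is local with the same [q]. A monochromatic set of [dl.+1]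
    parts then carries a proper colouring of [G]. *)
Lemma linear_local_ramsey (dl q : nat) :
  exists C, forall (G : sgraph) (T K : finType) (c : T -> T -> K) (W : {set T}),
    (forall x y, c x y = c y x) -> max_degree G <= dl -> 0 < #|G| -> C * #|G| <= #|W| ->
    {in W, forall x, #|[set c x y | y in W]| <= q} ->
  exists f : G -> T, [/\ injective f, forall x, f x \in W &
    exists h, forall x y, adj x y -> c (f x) (f y) = h].
Proof.
have [m Hm] := local_clique q dl.+1.
(* [D.-1.+1] equals [D] for positive [D] and keeps the demand positive at 0. *)
pose Gf D := 2 * dl.+1 * D.-1.+1 ^ dl.
pose ps : seq ('I_m * 'I_m) := [seq p : 'I_m * 'I_m <- enum predT | p.1 < p.2].
have [||| eta [B [eta0 HB]]] := @robust_family q m Gf ps.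
- move=> a b ab; rewrite leq_mul2l /=; case: (dl) => // n.
  by rewrite leq_exp2r //; lia.
- by move=> D; rewrite !muln_gt0 expn_gt0.
- apply/allP => p; rewrite mem_filter => /andP[lt _].
  by apply: contraTneq lt => ->; rewrite ltnn.
pose s0 := eta 1 * (2 * (B 1).+1 ^ dl).
have s0_gt0 : 0 < s0 by rewrite !muln_gt0 eta0 expn_gt0.
exists s0 => G T K c W csym degG G0 cW loc.
pose pal x := [set c x y | y in W].
have palP : {in W &, forall x y, (c x y \in pal x) && (c x y \in pal y)}.
  by move=> x y xW yW; rewrite {2}csym !imset_f.
have W0 : W != set0 by rewrite -card_gt0 (leq_trans _ cW) // muln_gt0 s0_gt0.
(* All parts start as [W] itself and may overlap; the embedding takes care of injectivity. *)
have [V [D [/andP[D0 DB] VW cV /allP rb]]] :=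
  HB T K c pal W palP loc 1 (fun=> W) (fun=> subxx W) (fun=> W0).
have cVa a : 2 * D ^ dl * #|G| <= #|V a|.
  rewrite -(leq_pmul2l (eta0 1)); apply: leq_trans (cV a); apply: leq_trans cW.
  rewrite /s0 -!mulnA.
  rewrite !leq_mul2l leq_mul2r; apply/orP; right; apply/orP; right; apply/orP; right.
  by case: (dl) => // n; rewrite leq_exp2r // (leq_trans DB).
have V_ne a : exists x, x \in V a.
  by apply/set0Pn; rewrite -card_gt0; apply: leq_trans (cVa a); rewrite !muln_gt0 expn_gt0 D0.
have /set0Pn [x0 _] := W0.
have [k0 _] : exists k : K, true.
  by exists (c x0 x0).
pose rbf a b h := robust_for c pal (Gf D) D h (V a) (V b).
pose kap0 a b := odflt k0 [pick h | rbf a b h].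
pose kap (a b : 'I_m) := if a < b then kap0 a b else kap0 b a.
have kap0P (a b : 'I_m) : a < b -> rbf a b (kap0 a b).
  move=> ab; rewrite /kap0; case: pickP => [//|no].
  have /existsP [h] : [exists h, rbf a b h].
    by apply: (rb (a, b)); rewrite mem_filter ab mem_enum.
  by rewrite no.
have kap_sym a b : kap a b = kap b a.
  by rewrite /kap; case: ltngtP => // /val_inj ->.
have [||P [h [_ cP Ph]]] := Hm _ _ kap setT kap_sym.
- by rewrite cardsT card_ord.
- move=> a _; have [x xV] := V_ne a.
  have xW := subsetP (VW a) _ xV.
  apply: leq_trans (loc x xW); apply/subset_leq_card/subsetP => k /imsetP [b].
  rewrite !inE andbT => ba ->; rewrite /kap.
  case: ltngtP ba => [ab _|ba _|/val_inj ->]; last by rewrite eqxx.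
  + by have /and3P[_ /forall_inP hx _] := kap0P _ _ ab; apply: hx.
  + by have /and3P[_ _ /forall_inP hx] := kap0P _ _ ba; apply: hx.
have [|col colP colE] := @proper_coloring G 'I_m P; first by rewrite cP ltnS.
have [|||f [finj fV fE _]] := @greedy_embedding G T K c m col V h dl D x0
  csym colE degG D0 _ _ setT.
- move=> x y lt; have /and3P[r _ _] := kap0P _ _ lt.
  have : kap (col x) (col y) = h.
    by apply: Ph; rewrite ?colP //; apply: contraTneq lt => ->; rewrite ltnn.
  by rewrite /kap lt => <-; rewrite /Gf prednK in r.
- by move=> x; apply: cVa.
- by move=> x _ y; rewrite !inE.
exists f; split=> [x y|x|]; first exact: finj.
  by apply: (subsetP (VW (col x))); apply: fV.
by exists h => x y; apply: fE.
Qed.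

(** * Olson's theorem on sums of two sets, in multiplicative notation *)

Section Olson.
Local Open Scope group_scope.
Variable gT : finGroupType.
Hypothesis mulC : forall x y : gT, x * y = y * x.
Variable B : {set gT}.
Hypothesis B1 : 1 \in B.
Let H := <<B>>.

Local Notation "X '^B'" := (X * B)%g (at level 9, format "X '^B'").

Let frag (X : {set gT}) := [&& X \subset H, X != set0 & X * B != H].

Lemma sub_mulB (X : {set gT}) : X \subset X * B.
Proof. by apply/subsetP => x xX; rewrite -[x]mulg1 mem_mulg. Qed.

Lemma mulB_gen (X : {set gT}) : X \subset H -> X * B \subset H.
Proof. by move=> XH; rewrite mul_subG // subset_gen. Qed.

Lemma card_lcoset_mul (x : gT) (X : {set gT}) : #|(x *: X)^B| = #|X^B|.
Proof. by rewrite -mulgA card_lcoset. Qed.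

Lemma frag_lcoset (x : gT) (X : {set gT}) : x \in H -> frag X -> frag (x *: X).
Proof.
move=> xH /and3P[XH X0 XB]; apply/and3P; split.
- by rewrite mul_subG ?sub1set.
- by rewrite -card_gt0 card_lcoset card_gt0.
- apply: contraNneq XB => e.
  by rewrite eqEcard mulB_gen //= -(card_lcoset_mul x) e.
Qed.

(* A smallest fragment of minimal boundary, translated to contain 1, is a
   subgroup: it coincides with its translates meeting it by submodularity. *)
Lemma frag_boundary (X : {set gT}) : frag X -> (2 * #|X| + #|B| <= 2 * #|X^B|)%N.
Proof.
move=> fX.
pose bd (Y : {set gT}) := (#|Y^B| - #|Y|)%N.
have bdE Y : #|Y^B| = (bd Y + #|Y|)%N by rewrite subnK // subset_leq_card ?sub_mulB.
(* The weight compares boundaries first and sizes second. *)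
pose wt (Y : {set gT}) := (bd Y * #|gT|.+1 + #|Y|)%N.
case: (arg_minnP wt fX) => M0 fM0 minM0.
have /set0Pn [m mM0] : M0 != set0 by case/and3P: fM0.
have mH : m \in H by case/and3P: fM0 => /subsetP sub _ _; apply: sub.
pose M := m^-1 *: M0.
have fM : frag M by apply: frag_lcoset; rewrite ?groupV.
have M1 : 1 \in M by rewrite mem_lcoset invgK mulg1.
have cM : #|M| = #|M0| by rewrite card_lcoset.
have bdM : bd M = bd M0 by rewrite /bd card_lcoset_mul cM.
have minM Y : frag Y -> (bd M < bd Y)%N \/ bd M = bd Y /\ (#|M| <= #|Y|)%N.
  move=> fY; have := minM0 Y fY; rewrite /wt bdM cM.
  have : (#|Y| <= #|gT|)%N by apply: max_card.
  by clear; case: (ltngtP (bd M0) (bd Y)) => [|lt|->]; [left|nia|right; lia].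
have /and3P[MH M0' MB] := fM.
have MBH := mulB_gen MH.
(* The inverse of the complement of [M * B] is again a fragment, of boundary at most that of [M]; by
   minimality it is at least as large as [M]. *)
have cMH : (#|M| <= #|H :\: M^B|)%N /\ (#|M^B| + #|H :\: M^B| = #|H|)%N.
  have cH : (#|M^B| + #|H :\: M^B| = #|H|)%N.
    by rewrite -[#|H|](cardsID (M * B)) (setIidPr MBH).
  split=> //; pose Z := (H :\: M * B)^-1.
  have cZ : #|Z| = #|H :\: M^B| by rewrite card_invg.
  have ZH : Z \subset H.
    by apply/subsetP => x; rewrite inE => /setDP[]; rewrite groupV.
  have ZB : Z * B \subset H :\: M^-1.
    rewrite subsetD mulB_gen //= disjoint_subset; apply/subsetP => x.
    case/imset2P => z b; rewrite inE => /setDP[_ zM] bB ->.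
    rewrite inE /= mem_invg; apply: contra zM; rewrite invMg => bz.
    have -> : z^-1 = b^-1 * z^-1 * b by rewrite mulC mulKVg.
    exact: mem_mulg.
  have cMV : (#|H :\: M^-1| + #|M| = #|H|)%N.
    rewrite -[#|H|](cardsID M^-1) addnC (setIidPr _) ?card_invg //.
    by apply/subsetP => x; rewrite mem_invg => /(subsetP MH); rewrite groupV.
  have cZB : (#|Z^B| <= #|H :\: M^-1|)%N by apply: subset_leq_card.
  have fZ : frag Z.
    apply/and3P; split=> //.
      rewrite -card_gt0 cZ card_gt0 setD_eq0; apply: contraNN MB => HMB.
      by rewrite eqEsubset MBH.
    apply: contraTneq cZB => ->; rewrite -ltnNge -cMV -[X in (X < _)%N]addn0 ltn_add2l.
    by rewrite card_gt0.
  have := minM Z fZ; move: cH cMV cZB (bdE Z) (bdE M); rewrite cZ.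
  by move: (bd Z) (bd M); lia_cards.
(* A proper intersection would have larger boundary than [M], so by submodularity the union would
   have smaller boundary. It is then no fragment, its product with [B] is all of [H], and [cMH]
   excludes this. *)
have stabM g : g \in M -> g *: M = M.
  move=> gM; pose Y := g *: M; pose I := M :&: Y.
  have fY : frag Y by apply: frag_lcoset => //; apply: (subsetP MH).
  have cY : #|Y| = #|M| by rewrite card_lcoset.
  have cYB : #|Y^B| = #|M^B| by rewrite card_lcoset_mul.
  suff : #|M| <= #|I|.
    move=> le; apply/eqP; rewrite eq_sym eqEcard cY leqnn andbT.
    have /eqP IM : I == M by rewrite eqEcard subsetIl.
    by rewrite -{1}IM subsetIr.
  rewrite leqNgt; apply/negP => ltI.
  have gI : g \in I by rewrite inE gM mem_lcoset mulVg M1.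
  have fI : frag I.
    apply/and3P; split; first exact: subset_trans (subsetIl _ _) MH.
      by apply/set0Pn; exists g.
    apply: contraNneq MB => e; rewrite eqEsubset MBH -e.
    by apply: mulSg; apply: subsetIl.
  have sub1 : (#|I^B| + #|(M :|: Y)^B| <= #|M^B| + #|Y^B|)%N.
    have UB : (M :|: Y) * B \subset M * B :|: Y * B.
      apply/subsetP => x; case/imset2P => y b yMY bB ->.
      by apply/setUP; case/setUP: yMY => yM; [left|right]; apply: mem_mulg.
    have IB : I * B \subset M * B :&: Y * B.
      by rewrite subsetI !mulSg ?subsetIl ?subsetIr.
    move: (subset_leq_card UB) (subset_leq_card IB) (cardsUI (M * B) (Y * B)).
    by lia_cards.
  have cU : (#|M :|: Y| + #|I| = #|M| + #|Y|)%N by rewrite cardsUI.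
  have I0 : (0 < #|I|)%N by rewrite card_gt0; apply/set0Pn; exists g.
  have bI : (bd M < bd I)%N by case: (minM I fI) => // -[_]; rewrite leqNgt ltI.
  move: cMH sub1 cU I0 bI (bdE I) (bdE M) (bdE Y) (bdE (M :|: Y)); rewrite cY cYB.
  have [e|ne] := eqVneq ((M :|: Y) * B) H.
    by rewrite e; move: (bd I) (bd M) (bd Y) (bd (M :|: Y)); lia_cards.
  have fU : frag (M :|: Y).
    have /and3P[YH _ _] := fY.
    apply/and3P; split=> //; first by rewrite subUset MH.
    by apply/set0Pn; exists 1; rewrite inE M1.
  by move: (minM _ fU); move: (bd I) (bd M) (bd Y) (bd (M :|: Y)); lia_cards.
have gM : group_set M.
  apply/group_setP; split=> // x y xM yM.
  by rewrite -(stabM x xM) mem_lcoset mulKg.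
have [b bB bM] : exists2 b, b \in B & b \notin M.
  apply/subsetPn; apply: contraNN MB => BM; rewrite eqEsubset MBH /=.
  apply: subset_trans (sub_mulB M); rewrite -[M]/(gval (Group gM)) gen_subG //.
(* [B] is not inside the subgroup [M], so [M * B] contains two cosets of [M]. The boundary of [M] is
   therefore at least half of [M * B], hence at least half of [B]. *)
have c2 : (2 * #|M| <= #|M^B|)%N.
  have dj : [disjoint M & b *: M].
    rewrite disjoint_subset; apply/subsetP => x xM; rewrite inE /= mem_lcoset.
    apply: contra bM => bx; have xVM : x^-1 \in M by rewrite -[M]/(gval (Group gM)) groupV.
    rewrite -[b]invgK -[b^-1](mulgK x) -[M]/(gval (Group gM)) groupV groupM //.
  rewrite mul2n -addnn -{2}(card_lcoset M b) -cardsUI (eqP (_ : M :&: _ == set0)) ?setI_eq0 //.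
  rewrite cards0 addn0 subset_leq_card // subUset sub_mulB.
  by apply/subsetP => x /lcosetP [y yM ->]; rewrite mulC mem_mulg.
have cB : (#|B| <= #|M^B|)%N.
  by rewrite subset_leq_card //; apply/subsetP => x xB; rewrite -[x]mul1g mem_mulg.
by move: c2 cB (bdE X) (bdE M) (minM X fX); move: (bd M) (bd X); lia_cards.
Qed.

(** The part of [A] in a coset of [H] that its product with [B] meets but does not fill is, after
    translation, a fragment. The rest of [A] lies in other cosets and contributes its own size. *)
Lemma olson (A : {set gT}) :
  (2 * #|A| + #|B| <= 2 * #|A^B|)%N \/ A * B * H = A * B.
Proof.
have [e|ne] := eqVneq (A * B * H) (A * B); first by right.
left; have /subsetPn [x] : ~~ (A * B * H \subset A * B).
  apply: contraNN ne => sub; rewrite eqEsubset sub.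
  by apply/subsetP => y yAB; rewrite -[y]mulg1 mem_mulg ?group1.
case/imset2P => _ h /imset2P [a b aA bB ->] hH -> xAB.
pose A1 := A :&: a *: H; pose X := a^-1 *: A1.
have A1E : A1 = a *: X by rewrite /X -lcosetM mulgV mul1g.
have bH : b \in H by rewrite mem_gen.
have fX : frag X.
  apply/and3P; split.
  - by apply/subsetP => y; rewrite mem_lcoset invgK inE mem_lcoset mulKg => /andP[].
  - apply/set0Pn; exists 1; rewrite mem_lcoset invgK mulg1 inE aA.
    by rewrite mem_lcoset mulVg group1.
  - apply: contraNneq xAB => e; have : b * h \in X * B by rewrite e groupM.
    case/imset2P => y c; rewrite mem_lcoset invgK inE => /andP[yA _] cB e2.
    by rewrite -mulgA e2 mulgA mem_mulg.
have le1 := frag_boundary fX.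
have c1 : #|A1| = #|X| by rewrite A1E card_lcoset.
have c2 : #|A1^B| = #|X^B| by rewrite A1E card_lcoset_mul.
have c3 : #|A| = (#|A1| + #|A :\: a *: H|)%N by rewrite cardsID.
have : (#|A1^B| + #|A :\: a *: H| <= #|A^B|)%N.
  rewrite -cardsUI (eqP (_ : A1 * B :&: _ == set0)).
    rewrite cards0 addn0 subset_leq_card // subUset mulSg ?subsetIl //=.
    by apply: subset_trans (sub_mulB A); apply: subsetDl.
  rewrite -subset0; apply/subsetP => y /setIP[/imset2P [z c]].
  rewrite inE => /andP[_ zC] cB -> /setDP[_ /negP []].
  move: zC; rewrite !mem_lcoset mulgA => zH; rewrite groupM //.
  by rewrite mem_gen.
by move: le1 c1 c2 c3; lia_cards.
Qed.
End Olson.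

(** * Sumsets and stabilisers in a finite abelian group *)

Section Sumset.
Local Open Scope ring_scope.
Variable gam : finZmodType.
Implicit Types (A B : {set gam}) (H : {group gam}).

Definition sumset A B : {set gam} := [set a + b | a in A, b in B].

Definition stab A : {set gam} := [set g | [forall a in A, a + g \in A]].

Lemma stabP A g : reflect {in A, forall a, a + g \in A} (g \in stab A).
Proof. by rewrite inE; apply: forall_inP. Qed.

Lemma stab_group_set A : group_set (stab A).
Proof.
apply/group_setP; split; first by apply/stabP => a aA; rewrite addr0.
move=> x y /stabP sx /stabP sy; apply/stabP => a aA.
by rewrite -[(x * y)%g]/(x + y) addrA sy // sx.
Qed.
Canonical stab_group A : {group gam} := Group (stab_group_set A).

Lemma groupDr H x y : x \in H -> y \in H -> x + y \in H.
Proof. exact: groupM. Qed.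
Lemma groupNr H x : (- x \in H) = (x \in H).
Proof. exact: groupV. Qed.
Lemma groupBr H x y : x \in H -> y \in H -> x - y \in H.
Proof. by move=> xH yH; rewrite groupDr ?groupNr. Qed.
Lemma group0r H : 0 \in H.
Proof. exact: group1. Qed.
Lemma groupMnr H x m : x \in H -> x *+ m \in H.
Proof. by move=> xH; elim: m => [|m IH]; rewrite ?mulr0n ?group0r // mulrS groupDr. Qed.
Lemma group_sumr H (I : finType) (P : pred I) (F : I -> gam) :
  (forall i, P i -> F i \in H) -> \sum_(i | P i) F i \in H.
Proof. by move=> FH; elim/big_ind: _ => //; [exact: group0r|move=> x y; exact: groupDr]. Qed.

Lemma card_addr A g : #|[set a + g | a in A]| = #|A|.
Proof. by rewrite card_imset //; apply: addIr. Qed.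

Lemma stab_add A g a : g \in stab A -> (a + g \in A) = (a \in A).
Proof.
move=> gs; apply/idP/idP => [agA|]; last by move/stabP: gs; apply.
have /stabP sN : - g \in stab A by rewrite groupNr.
by have := sN _ agA; rewrite addrK.
Qed.

Lemma stab_sumset A B : stab A \subset stab (sumset A B).
Proof.
apply/subsetP => g /stabP gA; apply/stabP => _ /imset2P [a b aA bB ->].
by rewrite addrAC imset2_f ?gA.
Qed.

Lemma card_in_coset H A r : {in A, forall a, a - r \in H} -> (#|A| <= #|H|)%N.
Proof.
move=> AH; rewrite -(card_addr A (- r)) subset_leq_card //.
by apply/subsetP => _ /imsetP [a aA ->]; apply: AH.
Qed.

Lemma full_coset H A r : {in A, forall a, a - r \in H} -> #|A| = #|H| ->
  forall a, a - r \in H -> a \in A.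
Proof.
move=> AH cA a arH; have /eqP e : [set a + (- r) | a in A] == H.
  rewrite eqEcard card_addr cA leqnn andbT.
  by apply/subsetP => _ /imsetP [x xA ->]; apply: AH.
have : a - r \in [set a + (- r) | a in A] by rewrite e.
by case/imsetP => x xA /addIr ->.
Qed.

Lemma stab_proper H A r : A != set0 -> {in A, forall a, a - r \in H} ->
  (#|A| < #|H|)%N -> stab A \proper H.
Proof.
move=> /set0Pn [a0 a0A] AH lt; rewrite properE; apply/andP; split.
  apply/subsetP => g /stabP gA; have := AH _ (gA _ a0A) => e.
  have -> : g = (a0 + g - r) - (a0 - r).
    by rewrite opprB addrA subrK addrAC subrr add0r.
  exact: groupBr e (AH _ a0A).
apply/negP => /subsetP Hs; move: lt; rewrite ltnNge => /negP; apply.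
rewrite -(card_addr H a0) subset_leq_card //.
apply/subsetP => _ /imsetP [g gH ->]; rewrite addrC.
by have /stabP := Hs _ gH; apply.
Qed.

(** [A] is a union of cosets of its stabiliser. A point of [A] that [y - x] moves out of [A] takes
    its whole coset along, which gives new elements beside the translate of [A] by [x]. *)
Lemma sumset_pair A x y : y - x \notin stab A ->
  (#|A| + #|stab A| <= #|sumset A [set x; y]|)%N.
Proof.
rewrite inE negb_forall_in => /exists_inP [a0 a0A ne].
have -> : #|A| = #|[set a + x | a in A]| by rewrite card_addr.
have <- : #|[set g + (a0 + y) | g in stab A]| = #|stab A| by rewrite card_addr.
rewrite -cardsUI (_ : _ :&: _ = set0) ?cards0 ?addn0.
  apply/subset_leq_card/subsetP => u /setUP[] /imsetP [v vA ->].
    by apply: imset2_f => //; rewrite !inE eqxx.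
  rewrite addrA; apply: imset2_f; last by rewrite !inE eqxx orbT.
  by rewrite addrC stab_add.
apply/setP => u; rewrite !inE; apply/negP => /andP[/imsetP [a aA ->] /imsetP [g gs e]].
case/negP: ne; rewrite -(@stab_add A g) //.
suff -> : a0 + (y - x) + g = a by [].
by apply: (addIr x); rewrite e addrAC -[_ + x]addrA; rewrite subrK addrC.
Qed.

(** Olson's bound is applied to a translate of [B] through 0. In its exceptional case the sumset is
    stable under a group of at least [2 * kappa] elements; [A] is not, its stabiliser being too
    small, so the growth is still strict. *)
Lemma sumset_growth A B kappa : A != set0 -> (2 * kappa <= #|B|)%N -> (#|stab A| < kappa)%N ->
  (#|A| + kappa <= #|sumset A B|)%N \/
  ((#|A| < #|sumset A B|) && (kappa <= #|stab (sumset A B)|))%N.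
Proof.
move=> A0 cB sA.
have /set0Pn [b0 b0B] : B != set0.
  by rewrite -card_gt0; move: cB sA; lia_cards.
pose B' := [set b + (- b0) | b in B].
have cB' : #|B'| = #|B| by rewrite card_addr.
have B'0 : (1%g : gam) \in B'.
  by apply/imsetP; exists b0 => //; rewrite addrN.
have AB : sumset A B = [set x + b0 | x in (A * B')%g].
  apply/setP => x; apply/imset2P/imsetP => [[a b aA bB ->]|[_ /imset2P [a _ aA /imsetP [b bB ->] ->] ->]].
    exists (a + (b - b0)); last by rewrite addrA subrK.
    by apply: (mem_mulg (x := a)) => //; apply: imset_f.
  by exists a b => //; rewrite -[(a * _)%g]/(a + (b - b0)) addrA subrK.
have cAB : #|sumset A B| = #|(A * B')%g| by rewrite AB card_addr.
have [le|stb] := @olson gam (@addrC gam) B' B'0 A.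
  by left; rewrite cAB; move: le cB; rewrite cB'; lia_cards.
right.
have genS X : (X * <<B'>>)%g = X -> (2 * kappa <= #|stab X|)%N.
  move=> e; apply: leq_trans cB _; rewrite -cB' subset_leq_card //.
  apply/subsetP => b bB; apply/stabP => a aX; rewrite -e.
  by apply: (mem_mulg (x := a)) => //; apply: mem_gen.
have k1 : (kappa <= #|stab (sumset A B)|)%N.
  have s2 : stab (A * B')%g \subset stab (sumset A B).
    apply/subsetP => g /stabP gs; apply/stabP => x; rewrite AB => /imsetP [y yA ->].
    by rewrite addrAC; apply: (imset_f (fun x => x + b0)); apply: gs.
  move: (genS _ stb) (subset_leq_card s2); lia_cards.
rewrite k1 andbT ltnNge; apply/negP => le.
have AAB : A = (A * B')%g.
  apply/eqP; rewrite eqEcard -cAB le andbT.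
  by apply/subsetP => a aA; rewrite -[a]mulg1 mem_mulg.
by move: (genS A); rewrite {1 2}AAB => /(_ stb); move: sA; lia_cards.
Qed.

End Sumset.

(** * Sums over the edges of a graph *)

Section EdgeSums.
Local Open Scope ring_scope.
Variables (G : sgraph) (gam : zmodType).

Definition edge_pairs : {set G * G} :=
  [set p | adj p.1 p.2 && (enum_rank p.1 < enum_rank p.2)%N].

Definition esum (D : {set G}) (phi : G -> G -> gam) : gam :=
  \sum_(p in edge_pairs | (p.1 \in D) && (p.2 \in D)) phi p.1 p.2.

Lemma in_nbrs (x y : G) : (y \in nbrs x) = adj x y.
Proof. by rewrite inE. Qed.

Lemma sum_nbrs (phi : G -> G -> gam) :
  \sum_x \sum_(y in nbrs x) phi x y =
  \sum_(p in edge_pairs) (phi p.1 p.2 + phi p.2 p.1).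
Proof.
rewrite (pair_big_dep predT (fun x y => y \in nbrs x)) /= big_split /=.
rewrite (bigID (fun p : G * G => (enum_rank p.1 < enum_rank p.2)%N)) /=.
congr (_ + _); first by apply: eq_bigl => p; rewrite !inE.
rewrite (reindex_inj (h := fun p : G * G => (p.2, p.1))); last by move=> [a b] [c d] [-> ->].
apply: eq_bigl => -[x y] /=; rewrite !inE /= adj_sym; case xy: (adj x y) => //=.
rewrite -leqNgt leq_eqVlt; case: eqP => // /val_inj /enum_rank_inj e.
by rewrite e adj_irrefl in xy.
Qed.

Lemma handshake (w : G -> gam) :
  \sum_(p in edge_pairs) (w p.1 + w p.2) = \sum_x w x *+ degree x.
Proof.
rewrite -(sum_nbrs (fun x _ => w x)); apply: eq_bigr => x _.
by rewrite sumr_const.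
Qed.

(** The neighbours of [Z] lie in its complement, so [Z] is independent and an edge not inside [D]
    has exactly one end in [Z]. *)
Lemma esum_split (D Z : {set G}) (phi : G -> G -> gam) :
  (forall x y, phi x y = phi y x) -> D = ~: Z -> {in Z, forall z, nbrs z \subset D} ->
  \sum_(p in edge_pairs) phi p.1 p.2 =
  esum D phi + \sum_(z in Z) \sum_(y in nbrs z) phi z y.
Proof.
move=> sym DZ ZD.
have -> : \sum_(z in Z) \sum_(y in nbrs z) phi z y =
    \sum_x \sum_(y in nbrs x) (if x \in Z then phi x y else 0).
  rewrite big_mkcond; apply: eq_bigr => x _; case: (x \in Z) => //.
  by rewrite big1.
rewrite sum_nbrs /esum big_mkcondr -big_split /=; apply: eq_bigr => -[x y] /=.
rewrite inE /= => /andP[xy _]; rewrite DZ !inE.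
case xZ: (x \in Z); case yZ: (y \in Z); rewrite /= ?addr0 ?add0r //.
by have /subsetP /(_ y) := ZD x xZ; rewrite in_nbrs DZ inE yZ => /(_ xy).
Qed.

Lemma edges_pairs : edges G = [set [set p.1; p.2] | p in edge_pairs].
Proof.
apply/setP => A; apply/imsetP/imsetP => -[[x y]]; rewrite !inE /=.
- move=> xy ->; case: (ltngtP (enum_rank x) (enum_rank y)) => [lt|lt|].
  + by exists (x, y); rewrite // inE /= xy.
  + by exists (y, x); [rewrite inE /= adj_sym xy|rewrite /= setUC].
  + by move=> /val_inj /enum_rank_inj e; rewrite e adj_irrefl in xy.
- by move=> /andP[xy _] ->; exists (x, y); rewrite ?inE.
Qed.

Lemma pair_set_inj : {in edge_pairs &, injective (fun p : G * G => [set p.1; p.2])}.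
Proof.
move=> [x y] [x' y']; rewrite !inE /= => /andP[_ lt] /andP[_ lt'] e.
have : x \in [set x'; y'] by rewrite -e !inE eqxx.
have : y \in [set x'; y'] by rewrite -e !inE eqxx orbT.
rewrite !inE => /orP[]/eqP ey /orP[]/eqP ex; subst => //.
- by rewrite ltnn in lt.
- by move: (ltn_trans lt lt'); rewrite ltnn.
- by rewrite ltnn in lt.
Qed.

Lemma card_edge_pairs : #|edge_pairs| = #|edges G|.
Proof. by rewrite edges_pairs card_in_imset //; apply: pair_set_inj. Qed.

End EdgeSums.

(** * Partial embeddings with free centres *)

Section State.
Local Open Scope ring_scope.
Variables (G : sgraph) (T : finType) (gam : finZmodType) (k : T -> T -> gam).
Variable good : rel T.

(* D is embedded by f; the vertices of Z, whose neighbours are all embedded,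
   are still free to move inside U, and A lists values that the sum of the
   colours of the edges at Z can take. *)
Definition state (D Z : {set G}) (f : G -> T) (U : {set T}) (A : {set gam}) : Prop :=
  [/\ {in D &, injective f} /\ f @: D \subset U,
      [disjoint D & Z] /\ {in Z, forall z, nbrs z \subset D},
      {in D &, forall x y, adj x y -> good (f x) (f y)} &
      {in A, forall a, exists xi : G -> T, [/\ {in Z &, injective xi},
        {in Z, forall z, xi z \in U :\: f @: D} &
        \sum_(z in Z) \sum_(y in nbrs z) k (xi z) (f y) = a]}].

Lemma state_subset D Z f U (A B : {set gam}) :
  B \subset A -> state D Z f U A -> state D Z f U B.
Proof. by move=> BA [h1 h2 h3 h4]; split=> // a /(subsetP BA); apply: h4. Qed.

Lemma state0 f : state set0 set0 f set0 [set 0].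
Proof.
split.
- by split; [move=> x y; rewrite inE|rewrite imset0 sub0set].
- by split; [rewrite -setI_eq0 setI0|move=> x; rewrite inE].
- by move=> x y; rewrite inE.
- move=> a; rewrite inE => /eqP ->; exists f; split.
  + by move=> x y; rewrite inE.
  + by move=> x; rewrite inE.
  + by rewrite big_set0.
Qed.

Lemma sum_centers_eq (Z D : {set G}) (f f' : G -> T) (F : G -> T -> gam) :
  {in Z, forall z, nbrs z \subset D} -> {in D, f' =1 f} ->
  \sum_(z in Z) \sum_(y in nbrs z) F z (f' y) = \sum_(z in Z) \sum_(y in nbrs z) F z (f y).
Proof.
move=> ZD ff'; apply: eq_bigr => z zZ; apply: eq_bigr => y yz.
by rewrite ff' // (subsetP (ZD z zZ)).
Qed.

(** [U] also contains the positions held in reserve for [Z]. New images avoid all of [U], so every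
    choice [xi] that realises a value of [A] stays available. *)
Lemma place D Z f U A (I : finType) (w : I -> G) (y : I -> T) :
  state D Z f U A -> injective w -> injective y ->
  (forall i, w i \notin D :|: Z) -> (forall i, y i \notin U) ->
  (forall i j, adj (w i) (w j) -> good (y i) (y j)) ->
  (forall x i, x \in D -> adj x (w i) -> good (f x) (y i) && good (y i) (f x)) ->
  exists f', [/\ {in D, f' =1 f}, forall i, f' (w i) = y i &
    state (D :|: w @: predT) Z f' (U :|: y @: predT) A].
Proof.
move=> [[finj fU] [DZ ZD] fgood fA] winj yinj wN yN gw gD.
pose f' x := if [pick i | w i == x] is Some i then y i else f x.
have f'w i : f' (w i) = y i.
  by rewrite /f'; case: pickP => [j /eqP /winj ->|/(_ i)] //; rewrite eqxx.
have f'D : {in D, f' =1 f}.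
  move=> x xD; rewrite /f'; case: pickP => // i /eqP e.
  by have := wN i; rewrite e inE xD.
have wP x : x \in D :|: w @: predT -> x \in D \/ exists i, x = w i.
  by case/setUP => [|/imsetP [i _ ->]]; [left|right; exists i].
have fDU x : x \in D -> f x \in U by move=> xD; rewrite (subsetP fU) // imset_f.
exists f'; split=> //; split.
- split.
    move=> x x' /wP [xD|[i ->]] /wP [x'D|[j ->]]; rewrite ?f'w ?f'D //.
    + exact: finj.
    + by move=> e; have := yN j; rewrite -e fDU.
    + by move=> e; have := yN i; rewrite e fDU.
    + by move=> /yinj ->.
  apply/subsetP => _ /imsetP [x /wP [xD|[i ->]] ->]; rewrite inE.
    by rewrite f'D // fDU.
  by rewrite f'w imset_f ?orbT.
- split; last by move=> z /ZD zD; apply: subset_trans zD (subsetUl _ _).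
  rewrite disjoint_subset; apply/subsetP => x /wP [xD|[i ->]]; rewrite inE /=.
    by move: DZ; rewrite disjoint_subset => /subsetP /(_ x xD); rewrite inE.
  by have := wN i; rewrite inE negb_or => /andP[].
- move=> x x' /wP [xD|[i ->]] /wP [x'D|[j ->]] xx'; rewrite ?f'w ?f'D //.
  + exact: fgood.
  + by have /andP[] := gD _ _ xD xx'.
  + by rewrite adj_sym in xx'; have /andP[] := gD _ _ x'D xx'.
  + exact: gw.
- move=> a /fA [xi [xinj xU xs]]; exists xi; split=> //; last first.
    by rewrite (@sum_centers_eq Z D f f' (fun z t => k (xi z) t)).
  move=> z zZ; have := xU z zZ; rewrite !inE => /andP[xf ->]; rewrite andbT.
  apply: contra xf => /imsetP [x /wP [xD|[i ->]] e].
    by rewrite e f'D // imset_f.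
  by have := yN i; rewrite -f'w -e; have := xU z zZ; rewrite inE => /andP[_ ->].
Qed.

(** The candidates [O] are new, so the position of [z] is independent of those of the earlier
    centres and the attainable sums add as sets. *)
Lemma place_center D Z f U A (z : G) (O : {set T}) :
  state D Z f U A -> z \notin D :|: Z -> nbrs z \subset D -> [disjoint O & U] ->
  state D (z |: Z) f (U :|: O) (sumset A [set \sum_(y in nbrs z) k x (f y) | x in O]).
Proof.
move=> [[finj fU] [DZ ZD] fgood fA]; rewrite inE negb_or => /andP[zD zZ] nz OU.
split=> //; first by split=> //; apply: subset_trans fU (subsetUl _ _).
- split; last by move=> x /setU1P [->|/ZD].
  by rewrite disjoint_sym disjoint_subset; apply/subsetP => x /setU1P [->|xZ];
    rewrite inE //=; move: DZ; rewrite disjoint_sym disjoint_subset => /subsetP /(_ x xZ); rewrite inE.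
- move=> _ /imset2P [a _ /fA [xi [xinj xU <-]] /imsetP [x xO ->] ->].
  have xNU : x \notin U by move: OU; rewrite disjoint_subset => /subsetP /(_ x xO); rewrite inE.
  have ne y : y \in Z -> (y == z) = false.
    by move=> yZ; apply: contraNF zZ => /eqP <-.
  exists (fun y => if y == z then x else xi y); split.
  + have xiU y : y \in Z -> xi y \in U by move=> /xU; rewrite inE => /andP[].
    move=> y y' /setU1P [->|yZ] /setU1P [->|y'Z]; rewrite ?eqxx ?ne //.
    * by move=> e; case/negP: xNU; rewrite e xiU.
    * by move=> e; case/negP: xNU; rewrite -e xiU.
    * exact: xinj.
  + move=> y /setU1P [->|yZ]; rewrite ?eqxx ?ne //.
      rewrite !inE xO orbT andbT; apply: contra xNU; exact: (subsetP fU).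
    by have := xU y yZ; rewrite !inE => /andP[-> ->].
  + rewrite big_setU1 //= eqxx addrC; congr (_ + _); apply: eq_bigr => y yZ.
    by rewrite ne.
Qed.

(* A state in which every vertex is placed yields a zero-sum copy as soon as A
   contains the opposite of the sum over the edges inside D. *)
Lemma state_copy D Z f U A : (forall x y, k x y = k y x) ->
  state D Z f U A -> D = ~: Z -> - esum D (fun x y => k (f x) (f y)) \in A ->
  exists2 F : G -> T, injective F &
    \sum_(p in edge_pairs G) k (F p.1) (F p.2) = 0.
Proof.
move=> ksym [[finj fU] [DZ ZD] _ fA] DE /fA [xi [xinj xU xs]].
exists (fun x => if x \in Z then xi x else f x).
  move=> x y; case xZ: (x \in Z); case yZ: (y \in Z).
  - exact: xinj.
  - move=> e; have := xU x xZ; rewrite inE e imset_f //.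
    by rewrite DE inE yZ.
  - move=> e; have := xU y yZ; rewrite inE -e imset_f //.
    by rewrite DE inE xZ.
  - by apply: finj; rewrite DE inE ?xZ ?yZ.
rewrite (@esum_split _ _ D Z (fun x y => k (if x \in Z then xi x else f x)
  (if y \in Z then xi y else f y))) //.
have NZ y : y \in D -> (y \in Z) = false by rewrite DE inE => /negPf.
rewrite [X in X + _](_ : _ = esum D (fun x y => k (f x) (f y))); last first.
  by apply: eq_bigr => -[x y] /= /andP[_ /andP[xD yD]]; rewrite !NZ.
rewrite (_ : \sum_(z in Z) _ = \sum_(z in Z) \sum_(y in nbrs z) k (xi z) (f y)); last first.
  apply: eq_bigr => z zZ; apply: eq_bigr => y yz; rewrite zZ NZ //.
  exact: (subsetP (ZD z zZ)).
by rewrite xs addrN.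
Qed.

End State.

(** * Abelian group identities by reflection *)

Section ZmodReflect.
Local Open Scope ring_scope.

Inductive zexp := ZVar of nat | ZAdd of zexp & zexp | ZOpp of zexp | ZNull.

Fixpoint zcoef (e : zexp) (i : nat) : int :=
  match e with
  | ZVar j => if i == j then 1 else 0
  | ZAdd a b => zcoef a i + zcoef b i
  | ZOpp a => - zcoef a i
  | ZNull => 0
  end.

Variable V : zmodType.

Fixpoint zval (env : seq V) (e : zexp) : V :=
  match e with
  | ZVar j => env`_j
  | ZAdd a b => zval env a + zval env b
  | ZOpp a => - zval env a
  | ZNull => 0
  end.

Lemma zvalE env e : zval env e = \sum_(i < size env) env`_i *~ zcoef e i.
Proof.
elim: e => [j|a IHa b IHb|a IHa|] /=; rewrite ?IHa ?IHb.
- case: (ltnP j (size env)) => [js|sj].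
    rewrite (bigD1 (Ordinal js)) //= eqxx mulr1z big1 ?addr0 // => i ne.
    by rewrite -[_ == j]/(i == Ordinal js) (negPf ne) mulr0z.
  rewrite nth_default // big1 // => i _; rewrite ltn_eqF ?mulr0z //.
  exact: leq_trans (ltn_ord i) sj.
- by rewrite -big_split; apply: eq_bigr => i _; rewrite mulrzDr.
- by rewrite -sumrN; apply: eq_bigr => i _; rewrite mulrNz.
- by rewrite big1 // => i _; rewrite mulr0z.
Qed.

Lemma zval_eq env a b :
  all (fun i => zcoef a i == zcoef b i) (iota 0 (size env)) -> zval env a = zval env b.
Proof.
move=> /allP H; rewrite !zvalE; apply: eq_bigr => i _.
by have /H/eqP -> : (i : nat) \in iota 0 (size env) by rewrite mem_iota /=.
Qed.
End ZmodReflect.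

Ltac zfind x env :=
  match env with
  | cons x _ => constr:(0)
  | cons _ ?l => let n := zfind x l in constr:(n.+1)
  end.

Ltac zadd x env :=
  match env with
  | context [cons x _] => env
  | _ => constr:(cons x env)
  end.

Ltac zatoms t env :=
  match t with
  | (?a + ?b)%R => let e := zatoms a env in zatoms b e
  | (- ?a)%R => zatoms a env
  | (0)%R => env
  | _ => zadd t env
  end.

Ltac zreify t env :=
  match t with
  | (?a + ?b)%R => let x := zreify a env in let y := zreify b env in constr:(ZAdd x y)
  | (- ?a)%R => let x := zreify a env in constr:(ZOpp x)
  | (0)%R => constr:(ZNull)
  | _ => let n := zfind t env in constr:(ZVar n)
  end.

(* Abelian group identities by reflection; atoms are matched syntactically. *)
Ltac zmod_eq :=
  match goal with
  | |- @eq ?T ?a ?b =>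
    let e0 := zatoms a (@nil T) in let env := zatoms b e0 in
    let x := zreify a env in let y := zreify b env in
    exact (@zval_eq _ env x y isT)
  end.

Lemma mem_eq (gam : finZmodType) (H : {group gam}) (x y : gam) : x \in H -> y = x -> y \in H.
Proof. by move=> xH ->. Qed.

Lemma greedy_choice (I T : finType) (F : I -> {set T}) (ok : rel T) (b : nat) (x0 : T) :
  symmetric ok ->
  (forall i j x, x \in F i -> #|[set y in F j | ~~ ok x y]| <= b) ->
  (forall i, #|I| * b < #|F i|) ->
  exists g : I -> T, (forall i, g i \in F i) /\ (forall i j, i != j -> ok (g i) (g j)).
Proof.
move=> oks Fb cF.
suff /(_ setT) [g [gF gok]] : forall J : {set I}, exists g : I -> T,
    {in J, forall i, g i \in F i} /\ {in J &, forall i j, i != j -> ok (g i) (g j)}.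
  by exists g; split=> [i|i j]; [apply: gF|apply: gok]; rewrite inE.
move=> J; move: {2}#|J| (erefl #|J|) => n; elim: n J => [|n IH] J cJ.
  by exists (fun=> x0); split=> [i|i j]; rewrite (cards0_eq cJ) inE.
have /set0Pn [i iJ] : J != set0 by rewrite -card_gt0 cJ.
have cJ' : #|J :\ i| = n by move: cJ; rewrite (cardsD1 i) iJ => -[].
have [g [gF gok]] := IH _ cJ'.
pose bad := \bigcup_(j in J :\ i) [set y in F i | ~~ ok (g j) y].
have cbad : #|bad| <= #|I| * b.
  apply: (@leq_trans (#|J :\ i| * b)); last by rewrite leq_mul2r max_card orbT.
  rewrite -sum_nat_const /bad; elim/big_rec2: _ => [|j u A jJ le]; first by rewrite cards0.
  apply: leq_trans (leq_card_setU _ _) _; apply: leq_add => //.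
  by apply: (Fb j); apply: gF.
have [v vF vb] : exists2 v, v \in F i & v \notin bad.
  by apply/subsetPn; apply: contraL (cF i) => /subset_leq_card le; rewrite -leqNgt (leq_trans le).
have okv j : j \in J -> j != i -> ok (g j) v.
  move=> jJ ji; apply: contraNT vb => nok; apply/bigcupP; exists j; rewrite ?inE ?ji ?vF //.
exists (fun j => if j == i then v else g j); split=> [j jJ|j j' jJ j'J jj'].
  by case: eqP => [->|/eqP ji] //; apply: gF; rewrite !inE ji.
case: (eqVneq j i) jj' => [->|ji]; case: (eqVneq j' i) => [_|j'i] // ne.
- by rewrite oks okv.
- exact: okv.
- by apply: gok => //; rewrite ?inE ?ji ?j'i.
Qed.

(** * Gadgets, rigidity and the potential *)

Section Gadgets.
Local Open Scope ring_scope.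
Variables (T : finType) (gam : finZmodType) (k : T -> T -> gam) (good : rel T).
Variables (d b : nat) (W0 : {set T}) (gam1 : {group gam}) (p : T -> gam).

(* m disjoint stars with d leaves [inl j], a base centre [inr false] joined to
   the leaves by good pairs, and an alternative centre [inr true]. *)
Definition gadget (X : {set T}) (m : nat) (v : 'I_m -> 'I_d + bool -> T) : Prop :=
  [/\ injective (fun s : 'I_m * ('I_d + bool) => v s.1 s.2), forall i s, v i s \in X,
      forall i j, good (v i (inr false)) (v i (inl j)) &
      forall i j j', j != j' -> good (v i (inl j)) (v i (inl j'))].

Definition star_sum (x : T) (u : 'I_d -> T) : gam := \sum_j k x (u j).

Definition gdiff (m : nat) (v : 'I_m -> 'I_d + bool -> T) : gam :=
  \sum_i (star_sum (v i (inr true)) (v i \o inl) - star_sum (v i (inr false)) (v i \o inl)).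

Definition escapes (H K : {group gam}) (X : {set T}) : Prop :=
  exists m (v : 'I_m -> 'I_d + bool -> T),
    [/\ (m <= d)%N, gadget X v, gdiff v \in H & gdiff v \notin K].

Definition rich_star (m : nat) (V : {set T}) : Prop :=
  exists (u : 'I_d -> T) (O : {set T}), [/\ injective u,
    forall j j', j != j' -> good (u j) (u j'), forall j, u j \in V :\: O, O \subset V /\ #|O| = m &
    {in O &, injective (star_sum ^~ u)} /\ {in O, forall x j, good x (u j)}].

(** [dl] is the common deviation from the potential. The pairs of the clique may fail to be good, so
    [dl] need not lie in [H]; since [d] kills it modulo [H], it can be balanced by counting edges
    modulo [d]. *)
Definition homogeneous_clique (H : {group gam}) (h : T -> gam) (c : gam) (r : nat) (Y : {set T}) : Prop :=
  exists (P : {set T}) (dl : gam), [/\ P \subset Y, #|P| = r, dl *+ d \in H &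
    {in P &, forall x y, x != y -> k x y - (h x + h y + c) - dl \in H}].

(** A gadget leaves the pairs at its alternative centre unrestricted, so [gdiff] may fall outside
    [gam1]; such gadgets are exempt. *)
Definition rigid (H : {group gam}) (X : {set T}) : Prop :=
  forall m (v : 'I_m -> 'I_d + bool -> T), (m <= d)%N -> gadget X v ->
    gdiff v \in gam1 -> gdiff v \in H.

Hypothesis ksym : forall x y, k x y = k y x.
Hypothesis good_sym : symmetric good.
Hypothesis good_irr : irreflexive good.
Hypothesis d_gt0 : (0 < d)%N.
Hypothesis bad_le : {in W0, forall x, (#|[set y in W0 | ~~ good x y]| <= b)%N}.
Hypothesis good_p : {in W0 &, forall x y, good x y -> k x y - p x - p y \in gam1}.
Hypothesis p_d : {in W0, forall x, p x *+ d \in gam1}.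
Hypothesis gam1_d : forall a : gam, a *+ d \in gam1.

Lemma good_family (I : finType) (S X W : {set T}) :
  W \subset W0 -> S \subset W0 -> ((#|I| + #|S|) * b + #|X| < #|W|)%N ->
  exists g : I -> T, [/\ injective g, forall i, g i \in W :\: X,
    forall i j, i != j -> good (g i) (g j) & {in S, forall x i, good x (g i)}].
Proof.
move=> WW SW cW; have [x0 _] : exists x, x \in W by apply/set0Pn; rewrite -card_gt0; lia.
pose F (i : I) := [set w in W :\: X | [forall x in S, good x w]].
have FW i x : x \in F i -> x \in W0.
  by rewrite !inE => /andP[/andP[_ xW] _]; apply: (subsetP WW).
have cF i : (#|I| * b < #|F i|)%N.
  have sub : W \subset F i :|: (X :|: \bigcup_(x in S) [set y in W0 | ~~ good x y]).
    apply/subsetP => w wW; rewrite !inE wW andbT.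
    case: (boolP (w \in X)) => //= _; rewrite ?orbT //.
    case: (boolP [forall x in S, good x w]) => //= /forall_inPn [x xS ng].
    by apply/bigcupP; exists x => //; rewrite inE (subsetP WW).
  have cB : (#|\bigcup_(x in S) [set y in W0 | ~~ good x y]| <= #|S| * b)%N.
    by apply: card_bigcup_le => x xS; rewrite bad_le ?(subsetP SW).
  move: (subset_leq_card sub) cB cW; set B := \bigcup_(x in S) _.
  move: (card_setU_le (F i) (X :|: B)) (card_setU_le X B).
  by rewrite mulnDl; lia_cards.
have [|g [gF gok]] := @greedy_choice I T F good b x0 good_sym _ cF.
  move=> i j x xF; apply: leq_trans (bad_le (FW _ _ xF)).
  apply/subset_leq_card/subsetP => y; rewrite inE => /andP[/FW yW ng].
  by rewrite inE yW.
exists g; split=> //.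
- move=> i j e; apply/eqP/negPn/negP => ij; have := gok i j ij.
  by rewrite e good_irr.
- by move=> i; have := gF i; rewrite inE => /andP[].
- by move=> x xS i; have := gF i; rewrite inE => /andP[_ /forall_inP]; apply.
Qed.

Lemma star_diff_gam1 (x x' : T) (us : 'I_d -> T) :
  x \in W0 -> x' \in W0 -> (forall j, us j \in W0) ->
  (forall j, good x (us j)) -> (forall j, good x' (us j)) ->
  star_sum x us - star_sum x' us \in gam1.
Proof.
move=> xW x'W uW gx gx'; rewrite /star_sum -sumrB.
have E j : k x (us j) - k x' (us j) =
    ((k x (us j) - p x - p (us j)) - (k x' (us j) - p x' - p (us j))) + (p x - p x').
  by zmod_eq.
under eq_bigr => j _ do rewrite E.
rewrite big_split /= sumr_const card_ord mulrnBl groupDr //.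
  by apply: group_sumr => j _; rewrite groupBr ?good_p.
by rewrite groupBr ?p_d.
Qed.

Section Rigid.
Variables (H : {group gam}) (W : {set T}).
Hypothesis WW0 : W \subset W0.
Hypothesis rigW : rigid H W.
Hypothesis W_big : ((d + 10) * b.+1 < #|W|)%N.

Lemma star_rigid (x x' : T) (us : 'I_d -> T) :
  x \in W -> x' \in W -> (forall j, us j \in W) -> x != x' ->
  (forall j, good x (us j)) -> (forall j, good x' (us j)) ->
  (forall j j', j != j' -> good (us j) (us j')) ->
  star_sum x us - star_sum x' us \in H.
Proof.
move=> xW x'W uW xx' gx gx' gu.
pose v (i : 'I_1) (s : 'I_d + bool) :=
  match s with inl j => us j | inr c => if c then x else x' end.
have ne y j : good y (us j) -> y != us j by apply: contraTneq => ->; rewrite good_irr.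
have := rigW (v := v) d_gt0; rewrite /gdiff big_ord1; apply.
  split.
  - move=> [i s] [i' s'] /=; rewrite !ord1; case: s s' => [j|c] [j'|c'] /= e.
    + by have [->|/gu] := eqVneq j j'; rewrite // e good_irr.
    + by case: c' e => e; [have := ne _ _ (gx j)|have := ne _ _ (gx' j)]; rewrite e eqxx.
    + by case: c e => e; [have := ne _ _ (gx j')|have := ne _ _ (gx' j')]; rewrite e eqxx.
    + by case: c e; case: c' => // e; move: xx'; rewrite e eqxx.
  - by move=> i [j|[]]; [apply: uW|apply: xW|apply: x'W].
  - by move=> i j; apply: gx'.
  - by move=> i j j'; apply: gu.
by apply: star_diff_gam1 => // [||j]; apply: (subsetP WW0).
Qed.

Lemma good_family_W (I : finType) (S : {set T}) :
  (#|I| + #|S| <= d + 10)%N -> S \subset W ->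
  exists g : I -> T, [/\ injective g, forall i, g i \in W,
    forall i j, i != j -> good (g i) (g j) & {in S, forall x i, good x (g i)}].
Proof.
move=> cS SW; have [||g [g1 g2 g3 g4]] := @good_family I S set0 W WW0.
- exact: subset_trans SW WW0.
- rewrite cards0 addn0; apply: leq_ltn_trans W_big.
  by apply: leq_mul => //; apply: leqW.
- by exists g; split=> // i; have := g2 i; rewrite setD0.
Qed.

Lemma card_set_seq (s : seq T) : (#|[set x in s]| <= size s)%N.
Proof. by rewrite cardsE card_size. Qed.

Lemma good_vertex (s : seq T) : (size s < 10)%N -> {subset s <= W} ->
  exists2 w, w \in W & {in s, forall x, good x w}.
Proof.
move=> cs sW; have [||g [_ g2 _ g4]] := @good_family_W unit [set x in s].
- by rewrite card_unit; have := card_set_seq s; lia.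
- by apply/subsetP => x; rewrite inE => /sW.
- by exists (g tt) => [|x xs]; rewrite ?g2 ?g4 ?inE.
Qed.

(** Exchange the centre [x'] for [x] in two stars that share [d - 1] leaves, the last leaf being [u]
    or [u']. The shared leaves cancel in the difference of the two exchanges. *)
Lemma rectangle (x x' u u' : T) : {subset [:: x; x'; u; u'] <= W} ->
  good x u -> good x u' -> good x' u -> good x' u' ->
  (k x u - k x' u) - (k x u' - k x' u') \in H.
Proof.
move=> sW gxu gxu' gx'u gx'u'.
have [->|xx'] := eqVneq x x'; first by rewrite !subrr group0r.
have [||g [g1 g2 g3 g4]] := @good_family_W 'I_d [set y in [:: x; x'; u; u']].
- by have := card_set_seq [:: x; x'; u; u']; rewrite card_ord /=; lia.
- by apply/subsetP => y; rewrite inE => /sW.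
have gg y j : y \in [:: x; x'; u; u'] -> good y (g j) by move=> ys; apply: g4; rewrite inE.
have [xW x'W uW u'W] : [/\ x \in W, x' \in W, u \in W & u' \in W].
  by split; apply: sW; rewrite !inE eqxx /= ?orbT.
pose j0 := Ordinal d_gt0.
pose us w j := if j == j0 then w else g j.
have st w : w \in [:: x; x'; u; u'] -> good x w -> good x' w ->
    star_sum x (us w) - star_sum x' (us w) \in H.
  move=> ws gxw gx'w; apply: star_rigid => // [j|j|j|j j']; rewrite /us.
  - by case: ifP => _ //; apply: sW.
  - by case: ifP => _ //; rewrite gg // !inE eqxx /= ?orbT.
  - by case: ifP => _ //; rewrite gg // !inE eqxx /= ?orbT.
  - case: (eqVneq j j0) => [ej|jj]; case: (eqVneq j' j0) => [ej'|jj'] ne.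
    + by rewrite ej ej' eqxx in ne.
    + exact: gg.
    + by rewrite good_sym gg.
    + exact: g3.
have sE w : star_sum x (us w) - star_sum x' (us w) =
    k x w - k x' w + \sum_(j < d | j != j0) (k x (g j) - k x' (g j)).
  rewrite /star_sum -sumrB (bigD1 j0) //= /us eqxx; congr (_ + _).
  by apply: eq_bigr => j /negPf ->.
have h1 : star_sum x (us u) - star_sum x' (us u) \in H by apply: st; rewrite // !inE eqxx /= ?orbT.
have h2 : star_sum x (us u') - star_sum x' (us u') \in H by apply: st; rewrite // !inE eqxx /= ?orbT.
by apply: (mem_eq (groupBr h1 h2)); rewrite !sE; zmod_eq.
Qed.

(** The potential of [x] is the difference of the rows of [x] and a base vertex [x0], which by
    [rectangle] does not depend on the column modulo [H]. Adding it over the leaves of one star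
    shows that [d] kills it. *)
Lemma rigid_potential : exists (h : T -> gam) (c : gam),
  {in W, forall x, h x *+ d \in H} /\
  {in W &, forall x y, good x y -> k x y - (h x + h y + c) \in H}.
Proof.
have /set0Pn [x0 x0W] : W != set0 by rewrite -card_gt0; move: W_big; lia_cards.
pose hh x := if [pick u in W | good x u && good x0 u] is Some u then k x u - k x0 u else 0.
have sub s : all (mem W) s -> {subset s <= W} by move/allP.
have hP x u : x \in W -> u \in W -> good x u -> good x0 u -> k x u - k x0 u - hh x \in H.
  move=> xW uW gxu gu; rewrite /hh; case: pickP => [u' /andP[u'W /andP[gxu' gu']]|no].
    by apply: rectangle => //; apply: sub; rewrite /= xW uW u'W x0W.
  by have := no u; rewrite /= uW gxu gu.
have [w1 w1W gw1] := @good_vertex [:: x0] isT (sub [:: x0] ltac:(by rewrite /= x0W)).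
have A x y w : x \in W -> y \in W -> w \in W -> good x y -> good w x -> good w y -> good w x0 ->
    k x y - (hh x + hh y + (k x0 w - hh w)) \in H.
  move=> xW yW wW gxy gwx gwy gw0.
  have [|w' w'W gw'] := @good_vertex [:: x; w; x0] isT; first by apply: sub; rewrite /= xW wW x0W.
  have [gx gw g0] : [/\ good x w', good w w' & good x0 w'].
    by split; apply: gw'; rewrite !inE eqxx /= ?orbT.
  have r := @rectangle x w y w' (sub [:: x; w; y; w'] ltac:(by rewrite /= xW wW yW w'W)) gxy gx gwy gw.
  have h1 := hP x w' xW w'W gx g0.
  have h2 := hP w w' wW w'W gw g0.
  have h3 := hP y w yW wW ltac:(by rewrite good_sym) ltac:(by rewrite good_sym).
  rewrite (ksym y w) in h3.
  apply: (mem_eq (groupDr (groupDr r h3) (groupBr h1 h2))).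
  by zmod_eq.
exists hh, (k x0 w1 - hh w1); split.
  move=> x xW; have [->|xx0] := eqVneq x x0.
    rewrite /hh; case: pickP => [u _|_]; rewrite ?subrr mul0rn group0r //.
  have [||g [g1 g2 g3 g4]] := @good_family_W 'I_d [set y in [:: x; x0]].
  - by have := card_set_seq [:: x; x0]; rewrite card_ord /=; lia.
  - by apply/subsetP => y; rewrite !inE => /orP[]/eqP ->.
  have gx j : good x (g j) by rewrite g4 // !inE eqxx.
  have gx0 j : good x0 (g j) by rewrite g4 // !inE eqxx orbT.
  have s := @star_rigid x x0 g xW x0W g2 xx0 gx gx0 g3.
  have s2 : \sum_(j < d) (k x (g j) - k x0 (g j) - hh x) \in H.
    by apply: group_sumr => j _; apply: hP.
  apply: (mem_eq (groupBr s s2)).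
  transitivity (\sum_(j < d) hh x); first by rewrite sumr_const card_ord.
  by rewrite /star_sum -!sumrB; apply: eq_bigr => j _; zmod_eq.
move=> x y xW yW gxy.
have [|w wW gw] := @good_vertex [:: x0; x; y] isT; first by apply: sub; rewrite /= xW yW x0W.
have [gw0 gwx gwy] : [/\ good x0 w, good x w & good y w].
  by split; apply: gw; rewrite !inE eqxx /= ?orbT.
(* The identity at [x], [y] comes with a constant read off at [w] instead of [w1]. A pair [x2], [y2]
   that is good to both shows that the two constants agree modulo [H]. *)
have [|x2 x2W g2] := @good_vertex [:: w; w1] isT; first by apply: sub; rewrite /= wW w1W.
have [|y2 y2W g3] := @good_vertex [:: w; w1; x2] isT; first by apply: sub; rewrite /= wW w1W x2W.
have a1 : k x y - (hh x + hh y + (k x0 w - hh w)) \in H by apply: A; rewrite // good_sym.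
have in1 z s : z \in z :: s by rewrite inE eqxx.
have a2 : k x2 y2 - (hh x2 + hh y2 + (k x0 w - hh w)) \in H.
  by apply: A => //; rewrite ?(g2, g3) ?inE ?eqxx /= ?orbT // good_sym.
have a3 : k x2 y2 - (hh x2 + hh y2 + (k x0 w1 - hh w1)) \in H.
  apply: A => //; rewrite ?(g2, g3) ?inE ?eqxx /= ?orbT // good_sym; apply: gw1.
  by rewrite inE.
apply: (mem_eq (groupDr (groupBr a1 a2) a3)).
by zmod_eq.
Qed.

Local Close Scope ring_scope.
Variables (q : nat) (h : T -> gam) (c : gam).
Hypothesis h_d : {in W, forall x, (h x *+ d)%R \in H}.
Hypothesis h_good : {in W &, forall x y, good x y -> (k x y - (h x + h y + c))%R \in H}.

Let res x y := (k x y - p x - p y)%R.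

(* The deviation from the potential inside a homogeneous set is killed by d:
   d disjoint stars, each using one pair of the set, form a gadget. *)
Lemma deviation_torsion (P : {set T}) (a al dl : gam) :
  P \subset W -> 2 * d <= #|P| -> (d * d.+1 + #|P|) * b + #|P| < #|W| ->
  {in P, forall x, h x = a} ->
  {in P &, forall x y, x != y -> res x y = al} ->
  {in P &, forall x y, x != y -> (k x y - (h x + h y + c) - dl)%R \in H} ->
  (dl *+ d)%R \in H.
Proof.
move=> PW cP cW Ph Pal Pdl.
have [|e [einj eP]] := @inj_into ('I_d * bool)%type _ P.
  by rewrite card_prod card_bool card_ord mulnC.
have [||g [ginj gW gg gP]] := @good_family ('I_d * option 'I_d)%type P P W WW0.
- exact: subset_trans PW WW0.
- by rewrite card_prod card_option card_ord.
have gW' i : g i \in W by have := gW i; rewrite inE => /andP[].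
have gNP i : g i \notin P by have := gW i; rewrite inE => /andP[].
pose j0 := Ordinal d_gt0.
pose u i j := if j == j0 then e (i, false) else g (i, Some j).
pose v i (s : 'I_d + bool) := match s with
  | inl j => u i j | inr true => e (i, true) | inr false => g (i, None) end.
have eW i : e i \in W := subsetP PW _ (eP i).
have uW i j : u i j \in W by rewrite /u; case: ifP.
have gP' x i : x \in P -> good (g i) x by move=> xP; rewrite good_sym gP.
have gbu i j : good (g (i, None)) (u i j).
  by rewrite /u; case: ifP => _; [apply: gP'|apply: gg; rewrite xpair_eqE andbF].
have guu i j j' : j != j' -> good (u i j) (u i j').
  rewrite /u; case: (eqVneq j j0) => [ej|nj]; case: (eqVneq j' j0) => [ej'|nj'] ne.
  - by rewrite ej ej' eqxx in ne.
  - exact: gP.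
  - exact: gP'.
  - by apply: gg; apply: contraNneq ne => -[->].
have gxu i j : j != j0 -> good (e (i, true)) (u i j).
  by move=> /negPf nj; rewrite /u nj gP.
have gdt : gadget W v.
  split=> //.
  - pose code (s : 'I_d * ('I_d + bool)) : ('I_d * bool) + ('I_d * option 'I_d) :=
      match s with
      | (i, inl j) => if j == j0 then inl (i, false) else inr (i, Some j)
      | (i, inr true) => inl (i, true) | (i, inr false) => inr (i, None) end.
    have vE s : v s.1 s.2 = match code s with inl x => e x | inr y => g y end.
      by case: s => i [j|[]] //=; rewrite /u; case: ifP.
    pose decode (x : ('I_d * bool) + ('I_d * option 'I_d)) : 'I_d * ('I_d + bool) :=
      match x with
      | inl (i, true) => (i, inr true) | inl (i, false) => (i, inl j0)
      | inr (i, None) => (i, inr false) | inr (i, Some j) => (i, inl j) end.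
    have cinj : injective code.
      by apply: (can_inj (g := decode)) => -[i [j|[]]] //=; case: eqP => // ->.
    move=> s s'; rewrite !vE => es; apply: cinj.
    case: (code s) (code s') es => [x|x] [y|y] es.
    + by rewrite (einj _ _ es).
    + by have := gNP y; rewrite -es eP.
    + by have := gNP x; rewrite es eP.
    + by rewrite (ginj _ _ es).
  - by move=> i [j|[]] /=.
pose sd i := (star_sum (e (i, true)) (u i) - star_sum (g (i, None)) (u i))%R.
pose ks i := (\sum_(j < d | j != j0) (k (e (i, true)) (u i j) - k (g (i, None)) (u i j)))%R.
have sumE i : (sd i =
   (k (e (i, true)) (e (i, false)) - k (g (i, None)) (e (i, false))) +
   ks i)%R.
  by rewrite /sd /star_sum -sumrB (bigD1 j0) //= /ks /u eqxx.
have ne i : e (i, true) != e (i, false) by apply/eqP => /einj.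
have sumc (x : gam) : (x *+ d = x + \sum_(j < d | j != j0) x)%R.
  by rewrite -(bigD1 (P := predT) j0 (F := fun=> x)) //= sumr_const card_ord.
(* Only the pair inside [P] may be bad; the other pairs contribute elements of [gam1] once [p] is
   subtracted. So the [d] stars together give [d] times [al] modulo [gam1], hence 0, and rigidity
   applies to the gadget. *)
have t1 i : (sd i - al)%R \in gam1.
  have m1 : (res (g (i, None)) (e (i, false)))%R \in gam1.
    by apply: good_p; rewrite ?(subsetP WW0) ?gP'.
  have m2 : (\sum_(j < d | j != j0) (res (e (i, true)) (u i j) - res (g (i, None)) (u i j)))%R \in gam1.
    by apply: group_sumr => j nj; rewrite groupBr // good_p ?(subsetP WW0) ?gxu.
  have m3 : ((p (e (i, true)) - p (g (i, None))) *+ d)%R \in gam1.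
    by rewrite mulrnBl groupBr // p_d // (subsetP WW0).
  apply: (mem_eq (groupDr (groupBr m2 m1) m3)); rewrite sumE sumc.
  rewrite -(Pal _ _ (eP _) (eP _) (ne i)).
  transitivity (k (e (i, true)) (e (i, false)) - k (g (i, None)) (e (i, false)) - res (e (i, true)) (e (i, false))
    + ks i)%R; first by zmod_eq.
  transitivity ((p (e (i, true)) - p (g (i, None))) - res (g (i, None)) (e (i, false)) +
    \sum_(j < d | j != j0) ((res (e (i, true)) (u i j) - res (g (i, None)) (u i j)) + (p (e (i, true)) - p (g (i, None)))))%R.
    congr (_ + _)%R; first by rewrite /res; zmod_eq.
    by apply: eq_bigr => j _; rewrite /res; zmod_eq.
  rewrite big_split /=; set A := (\sum_(j < d | _) (res _ _ - _))%R.
  by set B := (\sum_(j < d | _) (p _ - _))%R; zmod_eq.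
have t2 i : (sd i - dl)%R \in H.
  have m0 := Pdl _ _ (eP (i, true)) (eP (i, false)) (ne i).
  have m1 := h_good (gW' (i, None)) (eW (i, false)) (gP' _ _ (eP _)).
  have m2 : (\sum_(j < d | j != j0) ((k (e (i, true)) (u i j) - (h (e (i, true)) + h (u i j) + c))
      - (k (g (i, None)) (u i j) - (h (g (i, None)) + h (u i j) + c))))%R \in H.
    by apply: group_sumr => j nj; rewrite groupBr // h_good // gxu.
  have m3 : ((h (e (i, true)) - h (g (i, None))) *+ d)%R \in H.
    by rewrite mulrnBl groupBr // h_d.
  apply: (mem_eq (groupDr (groupDr (groupBr m0 m1) m2) m3)); rewrite sumE sumc.
  set X := (\sum_(j < d | _) (_ - _ - _))%R.
  transitivity ((k (e (i, true)) (e (i, false)) - k (g (i, None)) (e (i, false)) - dl) +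
    ks i)%R; first by zmod_eq.
  have -> : (ks i =
     X + \sum_(j < d | j != j0) (h (e (i, true)) - h (g (i, None))))%R.
    by rewrite /ks /X -big_split /=; apply: eq_bigr => j _; zmod_eq.
  by zmod_eq.
have g1 : gdiff v \in gam1.
  have s1 : (\sum_i (sd i - al))%R \in gam1.
    by apply: group_sumr => i _.
  apply: (mem_eq (groupDr s1 (gam1_d al))).
  rewrite [X in (X + _)%R]sumrB sumr_const card_ord subrK.
  by apply: eq_bigr.
have gH := rigW (leqnn d) gdt g1.
have s2 : (\sum_i (sd i - dl))%R \in H.
  by apply: group_sumr => i _.
apply: (mem_eq (groupBr gH s2)).
rewrite [X in (_ - X)%R]sumrB sumr_const card_ord opprB addrCA -{1}[(dl *+ d)%R]addr0.
congr (_ + _)%R; symmetry; apply/eqP; rewrite subr_eq0; apply/eqP.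
by apply: eq_bigr.
Qed.

(** The pairs at [x1] obey the potential and [h] is constant on [Y], so fixing the value of [res x1]
    makes [p] constant modulo [H]. A clique with constant [res] inside this set then has constant
    deviation. *)
Lemma homogeneous_set (N r : nat) (Y : {set T}) (x1 : T) (a : gam) :
  local_ramsey q r N T ->
  {in W0, forall x, #|[set res x y | y in W0]| <= q} ->
  x1 \in W -> Y \subset W -> {in Y, forall y, good x1 y /\ h y = a} ->
  q * N < #|Y| -> 2 * d <= r -> (d * d.+1 + r) * b + r < #|W| ->
  homogeneous_clique H h c r Y.
Proof.
move=> ramsey loc x1W YW Yx cY dr cW.
have Y0 : Y != set0 by rewrite -card_gt0; apply: leq_ltn_trans cY.
have [|be beP leb] := @pigeonhole _ _ Y (res x1) [set res x1 y | y in W0] Y0.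
  by move=> y yY; apply: imset_f; apply: (subsetP WW0); apply: (subsetP YW).
set S := [set y in Y | _] in leb.
have NS : N <= #|S|.
  have := loc x1 (subsetP WW0 _ x1W); move: leb cY.
  set w := #|[set _ | _ in _]|; move: #|Y| #|S| => y s; clear; nia.
have SY : S \subset Y by apply/subsetP => y; rewrite inE => /andP[].
have [||P [al [PS cP Pal]]] := ramsey _ res S _ NS.
- by move=> x y; rewrite /res ksym; zmod_eq.
- move=> x xS; have xW : x \in W0 by apply: (subsetP WW0); apply: (subsetP YW); apply: (subsetP SY).
  apply: leq_trans (loc x xW); apply/subset_leq_card/imsetS/subsetP => y.
  by rewrite inE => /andP[_ yS]; apply: (subsetP WW0); apply: (subsetP YW); apply: (subsetP SY).
have PY := subset_trans PS SY.
have PW := subset_trans PY YW.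
pose pi := (h x1 + a + c - be - p x1)%R.
have Ppi x : x \in P -> (p x - pi)%R \in H /\ h x = a.
  move=> xP; have [gx hx] := Yx _ (subsetP PY _ xP); split=> //.
  have := h_good x1W (subsetP PW _ xP) gx; rewrite hx => m.
  have rb : res x1 x = be by have := subsetP PS _ xP; rewrite inE => /andP[_ /eqP].
  by apply: (mem_eq m); rewrite /pi -rb /res; zmod_eq.
pose dl := (al + pi + pi - a - a - c)%R.
have Pdl : {in P &, forall x y, x != y -> (k x y - (h x + h y + c) - dl)%R \in H}.
  move=> x y xP yP xy; have [mx hx] := Ppi x xP; have [my hy] := Ppi y yP.
  apply: (mem_eq (groupDr mx my)); rewrite /dl hx hy -(Pal x y xP yP xy) /res.
  by zmod_eq.
exists P, dl; split=> //.
apply: (deviation_torsion (P := P) (a := a) (al := al)) => //; rewrite ?cP //.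
by move=> x /Ppi [].
Qed.

End Rigid.
End Gadgets.

(** * The minimal unavoidable subgroup *)

Section Descent.
Variables (T : finType) (gam : finZmodType) (k : T -> T -> gam) (good : rel T).
Variables (d : nat) (W0 : {set T}) (gam1 : {group gam}).

Definition gidx (H : {group gam}) : nat := #|[set: gam] : H|%g.

Lemma card_gidx (H : {group gam}) : #|H| * gidx H = #|gam|.
Proof. by rewrite /gidx Lagrange ?subsetT // cardsT. Qed.

Lemma proper_gidx (H K : {group gam}) : K \proper H ->
  2 * #|K| <= #|H| /\ 2 * gidx H <= gidx K.
Proof.
move=> KH; have sKH := proper_sub KH.
have c1 : #|K| * #|H : K|%g = #|H| by rewrite Lagrange.
have i2 : 1 < #|H : K|%g by rewrite indexg_gt1; case/andP: KH.
have K0 : 0 < #|K| by rewrite cardG_gt0.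
split; first by rewrite -c1 mulnC leq_mul2l i2 orbT.
have : #|K| * gidx K = #|K| * (#|H : K|%g * gidx H).
  by rewrite mulnA c1 !card_gidx.
by move/eqP; rewrite eqn_pmul2l // => /eqP ->; rewrite leq_mul2r i2 orbT.
Qed.

(* The least subgroup that cannot be avoided: every smaller one is left by some
   gadget, even after deleting few vertices. *)
Lemma minimal_rigid (cc : nat) : exists (H : {group gam}) (W : {set T}),
  [/\ W \subset W0 /\ H \subset gam1, rigid k good d gam1 H W,
      #|W0 :\: W| + cc * #|H| <= cc * (#|gam| + gidx H) &
      forall (K : {group gam}) (X : {set T}), K \proper H ->
        2 * #|X| <= cc * (#|H| + 2 * gidx H) ->
        escapes k good d H K (W :\: X)].
Proof.
(* The last condition pays for the deletions: passing to a proper subgroup at least halves the order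
   and at least doubles the index, and the slack gained covers the deleted set. *)
pose P (H : {group gam}) (W : {set T}) := [/\ W \subset W0, rigid k good d gam1 H W, H \subset gam1 &
  #|W0 :\: W| + cc * #|H| <= cc * (#|gam| + gidx H)].
suff : forall n (H : {group gam}) (W : {set T}), #|H| <= n -> P H W -> exists (H : {group gam}) (W : {set T}),
    P H W /\ forall (K : {group gam}) (X : {set T}), K \proper H ->
        2 * #|X| <= cc * (#|H| + 2 * gidx H) ->
        escapes k good d H K (W :\: X).
  case/(_ _ gam1 W0 (leqnn _)) => [|H [W [[h1 h2 h3 h4] h5]]]; last by exists H, W.
  split=> //; rewrite setDv cards0 add0n leq_mul2l; apply/orP; right.
  by apply: leq_trans (leq_addr _ _); apply: max_card.
elim=> [|n IH] H W cH PHW.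
  by move: cH; rewrite leqNgt cardG_gt0.
have [rob|nrob] := classic (forall (K : {group gam}) (X : {set T}), K \proper H ->
        2 * #|X| <= cc * (#|H| + 2 * gidx H) ->
        escapes k good d H K (W :\: X)).
  by exists H, W.
have [K nK] := not_all_ex_not _ _ nrob.
have [X nX] := not_all_ex_not _ _ nK.
have [KH nX2] := imply_to_and _ _ nX.
have [cX nv] := imply_to_and _ _ nX2.
have [WW0 rg Hg1 cW] := PHW.
have [cK iK] := proper_gidx KH.
apply: (IH K (W :\: X)).
  by rewrite -ltnS (leq_trans (proper_card KH)).
split.
- exact: subset_trans (subsetDl _ _) WW0.
- move=> m v md gv g1; apply/negPn/negP => gK; apply: nv; exists m, v; split=> //.
  apply: rg => //; case: gv => v1 v2 v3 v4; split=> // i s.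
  by have := v2 i s; rewrite inE => /andP[].
- exact: subset_trans (proper_sub KH) Hg1.
- have : #|W0 :\: (W :\: X)| <= #|W0 :\: W| + #|X|.
    apply: leq_trans (card_setU_le _ _); apply/subset_leq_card/subsetP => x.
    by rewrite !inE negb_and negbK; case: (x \in X); rewrite ?orbT //= orbF.
  have := leq_mul (leqnn cc) cK; have := leq_mul (leqnn cc) iK.
  by move: cW cX; rewrite !mulnDr; lia_cards.
Qed.

(* Replace each value of the potential by the representative of its coset. *)
Lemma normalize_potential (H : {group gam}) (W : {set T}) (h : T -> gam) (c : gam) :
  {in W, forall x, (h x *+ d)%R \in H} ->
  {in W &, forall x y, good x y -> (k x y - (h x + h y + c))%R \in H} ->
  exists h' : T -> gam, [/\ {in W, forall x, (h' x *+ d)%R \in H},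
    {in W &, forall x y, good x y -> (k x y - (h' x + h' y + c))%R \in H} &
    #|[set h' x | x in W]| <= gidx H].
Proof.
move=> hd hg; pose rep a := repr (H :* a)%g.
have repP a : (rep a - a)%R \in H.
  by have := mem_repr_rcoset H a; rewrite mem_rcoset.
exists (fun x => rep (h x)); split.
- move=> x xW; apply: (mem_eq (groupDr (groupMnr d (repP (h x))) (hd x xW))).
  by rewrite mulrnBl subrK.
- move=> x y xW yW gxy.
  apply: (mem_eq (groupBr (hg x y xW yW gxy) (groupDr (repP (h x)) (repP (h y))))).
  by zmod_eq.
- apply: (@leq_trans #|[set repr C | C in rcosets H [set: gam]]|); last first.
    exact: leq_imset_card.
  apply/subset_leq_card/subsetP => _ /imsetP [x _ ->].
  by apply/imsetP; exists (H :* h x)%g => //; apply/rcosetsP; exists (h x).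
Qed.
End Descent.

Definition zero_copy (G : sgraph) (T : finType) (gam : finZmodType) (k : T -> T -> gam) : Prop :=
  exists2 F : G -> T, injective F & (\sum_(p in edge_pairs G) k (F p.1) (F p.2) = 0)%R.

Lemma mulrn_card (gam : finZmodType) (a : gam) (e : nat) : #|gam| %| e -> (a *+ e)%R = 0%R.
Proof.
case/dvdnP => m ->; rewrite mulnC mulrnA.
have -> : (a *+ #|gam|)%R = 0%R; last by rewrite mul0rn.
apply: (addrI (\sum_(x : gam) x)%R); rewrite addr0 -sumr_const -big_split /=.
by rewrite [RHS](reindex_inj (addIr a)).
Qed.

Section PlaceInto.
Variables (G : sgraph) (T : finType) (gam : finZmodType) (k : T -> T -> gam) (good : rel T).

Lemma place_into D Z f U A (Q : {set G}) (Y : {set T}) :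
  state k good D Z f U A -> Q \subset ~: (D :|: Z) -> Y \subset ~: U -> #|Q| <= #|Y| ->
  {in Q &, forall x y, adj x y -> {in Y &, forall u v, good u v}} ->
  {in D & Q, forall x q, adj x q -> {in Y, forall y, good (f x) y && good y (f x)}} ->
  exists f' U', [/\ {in D, f' =1 f}, {in Q, forall x, f' x \in Y},
    state k good (D :|: Q) Z f' (U :|: U') A & U' \subset Y /\ #|U'| <= #|Q|].
Proof.
move=> st QDZ YU cQ gQ gD.
have cI : #|{: {x : G | x \in Q}}| = #|Q| by rewrite card_sig.
have [|y [yinj yY]] := @inj_into {x : G | x \in Q} _ Y; first by rewrite cI.
have [||||f' [f'D f'w st']] := @place G T gam k good D Z f U A _ sval y st val_inj yinj.
- by move=> [x xQ] /=; have := subsetP QDZ _ xQ; rewrite inE.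
- by move=> i; have := subsetP YU _ (yY i); rewrite inE.
- by move=> [x xQ] [x' x'Q] /= ad; apply: (gQ x x').
- by move=> x [x' x'Q] xD /= ad; apply: (gD x x').
exists f', [set y i | i in predT]; split=> //.
- by move=> x xQ; have := f'w (exist _ x xQ) => /= ->.
- rewrite (_ : D :|: Q = D :|: [set sval i | i in {: {x : G | x \in Q}}]) //.
  congr (_ :|: _); apply/setP => x; apply/idP/imsetP => [xQ|[[x' x'Q] _ ->] //].
  by exists (exist _ x xQ).
- split; first by apply/subsetP => _ /imsetP [i _ ->].
  by rewrite -cI; apply: leq_imset_card.
Qed.

End PlaceInto.

(** * Placing stars and gadgets at sites *)

Section Sites.
Local Open Scope ring_scope.
Variables (G : sgraph) (d : nat) (S : {set G}) (t : 'I_d -> nat).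

Definition ball (z : G) : {set G} := z |: nbrs z.

Definition nbr (z : G) (j : 'I_d) : G := nth z (enum (nbrs z)) j.

(* Vertices of degree d with the same ordered list of neighbour degrees, whose
   closed neighbourhoods are disjoint and not joined by edges. *)
Definition sites : Prop :=
  [/\ {in S, forall z, degree z = d}, {in S, forall z j, degree (nbr z j) = t j} &
    {in S &, forall z z', z != z' -> forall x x', x \in ball z -> x' \in ball z' ->
      x != x' /\ ~~ adj x x'}].

Hypothesis SP : sites.

Lemma nbr_in z j : z \in S -> nbr z j \in nbrs z.
Proof.
have [Sd _ _] := SP; move=> /Sd zd; rewrite -mem_enum mem_nth // -cardE.
by move: zd; rewrite /degree => ->.
Qed.

Lemma nbr_inj z : z \in S -> injective (nbr z).
Proof.
have [Sd _ _] := SP; move=> /Sd zd i j /eqP.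
have sz : size (enum (nbrs z)) = d by rewrite -cardE.
by rewrite nth_uniq ?enum_uniq ?sz // => /eqP /val_inj.
Qed.

Lemma nbrsE z : z \in S -> nbrs z = [set nbr z j | j in 'I_d].
Proof.
move=> zS; apply/esym/eqP; rewrite eqEcard; apply/andP; split.
  by apply/subsetP => _ /imsetP [j _ ->]; apply: nbr_in.
rewrite card_imset ?card_ord; last exact: nbr_inj.
by have [Sd _ _] := SP; rewrite -(Sd z zS).
Qed.

Lemma sum_nbr (V : zmodType) (F : G -> V) z : z \in S ->
  \sum_(y in nbrs z) F y = \sum_(j < d) F (nbr z j).
Proof.
move=> zS; rewrite nbrsE // big_imset //= => i j _ _; exact: nbr_inj.
Qed.

Variables (T : finType) (gam : finZmodType) (k : T -> T -> gam) (good : rel T).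
Variables (H : {group gam}) (W : {set T}) (h : T -> gam) (c : gam).
Hypothesis good_sym : symmetric good.
Hypothesis d_gt0 : (0 < d)%N.
Hypothesis h_d : {in W, forall x, h x *+ d \in H}.
Hypothesis h_good : {in W &, forall x y, good x y -> k x y - (h x + h y + c) \in H}.

(** By the handshake identity, the contribution of [D] to the potential summed over all edges. *)
Definition hsum (D : {set G}) (f : G -> T) : gam := \sum_(y in D) h (f y) *+ degree y.

(** The residue modulo [H] of the sum at the free centres when these use good pairs: the potential
    of a centre enters [d] times and vanishes. *)
Definition rho (Z : {set G}) (f : G -> T) : gam :=
  \sum_(z in Z) \sum_(y in nbrs z) (h (f y) + c).

Definition inv D Z f U A (Su : {set G}) : Prop :=
  [/\ state k good D Z f U A /\ U \subset W,
      Su \subset S /\ D :|: Z \subset \bigcup_(z in Su) ball z,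
      hsum D f \in H &
      (d %| \sum_(y in D) degree y)%N /\ Z \subset S].

(** A leaf [u j] alone would leave [h (u j) *+ t j] in [hsum]. It is accompanied by the [j]-th
    neighbours of [d - 1] other sites, put into the same class of [h], so that the contribution
    becomes a multiple of [d]. The set [X] is protected from these companions. *)
Lemma place_star D Z f U A Su (u : 'I_d -> T) (O X : {set T}) :
  inv D Z f U A Su -> injective u -> (forall j j', j != j' -> good (u j) (u j')) ->
  (forall j, u j \in X) -> O \subset X -> X \subset W :\: U -> (forall j, u j \notin O) ->
  (forall j, (d * d < #|[set y in W :\: (U :|: X) | h y == h (u j)]|)%N) ->
  ((d * d).+1 <= #|S :\: Su|)%N ->
  exists D' Z' f' U' Su', [/\
    inv D' Z' f' U' (sumset A [set star_sum k x u | x in O]) Su',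
    rho Z' f' = rho Z f + \sum_j (h (u j) + c),
    (#|U'| <= #|U| + (d * d + #|O|))%N /\ U \subset U',
    (#|Su'| <= #|Su| + (d * d).+1)%N /\ Su \subset Su' &
    forall x, x \in X -> x \in U' -> x \in O \/ exists j, x = u j].
Proof.
move=> [[st UW] [SuS cov] hsH [dD ZS]] uinj ugood uX OX XW uO rich cS.
have [_ Styp Sfar] := SP.
have [|sig [siginj sigS]] := @inj_into (option ('I_d * 'I_d)) _ (S :\: Su).
  by rewrite card_option card_prod card_ord.
have [|||g [gF gne]] := @greedy_choice ('I_d * 'I_d)%type T
    (fun q => [set y in W :\: (U :|: X) | h y == h (u q.1)]) (fun x y => x != y) 1 (u (Ordinal d_gt0)).
- by move=> x y; rewrite eq_sym.
- move=> q q' x _; apply: leq_trans (_ : #|[set x]| <= _)%N; last by rewrite cards1.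
  by apply/subset_leq_card/subsetP => y; rewrite !inE => /andP[_]; rewrite negbK eq_sym.
- by move=> q; rewrite card_prod card_ord muln1.
have ginj : injective g.
  by move=> q q' e; apply/eqP/negPn/negP => /gne; rewrite e eqxx.
have gP q : [/\ g q \in W, g q \notin U, g q \notin X & h (g q) = h (u q.1)].
  by have := gF q; rewrite !inE negb_or => /andP[/andP[/andP[-> ->] ->] /eqP].
pose z0 := sig None.
pose l0 := Ordinal d_gt0.
(* Pairs with second entry [l0] are the leaves of the star itself, at [z0]; the pair of [j] and
   another index is a companion of leaf [j], at a site of its own. *)
pose sit (q : 'I_d * 'I_d) := if q.2 == l0 then z0 else sig (Some q).
pose w q := nbr (sit q) q.1.
pose y q := if q.2 == l0 then u q.1 else g q.
have sigSS o : sig o \in S by have := sigS o; rewrite inE => /andP[].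
have sitS q : sit q \in S by rewrite /sit; case: ifP => _; apply: sigSS.
have sitSu q : sit q \notin Su.
  rewrite /sit; case: ifP => _.
    by have := sigS None; rewrite inE => /andP[].
  by have := sigS (Some q); rewrite inE => /andP[].
have z0Su : z0 \notin Su by have := sigS None; rewrite inE => /andP[].
have wball q : w q \in ball (sit q) by rewrite inE nbr_in ?orbT.
have sit_eq q q' : sit q = sit q' -> q = q' \/ (q.2 = l0 /\ q'.2 = l0).
  rewrite /sit; case: eqP => e1; case: eqP => e2; first by right.
  - by move/siginj.
  - by move/siginj.
  - by move/siginj => -[]; left.
have far x z : x \in D :|: Z -> z \in S -> z \notin Su -> forall x', x' \in ball z ->
    x != x' /\ ~~ adj x x'.
  move=> /(subsetP cov) /bigcupP [s sSu xs] zS zSu x' x'z.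
  apply: (Sfar s z) => //; first exact: (subsetP SuS).
  by apply: contraNneq zSu => <-.
have sfar q q' : sit q != sit q' -> w q != w q' /\ ~~ adj (w q) (w q').
  by move=> ne; apply: (Sfar _ _ (sitS q) (sitS q') ne).
have winj : injective w.
  move=> q q' e; have [es|ne] := eqVneq (sit q) (sit q'); last first.
    by have [] := sfar _ _ ne; rewrite e eqxx.
  have [//|[e1 e2]] := sit_eq _ _ es.
  move: e; rewrite /w es => /(nbr_inj (sitS q')).
  by case: q q' e1 e2 {es} => [a b] [a' b'] /= -> -> ->.
have yinj : injective y.
  have uX' q j : g q != u j by have [_ _ gX _] := gP q; apply: contraNneq gX => ->.
  move=> [a b] [a' b']; rewrite /y /=; case: eqP => [->|ne]; case: eqP => [->|ne'].
  - by move=> /uinj ->.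
  - by move=> e; have := uX' (a', b') a; rewrite e eqxx.
  - by move=> e; have := uX' (a, b) a'; rewrite e eqxx.
  - exact: ginj.
have XW' x : x \in X -> (x \in W) && (x \notin U).
  by move/(subsetP XW); rewrite inE andbC.
have yW q : y q \in W.
  by rewrite /y; case: ifP => _; [have /andP[] := XW' _ (uX q.1)|have [] := gP q].
have yU q : y q \notin U.
  by rewrite /y; case: ifP => _; [have /andP[] := XW' _ (uX q.1)|have [] := gP q].
have [|||f' [f'D f'w st']] := place st winj yinj _ yU.
- move=> q; apply/negP => wD; have [] := far _ _ wD (sitS q) (sitSu q) _ (wball q).
  by rewrite eqxx.
- move=> q q' ad; have [es|ne] := eqVneq (sit q) (sit q'); last first.
    by have [_] := sfar _ _ ne; rewrite ad.
  have [e|[e1 e2]] := sit_eq _ _ es; first by rewrite e adj_irrefl in ad.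
  rewrite /y e1 e2 eqxx; apply: ugood; apply: contraTneq ad => e.
  by rewrite /w es e adj_irrefl.
- move=> x q xD ad; have xDZ : x \in D :|: Z by rewrite inE xD.
  by have [_] := far _ _ xDZ (sitS q) (sitSu q) _ (wball q); rewrite ad.
set D' := D :|: _ in st'; set U' := U :|: _ in st'.
have z0S : z0 \in S := sigSS None.
have z0ball : z0 \in ball z0 by rewrite !inE eqxx.
have w0 j : w (j, l0) = nbr z0 j by rewrite /w /sit eqxx.
have nz0 : nbrs z0 \subset D'.
  rewrite nbrsE //; apply/subsetP => _ /imsetP [j _ ->].
  by rewrite inE -w0 imset_f ?orbT.
have z0D' : z0 \notin D' :|: Z.
  rewrite !inE; apply/negP => /orP[/orP[z0D|/imsetP [q _ e]]|z0Z].
  - have z0DZ : z0 \in D :|: Z by rewrite inE z0D.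
    by have [] := far _ _ z0DZ z0S z0Su _ z0ball; rewrite eqxx.
  - have [es|ne] := eqVneq (sit q) z0; last first.
      by have [] := Sfar _ _ (sitS q) z0S ne _ _ (wball q) z0ball; rewrite e eqxx.
    by have := nbr_in q.1 (sitS q); rewrite -/(w q) -e es inE adj_irrefl.
  - have z0DZ : z0 \in D :|: Z by rewrite inE z0Z orbT.
    by have [] := far _ _ z0DZ z0S z0Su _ z0ball; rewrite eqxx.
have OU : [disjoint O & U'].
  rewrite disjoint_subset; apply/subsetP => x xO; rewrite !inE negb_or.
  have xX := subsetP OX _ xO; have /andP[_ ->] /= := XW' _ xX.
  apply/imsetP => -[q _ e]; move: xO; rewrite e /y; case: ifP => _.
    by rewrite (negPf (uO _)).
  by move=> gO; have [_ _ /negP gX _] := gP q; apply: gX; apply: (subsetP OX).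
have st2 := place_center st' z0D' nz0 OU.
have f'u j : f' (nbr z0 j) = u j by rewrite -w0 f'w /y eqxx.
have sumsE : [set \sum_(y0 in nbrs z0) k x (f' y0) | x in O] = [set star_sum k x u | x in O].
  by apply: eq_imset => x; rewrite sum_nbr //; apply: eq_bigr => j _; rewrite f'u.
rewrite sumsE in st2.
have wD q : w q \notin D.
  apply/negP => wqD; have wq2 : w q \in D :|: Z by rewrite inE wqD.
  by have [] := far _ _ wq2 (sitS q) (sitSu q) _ (wball q); rewrite eqxx.
have sumD' (V : nmodType) (F : G -> V) :
    \sum_(x in D') F x = \sum_(x in D) F x + \sum_q F (w q).
  have dj : [disjoint D & w @: predT].
    by rewrite disjoint_sym disjoint_subset; apply/subsetP => _ /imsetP [q _ ->]; rewrite inE /=.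
  rewrite /D' (eq_bigl _ _ (fun x => in_setU x D _)) bigU //=; congr (_ + _).
  by rewrite big_imset //= => q q' _ _; apply: winj.
have degw q : degree (w q) = t q.1 by rewrite Styp.
exists D', (z0 |: Z), f', (U' :|: O), (Su :|: [set sig o | o in predT]).
split.
- split.
  + split=> //; rewrite subUset subUset UW /=; apply/andP; split.
      by apply/subsetP => _ /imsetP [q _ ->].
    by apply: subset_trans OX (subset_trans XW (subsetDl _ _)).
  + split; first by rewrite subUset SuS; apply/subsetP => _ /imsetP [o _ ->].
    have inS q : sit q \in Su :|: [set sig o | o in predT].
      by rewrite inE /sit; case: ifP => _; rewrite imset_f ?orbT.
    have z0in : z0 \in Su :|: [set sig o | o in predT] by rewrite inE imset_f ?orbT.
    apply/subsetP => x; rewrite !inE => /orP[/orP[xD|/imsetP [q _ ->]]|/orP[/eqP ->|xZ]].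
    * have /bigcupP [s sS xs] : x \in \bigcup_(z in Su) ball z by rewrite (subsetP cov) ?inE ?xD.
      by apply/bigcupP; exists s; rewrite // inE sS.
    * by apply/bigcupP; exists (sit q).
    * by apply/bigcupP; exists z0.
    * have /bigcupP [s sS xs] : x \in \bigcup_(z in Su) ball z by rewrite (subsetP cov) ?inE ?xZ ?orbT.
      by apply/bigcupP; exists s; rewrite // inE sS.
  + rewrite /hsum sumD' groupDr //.
      by rewrite (eq_bigr (fun y0 => h (f y0) *+ degree y0)) // => x /f'D ->.
    rewrite (eq_bigr (fun q => h (u q.1) *+ t q.1)); last first.
      move=> q _; rewrite f'w degw /y; case: ifP => // _.
      by have [_ _ _ ->] := gP q.
    rewrite -(pair_bigA _ (fun j _ => h (u j) *+ t j)) /=; apply: group_sumr => j _.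
    rewrite sumr_const card_ord -mulrnA mulnC mulrnA groupMnr // h_d //.
    by have /andP[] := XW' _ (uX j).
  + split; last by rewrite subUset ZS andbT sub1set.
    have -> : (\sum_(x in D') degree x = \sum_(x in D) degree x + \sum_q degree (w q))%N.
      exact: (sumD' nat).
    rewrite dvdn_addr // (eq_bigr (fun q => t q.1)); last by move=> q _; apply: degw.
    rewrite -(pair_bigA _ (fun j _ => t j)) /=; apply: dvdn_sum => j _.
    by rewrite sum_nat_const card_ord dvdn_mulr.
- rewrite /rho big_setU1 /=; last by move: z0D'; rewrite inE negb_or => /andP[].
  rewrite addrC; congr (_ + _).
    have [_ [_ ZD] _ _] := st.
    exact: (@sum_centers_eq _ _ _ Z D f f' (fun _ s => h s + c)).
  by rewrite sum_nbr //; apply: eq_bigr => j _; rewrite f'u.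
- split; last by rewrite -setUA subsetUl.
  apply: leq_trans (card_setU_le _ _) _.
  have := card_setU_le U (y @: predT); rewrite -/U'.
  have := leq_imset_card y predT; rewrite card_prod card_ord.
  by lia_cards.
- split; last exact: subsetUl.
  apply: leq_trans (card_setU_le _ _) _; rewrite leq_add2l.
  by apply: leq_trans (leq_imset_card _ _) _; rewrite card_option card_prod card_ord.
- move=> x xX; rewrite !inE => /orP[/orP[xU|/imsetP [q _ e]]|]; last by left.
    by have /andP[_ /negP] := XW' _ xX.
  right; move: e xX; rewrite /y; case: ifP => _ -> gX; first by exists q.1.
  by have [_ _ /negP] := gP q.
Qed.

(** The stars are placed one by one, but only the two combinations with all centres basic or all
    alternative are kept: a single exchange may leave the coset of [H], and only the total
    difference is under control. *)
Lemma place_gadget D Z f U A Su m (v : 'I_m -> 'I_d + bool -> T) :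
  inv D Z f U A Su -> gadget good (W :\: U) v -> (m <= d)%N ->
  (forall i j, (d * (d * d + 2) + d * (d + 2) + d * d <
     #|[set y in W :\: U | h y == h (v i (inl j))]|)%N) ->
  (d * (d * d).+1 <= #|S :\: Su|)%N ->
  exists D' Z' f' U' Su', [/\
    inv D' Z' f' U' (sumset A [set \sum_i star_sum k (v i (inr false)) (v i \o inl);
                                   \sum_i star_sum k (v i (inr true)) (v i \o inl)]) Su',
    rho Z' f' = rho Z f + \sum_i \sum_j (h (v i (inl j)) + c),
    (#|U'| <= #|U| + d * (d * d + 2))%N &
    (#|Su'| <= #|Su| + d * (d * d).+1)%N].
Proof.
move=> iv [vinj vW vbase vgood] md rich cS.
pose X := [set v q.1 q.2 | q in {: 'I_m * ('I_d + bool)}].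
have cX : (#|X| <= d * (d + 2))%N.
  apply: leq_trans (leq_imset_card _ _) _.
  by rewrite card_prod card_sum card_bool !card_ord leq_mul2r md orbT.
have XP i s : v i s \in X by apply: (imset_f (fun q => v q.1 q.2) (x := (i, s))).
have UW : U \subset W by have [[_ ->]] := iv.
suff /(_ m (leqnn m)) [D' [Z' [f' [U' [Su' [iv' r' [cU' _] [cSu' _] _]]]]]] : forall n, (n <= m)%N ->
  exists D' Z' f' U' Su', [/\
    inv D' Z' f' U' (sumset A
      [set \sum_(i : 'I_m | (i < n)%N) star_sum k (v i (inr false)) (v i \o inl);
           \sum_(i : 'I_m | (i < n)%N) star_sum k (v i (inr true)) (v i \o inl)]) Su',
    rho Z' f' = rho Z f + \sum_(i : 'I_m | (i < n)%N) \sum_j (h (v i (inl j)) + c),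
    (#|U'| <= #|U| + n * (d * d + 2))%N /\ U \subset U',
    (#|Su'| <= #|Su| + n * (d * d).+1)%N /\ Su \subset Su' &
    forall i s, v i s \in U' -> (i < n)%N].
  have allm (F : 'I_m -> gam) : \sum_(i : 'I_m | (i < m)%N) F i = \sum_i F i.
    by apply: eq_bigl => i; rewrite ltn_ord.
  rewrite !allm in iv' r'; exists D', Z', f', U', Su'; split=> //.
    by apply: leq_trans cU' _; rewrite leq_add2l leq_mul2r md orbT.
  by apply: leq_trans cSu' _; rewrite leq_add2l leq_mul2r md orbT.
elim=> [_|n IH nm].
  have none (F : 'I_m -> gam) : \sum_(i : 'I_m | (i < 0)%N) F i = 0 by rewrite big_pred0.
  exists D, Z, f, U, Su; rewrite !none; split; rewrite ?addr0 ?mul0n ?addn0 //.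
    case: iv => [[st UW'] h2 h3 h4]; split=> //; split=> //.
    apply: state_subset st; apply/subsetP => x /imset2P [a s aA].
    by rewrite !inE orbb => /eqP -> ->; rewrite addr0.
  by move=> i s viU; have := vW i s; rewrite inE viU.
have [D1 [Z1 [f1 [U1 [Su1 [iv1 r1 [cU1 sU1] [cSu1 sSu1] vU1]]]]]] := IH (ltnW nm).
pose i0 := Ordinal nm.
have W1 : U1 \subset W by have [[_ ->]] := iv1.
(* The vertices of the later stars are protected as well. *)
pose X1 := [set v i0 s | s in predT] :|: (X :\: U1).
have v0U1 s : v i0 s \notin U1 by apply/negP => /vU1; rewrite ltnn.
have vX1 s : v i0 s \in X1 by apply/setUP; left; apply: (imset_f (v i0)).
pose u j := v i0 (inl j).
pose O := [set v i0 (inr false); v i0 (inr true)].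
have X1X : X1 \subset X :\: U1.
  by rewrite subUset subxx andbT; apply/subsetP => _ /imsetP [s _ ->]; rewrite inE XP v0U1.
have cO : (#|O| <= 2)%N by rewrite cards2; case: (_ != _).
have [||||||||D2 [Z2 [f2 [U2 [Su2 [iv2 r2 [cU2 sU2] [cSu2 sSu2] vU2]]]]]] :=
  @place_star D1 Z1 f1 U1 _ Su1 u O X1 iv1.
- by move=> j j' e; have := vinj (i0, inl j) (i0, inl j') e => -[].
- by move=> j j'; apply: vgood.
- by move=> j; apply: vX1.
- by apply/subsetP => x; rewrite in_set2 => /orP[]/eqP ->; apply: vX1.
- apply: subset_trans X1X _; apply/subsetP => x; rewrite !inE => /andP[-> /imsetP [q _ ->]] /=.
  by have := vW q.1 q.2; rewrite inE => /andP[].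
- move=> j; rewrite !inE; apply/negP => /orP[]/eqP e.
    by have := vinj (i0, inl j) (i0, inr false) e => -[].
  by have := vinj (i0, inl j) (i0, inr true) e => -[].
- move=> j; have := rich i0 j; rewrite -/(u j) => rj.
  have sub : [set y in W :\: U | h y == h (u j)] \subset
      [set y in W :\: (U1 :|: X1) | h y == h (u j)] :|: ((U1 :\: U) :|: X).
    apply/subsetP => y; rewrite !inE => /andP[/andP[yU yW] ->]; rewrite yU yW !andbT /=.
    case yU1: (y \in U1) => //=; rewrite ?orbT //.
    case yX: (y \in X); rewrite ?orbT // orbF; apply/negP.
    by case/orP => // /imsetP [s _ e]; rewrite e XP in yX.
  have cD : (#|U1 :\: U| <= n * (d * d + 2))%N.
    by rewrite cardsD (setIidPr sU1) leq_subLR.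
  have := subset_leq_card sub.
  have := card_setU_le [set y in W :\: (U1 :|: X1) | h y == h (u j)] ((U1 :\: U) :|: X).
  have := card_setU_le (U1 :\: U) X.
  have nd : (n * (d * d + 2) <= d * (d * d + 2))%N by rewrite leq_mul2r (leq_trans (ltnW nm)) ?orbT.
  move: cX cD nd rj; lia_cards.
- have : (#|S :\: Su| <= #|S :\: Su1| + #|Su1 :\: Su|)%N.
    apply: leq_trans (card_setU_le _ _); apply/subset_leq_card/subsetP => x.
    by rewrite !inE => /andP[-> ->]; rewrite andbT orNb.
  have -> : #|Su1 :\: Su| = (#|Su1| - #|Su|)%N by rewrite cardsD (setIidPr sSu1).
  have : (n.+1 * (d * d).+1 <= d * (d * d).+1)%N by rewrite leq_mul2r (leq_trans nm) ?orbT.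
  by move: cSu1 cS; rewrite mulSn; lia_cards.
exists D2, Z2, f2, U2, Su2.
have lastF (F : 'I_m -> gam) :
    \sum_(i : 'I_m | (i < n.+1)%N) F i = \sum_(i : 'I_m | (i < n)%N) F i + F i0.
  rewrite (bigD1 i0) //= addrC; congr (_ + _); apply: eq_bigl => i.
  by rewrite ltnS leq_eqVlt -[i == i0]/(i == n :> nat); case: ltngtP.
rewrite !lastF; split.
- case: iv2 => [[st2 UW2] h2 h3 h4]; split=> //; split=> //.
  apply: state_subset st2; apply/subsetP => _ /imset2P [a s aA sin ->].
  have [bo sc] : exists bo, s = \sum_(i : 'I_m | (i < n)%N) star_sum k (v i (inr bo)) (v i \o inl)
      + star_sum k (v i0 (inr bo)) (v i0 \o inl).
    by move: sin; rewrite !inE => /orP[]/eqP ->; [exists false|exists true].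
  rewrite sc addrA; apply: imset2_f.
    by apply: imset2_f => //; rewrite !inE; case: (bo); rewrite eqxx ?orbT.
  by apply: (imset_f (fun x => star_sum k x u)); rewrite !inE; case: (bo); rewrite eqxx ?orbT.
- by rewrite r2 r1 addrA.
- split; last exact: subset_trans sU1 sU2.
  by move: cU1 cU2 cO; rewrite mulSn; lia_cards.
- split; last exact: subset_trans sSu1 sSu2.
  by move: cSu1 cSu2; rewrite mulSn; lia_cards.
- move=> i s vU; rewrite ltnS leq_eqVlt; case: (boolP (v i s \in U1)) => [/vU1 ->|vNU1].
    by rewrite orbT.
  have vX1' : v i s \in X1 by rewrite inE orbC inE vNU1 XP.
  have [vO|[j e]] := vU2 _ vX1' vU.
    have [bo e] : exists bo, v i s = v i0 (inr bo).
      by move: vO; rewrite !inE => /orP[]/eqP ->; [exists false|exists true].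
    by have := vinj (i, s) (i0, inr bo) e => -[-> _]; rewrite eqxx.
  by have := vinj (i, s) (i0, inl j) e => -[-> _]; rewrite eqxx.
Qed.

Local Close Scope ring_scope.

(** * Filling a coset of the minimal subgroup *)

Section Fill.
Variables (kappa s : nat).
Hypothesis kappa_gt0 : 0 < kappa.
Hypothesis h_vals : #|[set h x | x in W]| <= gidx H.

(* One step of the filling consumes at most [usage] vertices, and needs up to
   [depth] free vertices in the potential class of each vertex it uses. *)
Definition usage := d * (d * d + 2) + d * d + 2 * kappa.
Definition depth := d * (d * d + 2) + d * (d + 2) + d * d + 2 * kappa + d.
Definition budget := 2 * usage + depth.

Hypothesis robust_gadget : forall (K : {group gam}) (X : {set T}), K \proper H ->
  2 * #|X| <= budget * (#|H| + 2 * gidx H) ->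
  escapes k good d H K (W :\: X).

Hypothesis rich : kappa = 1 \/
  forall X : {set T}, #|X| <= budget * (#|H| + gidx H) ->
  rich_star k good d (2 * kappa) (W :\: X).

Let c1 := (d * d).+1.

Definition shallow (U : {set T}) : {set T} :=
  [set x in W | #|[set y in W :\: U | h y == h x]| <= depth].

Lemma card_shallow (U : {set T}) : #|shallow U :\: U| <= depth * gidx H.
Proof.
apply: (@leq_trans (\sum_(a in [set h x | x in W]) depth)); last first.
  by rewrite sum_nat_const mulnC leq_mul2l h_vals orbT.
have -> : #|shallow U :\: U| = \sum_(a in [set h x | x in W])
    #|[set x in shallow U :\: U | h x == a]|.
  rewrite -sum1_card (partition_big h (mem [set h x | x in W])) /=.
    by apply: eq_bigr => a _; rewrite sum1dep_card.
  by move=> x; rewrite !inE => /andP[_ /andP[xW _]]; apply: imset_f.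
apply: leq_sum => a _.
case: (set_0Vmem [set x in shallow U :\: U | h x == a]) => [->|[x]].
  by rewrite cards0.
rewrite !inE => /andP[/andP[_ /andP[xW le]] /eqP ha]; apply: leq_trans le.
apply/subset_leq_card/subsetP => y; rewrite !inE ha => /andP[/andP[-> /andP[-> _]] ->] //.
Qed.

(* While the stabiliser of A has order below kappa, a rich star makes A grow by
   kappa or, by Olson's theorem, raises that order to kappa, at most once; from
   then on every gadget adds a whole coset of the stabiliser to A. *)
Definition pot (A : {set gam}) :=
  c1 * (d * (#|H| - #|A|) + kappa * (kappa - minn kappa #|stab A|)).

(** [A] starts with one element and grows in every step, so the fourth condition keeps the vertices
    used within [usage] times the order of [H]. In the last one [pot A] is the cost in sites still
    to come, scaled by [kappa]. *)
Let good_state D Z f U A Su := [/\ inv D Z f U A Su, A != set0,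
  {in A, forall a, (a - rho Z f)%R \in H},
  #|U| + usage <= usage * #|A| & kappa * #|Su| + pot A <= kappa * s].

Hypothesis s_le : s <= #|S|.

Lemma star_base_mem (x : T) (u : 'I_d -> T) : x \in W -> (forall j, u j \in W) ->
  (forall j, good x (u j)) ->
  (star_sum k x u - \sum_j (h (u j) + c))%R \in H.
Proof.
move=> xW uW gx; have e : (\sum_(j < d) (k x (u j) - (h x + h (u j) + c)))%R \in H.
  by apply: group_sumr => j _; apply: h_good.
apply: (mem_eq (groupDr e (h_d xW))).
have -> : (h x *+ d)%R = (\sum_(j < d) h x)%R by rewrite sumr_const card_ord.
by rewrite /star_sum -sumrB -big_split /=; apply: eq_bigr => j _; zmod_eq.
Qed.

Lemma fill_step D Z f U A Su : good_state D Z f U A Su -> #|A| < #|H| ->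
  exists D' Z' f' U' A' Su', good_state D' Z' f' U' A' Su' /\ #|A| < #|A'|.
Proof.
move=> [iv A0 Arho cU cpot] ltA.
have [[st UW] [SuS cov] _ _] := iv.
have stH := stab_proper A0 Arho ltA.
have cS : #|S| <= #|S :\: Su| + #|Su|.
  by rewrite -(cardsID Su S) addnC leq_add2l subset_leq_card // subsetIr.
have HA := ltnW ltA.
pose X := U :|: (shallow U :\: U).
have cX : #|X| <= usage * #|H| + depth * gidx H.
  apply: leq_trans (card_setU_le _ _) (leq_add _ (card_shallow U)).
  apply: leq_trans (_ : usage * #|A| <= _); last by rewrite leq_mul2l HA orbT.
  by apply: leq_trans cU; apply: leq_addr.
have deep x : x \in W :\: X -> depth < #|[set y in W :\: U | h y == h x]|.
  rewrite !inE negb_or => /andP[/andP[xU]]; rewrite (negPf xU) /= => + xW.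
  by rewrite xW /= -ltnNge.
have WX x : x \in W :\: X -> x \in W :\: U.
  by rewrite !inE negb_or => /andP[/andP[-> _] ->].
have card_bound (A' : {set gam}) r : {in A', forall a, (a - r)%R \in H} -> #|A'| <= #|H|.
  exact: card_in_coset.
have kc : kappa * (d * c1) = c1 * (d * kappa) by rewrite [in RHS]mulnCA mulnC -mulnA.
(* In the first case the stabiliser is a proper subgroup of [H], so some gadget has its difference
   in [H] but outside it, and the gain is a whole coset, at least [kappa] values. *)
have [kst|stk] := leqP kappa #|stab A|.
  have [|m [v [md gv vH vK]]] := robust_gadget stH (X := X).
    by move: cX; rewrite /budget; have : 0 < 1 by []; set a := #|X|; nia.
  have [vinj vW vbase vleaf] := gv.
  have gvU : gadget good (W :\: U) v by split=> // i s0; apply: WX.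
  set x := (\sum_i star_sum k (v i (inr false)) (v i \o inl))%R.
  set y := (\sum_i star_sum k (v i (inr true)) (v i \o inl))%R.
  have yx : gdiff k v = (y - x)%R by rewrite /gdiff sumrB.
  rewrite yx in vH vK.
  pose r := (rho Z f + \sum_i \sum_j (h (v i (inl j)) + c))%R.
  have xr : (x - \sum_i \sum_j (h (v i (inl j)) + c))%R \in H.
    rewrite /x -sumrB; apply: group_sumr => i _.
    apply: (@star_base_mem _ (v i \o inl)) => [|j|j]; last exact: vbase.
      by have := vW i (inr false); rewrite inE => /andP[].
    by have := vW i (inl j); rewrite inE => /andP[].
  have A'H : {in sumset A [set x; y], forall a, (a - r)%R \in H}.
    move=> _ /imset2P [a b aA bxy ->].
    have bH : (b - x)%R \in H.
      by move: bxy; rewrite !inE => /orP[]/eqP ->; rewrite ?subrr ?group0r.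
    apply: (mem_eq (groupDr (groupDr (Arho a aA) bH) xr)).
    by rewrite /r; zmod_eq.
  have grow := sumset_pair vK.
  have cA' := card_bound _ _ A'H.
  have s0 := stab_sumset A [set x; y].
  have cs0 := subset_leq_card s0.
  have pk : kappa - minn kappa #|stab A| = 0 by rewrite (minn_idPl kst) subnn.
  have pk' : kappa - minn kappa #|stab (sumset A [set x; y])| = 0.
    by rewrite (minn_idPl (leq_trans kst cs0)) subnn.
  have [||D' [Z' [f' [U' [Su' [iv' r' cU' cSu']]]]]] := place_gadget iv gvU md.
  - move=> i j; apply: leq_ltn_trans (deep _ (vW i (inl j))).
    by rewrite /depth -!addnA !leq_add2l leq_addr.
  - move: cpot; rewrite /pot pk muln0 addn0 => cpot.
    have h1 : kappa * #|Su| + c1 * (d * kappa) <= kappa * s.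
      apply: leq_trans cpot; rewrite leq_add2l !leq_mul2l.
      by apply/orP; right; apply/orP; right; move: grow kst cA'; lia_cards.
    have h2 : kappa * (#|Su| + d * c1) <= kappa * s.
      by apply: leq_trans h1; rewrite mulnDr leq_add2l kc.
    move: h2; rewrite leq_pmul2l // -/c1; move: cS s_le; lia_cards.
  exists D', Z', f', U', (sumset A [set x; y]), Su'; split; last first.
    by move: grow kst kappa_gt0; lia_cards.
  split=> //.
  - by rewrite -card_gt0; move: grow kst kappa_gt0; lia_cards.
  - by rewrite r'; apply: A'H.
  - have : usage * (#|A|.+1) <= usage * #|sumset A [set x; y]|.
      by rewrite leq_mul2l; apply/orP; right; move: grow kst kappa_gt0; lia_cards.
    have : d * (d * d + 2) <= usage by rewrite /usage -addnA leq_addr.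
    by move: cU cU'; rewrite mulnS; move: usage => us; lia_cards.
  - move: cpot; rewrite /pot pk pk' muln0 !addn0 => cpot; apply: leq_trans cpot.
    have h1 : c1 * (d * (#|H| - #|sumset A [set x; y]|)) + kappa * (d * c1) <=
        c1 * (d * (#|H| - #|A|)).
      rewrite kc -!mulnDr !leq_mul2l; apply/orP; right; apply/orP; right.
      by move: grow kst cA'; lia_cards.
    have := leq_mul (leqnn kappa) cSu'; rewrite mulnDr -/c1.
    by move: h1; lia_cards.
(* For [kappa = 1] this branch is void, since a stabiliser is never empty. *)
have [k1|rich_st] := rich; first by move: stk; rewrite k1 ltnS leqNgt cardG_gt0.
have [|u [O [uinj ugood uWO [OW cO] [sinj Ogood]]]] := rich_st X.
  have ub : usage <= budget by rewrite /budget mul2n -addnn -addnA leq_addr.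
  have db : depth <= budget by rewrite leq_addl.
  by apply: leq_trans cX _; rewrite mulnDr leq_add // leq_mul2r ?ub ?db orbT.
have uW j : u j \in W :\: X /\ u j \notin O by have := uWO j; rewrite inE => /andP[].
set B := [set star_sum k x u | x in O].
have cB : 2 * kappa <= #|B| by rewrite card_in_imset // cO.
have OW' x : x \in O -> x \in W by move/(subsetP OW); rewrite inE => /andP[].
have uW' j : u j \in W by have [] := uW j; rewrite inE => /andP[].
have grow := sumset_growth A0 cB stk.
have gA : #|A| < #|sumset A B| by case: grow => [|/andP[]//]; move: kappa_gt0; lia_cards.
pose r := (rho Z f + \sum_j (h (u j) + c))%R.
have A'H : {in sumset A B, forall a, (a - r)%R \in H}.
  move=> _ /imset2P [a _ aA /imsetP [x xO ->] ->].
  apply: (mem_eq (groupDr (Arho a aA) (star_base_mem (OW' x xO) uW' (Ogood x xO)))).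
  by rewrite /r; zmod_eq.
have cA' := card_bound _ _ A'H.
pose Y := O :|: [set u j | j in predT].
have cY : #|Y| <= 2 * kappa + d.
  apply: leq_trans (card_setU_le _ _) _; rewrite cO leq_add2l.
  by apply: leq_trans (leq_imset_card _ _) _; rewrite card_ord.
have [||||||D' [Z' [f' [U' [Su' [iv' r' [cU' _] [cSu' _] _]]]]]] :=
  @place_star D Z f U A Su u O Y iv uinj ugood.
- by move=> j; rewrite inE imset_f ?orbT.
- exact: subsetUl.
- rewrite subUset; apply/andP; split; last first.
    by apply/subsetP => _ /imsetP [j _ ->]; apply: WX; have [] := uW j.
  by apply: subset_trans OW _; apply/subsetP => x; apply: WX.
- by move=> j; have [] := uW j.
- move=> j; have [/deep dj _] := uW j.
  have sub : [set y in W :\: U | h y == h (u j)] \subset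
      [set y in W :\: (U :|: Y) | h y == h (u j)] :|: Y.
    apply/subsetP => y; rewrite in_set => /andP[/setDP[yW yU] yh].
    rewrite in_setU in_set in_setD in_setU negb_or yU yW yh andbT /= andbT.
    by case: (y \in Y).
  have := subset_leq_card sub.
  have := card_setU_le [set y in W :\: (U :|: Y) | h y == h (u j)] Y.
  have : d * d + (2 * kappa + d) <= depth by rewrite /depth; lia.
  by move: cY dj; move: depth (d * d) => a b; lia_cards.
- have : kappa * #|Su| + kappa * c1 <= kappa * s.
    apply: leq_trans cpot; rewrite leq_add2l /pot mulnC leq_mul2l; apply/orP; right.
    apply: leq_trans (leq_addl _ _); rewrite -{1}[kappa]muln1 leq_mul2l.
    apply/orP; right; rewrite subn_gt0 (minn_idPr (ltnW stk)) //.
  by rewrite -mulnDr leq_pmul2l // /c1; move: cS s_le; lia_cards.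
exists D', Z', f', U', (sumset A B), Su'; split=> //; split=> //.
- by rewrite -card_gt0; move: gA; lia_cards.
- by rewrite r'; apply: A'H.
- have : usage * (#|A|.+1) <= usage * #|sumset A B| by rewrite leq_mul2l gA orbT.
  have : d * d + #|O| <= usage by rewrite cO /usage -addnA leq_addl.
  by move: cU cU'; rewrite mulnS; move: usage => us; lia_cards.
- apply: leq_trans cpot; have := leq_mul (leqnn kappa) cSu'; rewrite mulnDr -/c1 => h1.
  apply: leq_trans (leq_add h1 (leqnn _)) _; rewrite -addnA leq_add2l /pot.
  have s0 := subset_leq_card (stab_sumset A B).
  rewrite [kappa * c1]mulnC -mulnDr leq_mul2l; apply/orP; right.
  case: grow => [le|/andP[lt ks]].
    have m1 : kappa * (kappa - minn kappa #|stab (sumset A B)|) <=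
        kappa * (kappa - minn kappa #|stab A|).
      by rewrite leq_mul2l leq_sub2l ?orbT // leq_min geq_minl (leq_trans (geq_minr _ _)).
    have m2 : d * (#|H| - #|sumset A B| + kappa) <= d * (#|H| - #|A|).
      by rewrite leq_mul2l; apply/orP; right; move: le cA'; lia_cards.
    have m3 : kappa <= d * kappa by rewrite leq_pmull.
    by move: m1 m2 m3; rewrite mulnDr; clear; lia.
  rewrite (minn_idPl ks) subnn muln0 addn0 addnC leq_add //.
    by rewrite leq_mul2l leq_sub2l ?orbT // ltnW.
  by rewrite leq_pmulr // subn_gt0 (minn_idPr (ltnW stk)).
Qed.

Lemma fill :
  c1 * (d * #|H| + kappa * kappa) <= kappa * s ->
  forall f0 : G -> T, exists D Z f U A Su, [/\ inv D Z f U A Su,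
    forall a, (a - rho Z f)%R \in H -> a \in A,
    #|U| <= usage * #|H| & #|Su| <= s].
Proof.
move=> cs f0.
suff : forall n D Z f U A Su, good_state D Z f U A Su -> #|H| - #|A| <= n ->
    exists D Z f U A Su, good_state D Z f U A Su /\ #|H| <= #|A|.
  case/(_ #|H| set0 set0 f0 set0 [set 0%R] set0).
  - split.
    + split; first by split; [apply: state0|apply: sub0set].
      * by rewrite sub0set setU0 sub0set.
      * by rewrite /hsum big_set0 group0r.
      * by rewrite big_set0 dvdn0 sub0set.
    + by rewrite -card_gt0 cards1.
    + by move=> a; rewrite inE => /eqP ->; rewrite /rho big_set0 subrr group0r.
    + by rewrite cards0 cards1 muln1.
    + rewrite cards0 muln0 add0n; apply: leq_trans cs; rewrite leq_mul2l leq_add ?orbT //.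
        by rewrite leq_mul2l leq_subr orbT.
      by rewrite leq_mul2l leq_subr orbT.
  - exact: leq_subr.
  move=> D [Z [f [U [A [Su [[iv A0 Arho cU cpot] le]]]]]].
  have cA := card_in_coset Arho.
  have eA : #|A| = #|H| by apply/eqP; rewrite eqn_leq cA le.
  exists D, Z, f, U, A, Su; split=> //; first exact: full_coset Arho eA.
    by rewrite -eA; apply: leq_trans cU; apply: leq_addr.
  by rewrite -(leq_pmul2l kappa_gt0); apply: leq_trans cpot; apply: leq_addr.
elim=> [|n IH] D Z f U A Su gs le.
  by exists D, Z, f, U, A, Su; split=> //; rewrite -subn_eq0 -leqn0.
have [lt|le'] := ltnP #|A| #|H|; last by exists D, Z, f, U, A, Su.
have [D' [Z' [f' [U' [A' [Su' [gs' lt']]]]]]] := fill_step gs lt.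
by apply: IH gs' _; move: le lt lt'; lia_cards.
Qed.

End Fill.

(** * Completing the copy *)

Section Finish.
Variables (Dl b : nat) (W0 : {set T}).
Hypothesis degG : max_degree G <= Dl.
Hypothesis ksym : forall x y, k x y = k y x.
Hypothesis bad_le : {in W0, forall x, #|[set y in W0 | ~~ good x y]| <= b}.
Hypothesis WW0 : W \subset W0.

Definition balanced D Z f U A := [/\ state k good D Z f U A /\ U \subset W,
  hsum D f \in H, d %| \sum_(y in D) degree y & Z \subset S].

(** At most [#|Q| * Dl] placed vertices are adjacent to [Q]; each of them, and each vertex of [B],
    excludes at most [b] positions. What remains is split into at most [#|gam|] classes of [h]. *)
Lemma allowed_class D Z f U A (Q : {set G}) (B : {set T}) (m : nat) :
  state k good D Z f U A -> U \subset W -> B \subset W0 -> 0 < m ->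
  #|U| + (#|Q| * Dl + #|B|) * b + #|gam| * m <= #|W| ->
  exists a (Y : {set T}), [/\ Y \subset W :\: U, m <= #|Y|, {in Y, forall y, h y = a},
    {in D & Q, forall x q, adj x q -> {in Y, forall y, good (f x) y}} &
    {in B & Y, forall s y, good s y}].
Proof.
move=> st UW BW m0 cW; have [[_ fU] _ _ _] := st.
pose N := D :&: \bigcup_(q in Q) nbrs q.
pose S0 := f @: N :|: B.
have cN : #|N| <= #|Q| * Dl.
  apply: leq_trans (subset_leq_card (subsetIr _ _)) _; rewrite -sum_nat_const.
  elim/big_rec2: _ => [|q u A' qQ le]; first by rewrite cards0.
  apply: leq_trans (card_setU_le _ _) (leq_add _ le).
  exact: leq_trans (card_nbrs q) degG.
have cS0 : #|S0| <= #|Q| * Dl + #|B|.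
  apply: leq_trans (card_setU_le _ _) _; rewrite leq_add2r.
  exact: leq_trans (leq_imset_card _ _) cN.
have S0W : S0 \subset W0.
  rewrite subUset BW andbT; apply/subsetP => _ /imsetP [x /setIP [xD _] ->].
  apply: (subsetP WW0); apply: (subsetP UW); apply: (subsetP fU); exact: imset_f.
pose Y0 := [set y in W :\: U | [forall s in S0, good s y]].
have sub : W \subset U :|: (Y0 :|: \bigcup_(s in S0) [set y in W0 | ~~ good s y]).
  apply/subsetP => y yW; rewrite !inE yW andbT; case: (y \in U) => //=.
  case: (boolP [forall s in S0, good s y]) => //= /forall_inPn [s sS ng].
  by apply/bigcupP; exists s => //; rewrite inE (subsetP WW0).
have cB : #|\bigcup_(s in S0) [set y in W0 | ~~ good s y]| <= #|S0| * b.
  by apply: card_bigcup_le => s sS; rewrite bad_le ?(subsetP S0W).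
have cY0 : #|gam| * m <= #|Y0|.
  have := subset_leq_card sub; move: cB; set B' := \bigcup_(s in S0) _ => cB.
  have := card_setU_le U (Y0 :|: B'); have := card_setU_le Y0 B'.
  have := leq_mul cS0 (leqnn b); move: cB cW; move: ((_ + _) * b).
  by move: (#|S0| * b) (#|gam| * m) => u v w; lia_cards.
have g0 : 0 < #|gam| by apply/card_gt0P; exists 0%R.
have Y0n : Y0 != set0 by rewrite -card_gt0; apply: leq_trans cY0; rewrite muln_gt0 g0.
have [//|a _ le] := @pigeonhole _ _ Y0 h [set: gam] Y0n.
set Y := [set y in Y0 | _] in le.
have YY0 y : y \in Y -> y \in Y0 by rewrite inE => /andP[].
exists a, Y; split.
- by apply/subsetP => y /YY0; rewrite inE => /andP[].
- by have := leq_trans cY0 le; rewrite cardsT leq_pmul2l.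
- by move=> y; rewrite inE => /andP[_ /eqP].
- move=> x q xD qQ ad y /YY0; rewrite inE => /andP[_ /forall_inP]; apply.
  rewrite inE imset_f // inE xD; apply/bigcupP; exists q => //.
  by rewrite inE adj_sym.
- move=> s y sB /YY0; rewrite inE => /andP[_ /forall_inP]; apply.
  by rewrite inE sB orbT.
Qed.

Lemma rho_eq (D Z : {set G}) (f f' : G -> T) : {in Z, forall z, nbrs z \subset D} -> {in D, f' =1 f} ->
  rho Z f' = rho Z f.
Proof. by move=> ZD ff'; apply: (sum_centers_eq (fun _ s => h s + c)%R ZD ff'). Qed.

Lemma sum_setU_disj (V : nmodType) (D Q : {set G}) (F : G -> V) : Q \subset ~: D ->
  (\sum_(x in D :|: Q) F x = \sum_(x in D) F x + \sum_(x in Q) F x)%R.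
Proof.
move=> QD; rewrite (eq_bigl _ _ (fun x => in_setU x D Q)) bigU //=.
by rewrite disjoint_sym disjoint_subset; apply/subsetP => x /(subsetP QD); rewrite inE.
Qed.

Lemma hsum_place (D Q : {set G}) (f f' : G -> T) (a : gam) : Q \subset ~: D -> {in D, f' =1 f} ->
  {in Q, forall x, h (f' x) = a} ->
  hsum (D :|: Q) f' = (hsum D f + a *+ \sum_(x in Q) degree x)%R.
Proof.
move=> QD ff' Qa; rewrite /hsum sum_setU_disj // -sumrMnr; congr (_ + _)%R.
  by apply: eq_bigr => x /ff' ->.
by apply: eq_bigr => x /Qa ->.
Qed.

(** In one class [a] the set changes [hsum] by [a] times its total degree, a multiple of [d].
    Independence spares any demand on the pairs inside the class. *)
Lemma place_bunch D Z f U A (Q : {set G}) :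
  balanced D Z f U A -> Q \subset ~: (D :|: Z) -> {in Q &, forall x y, ~~ adj x y} ->
  #|Q| <= d -> d %| \sum_(x in Q) degree x ->
  #|U| + d * Dl * b + #|gam| * d <= #|W| ->
  exists f' U', [/\ balanced (D :|: Q) Z f' U' A, #|U'| <= #|U| + #|Q| &
    rho Z f' = rho Z f].
Proof.
move=> [[st UW] hs dD ZS] QDZ Qi cQ dQ cW.
have [||a [Y [YW cY Ya Yg _]]] := allowed_class (Q := Q) (B := set0) st UW _ d_gt0.
- exact: sub0set.
- apply: leq_trans cW; rewrite leq_add2r leq_add2l cards0 addn0.
  by rewrite leq_mul2r leq_mul2r cQ !orbT.
have [||||f' [U' [f'D f'Q st' [U'Y cU']]]] := place_into st QDZ (Y := Y).
- by apply/subsetP => y /(subsetP YW); rewrite !inE => /andP[].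
- exact: leq_trans cY.
- by move=> x y xQ yQ ad; have := Qi x y xQ yQ; rewrite ad.
- by move=> x q xD qQ ad y yY; rewrite [X in _ && X]good_sym (Yg x q).
have QD : Q \subset ~: D by apply: subset_trans QDZ _; rewrite setCS subsetUl.
have [[_ _] [_ ZD] _ _] := st.
exists f', (U :|: U'); split; last exact: (rho_eq ZD).
- split=> //.
  + split=> //; rewrite subUset UW; apply: subset_trans U'Y (subset_trans YW (subsetDl _ _)).
  + rewrite (hsum_place (a := a) (f := f)) //; last by move=> x /f'Q /Ya.
    case/dvdnP: dQ => e ->; rewrite groupDr // mulnC mulrnA groupMnr //.
    have [y yY] : exists y, y \in Y by apply/set0Pn; rewrite -card_gt0 (leq_trans d_gt0).
    rewrite -(Ya y yY) h_d //; exact: subsetP (subset_trans YW (subsetDl _ _)) _ yY.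
  + have -> : \sum_(y in D :|: Q) degree y = \sum_(y in D) degree y + \sum_(y in Q) degree y.
      exact: (sum_setU_disj (V := nat)).
    by rewrite dvdn_addr.
- by apply: leq_trans (card_setU_le _ _) _; rewrite leq_add2l.
Qed.

(** Pigeonhole over [Dl.+1] degrees, followed by a greedy choice of [d] vertices that each exclude
    at most [Dl.+1]. *)
Definition crowd := Dl.+1 * (d * Dl.+1) + 1.

Lemma independent_bunch (R0 : {set G}) : crowd <= #|R0| ->
  exists Q : {set G}, [/\ Q \subset R0, {in Q &, forall x y, ~~ adj x y}, #|Q| = d &
    d %| \sum_(x in Q) degree x].
Proof.
move=> cR; have R0n : R0 != set0 by rewrite -card_gt0; apply: leq_trans cR; rewrite /crowd addn1.
have dle (x : G) : degree x < Dl.+1 by rewrite ltnS (leq_trans (card_nbrs x)).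
have [//|e _ le] := @pigeonhole _ _ R0 (fun x => inord (degree x) : 'I_Dl.+1) [set: 'I_Dl.+1] R0n.
set C := [set x in R0 | _] in le.
have cC : d * Dl.+1 < #|C|.
  move: le; rewrite cardsT card_ord => le; have := leq_trans cR le.
  by rewrite /crowd addn1 ltn_mul2l => /andP[].
have Cd x : x \in C -> degree x = e by rewrite inE => /andP[_ /eqP <-]; rewrite inordK.
have [x0 _] : exists x, x \in C by apply/set0Pn; rewrite -card_gt0; apply: leq_ltn_trans cC.
have [|||g [gC gi]] := @greedy_choice 'I_d G (fun=> C) (fun x y => ~~ adj x y && (x != y)) Dl.+1 x0.
- by move=> x y; rewrite adj_sym eq_sym.
- move=> _ _ x _; apply: (@leq_trans #|x |: nbrs x|).
    apply/subset_leq_card/subsetP => y; rewrite in_set => /andP[_].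
    by rewrite negb_and !negbK !inE => /orP[->|/eqP ->]; rewrite ?eqxx ?orbT.
  rewrite cardsU1 -add1n leq_add //; first by case: (_ \in _).
  exact: leq_trans (card_nbrs x) degG.
- by move=> _; rewrite card_ord.
have ginj : injective g.
  by move=> i j eg; apply/eqP/negPn/negP => /gi; rewrite eg eqxx andbF.
exists [set g i | i in predT]; split.
- by apply/subsetP => _ /imsetP [i _ ->]; have := gC i; rewrite inE => /andP[].
- move=> _ _ /imsetP [i _ ->] /imsetP [j _ ->]; have [->|/gi /andP[]//] := eqVneq i j.
  by rewrite adj_irrefl.
- by rewrite card_imset // card_ord.
- rewrite big_imset /=; last by move=> i j _ _; apply: ginj.
  by rewrite (eq_bigr (fun=> nat_of_ord e)) ?sum_nat_const ?card_ord ?dvdn_mulr // => i _; apply: Cd.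
Qed.

Lemma place_most (PP : {set G}) (u0 : nat) D Z f U A :
  balanced D Z f U A -> [disjoint PP & D :|: Z] ->
  #|U| + #|~: (D :|: Z)| <= u0 -> u0 + d * Dl * b + #|gam| * d <= #|W| ->
  exists D' f' U', [/\ balanced D' Z f' U' A, D \subset D' /\ [disjoint PP & D' :|: Z],
    #|U'| + #|~: (D' :|: Z)| <= u0, #|~: (D' :|: Z) :\: PP| < crowd &
    rho Z f' = rho Z f].
Proof.
move: {2}#|_| (leqnn #|~: (D :|: Z)|) => n; elim: n D f U => [|n IH] D f U cn bal dPP cU cW.
  exists D, f, U; split=> //; apply: leq_ltn_trans (subset_leq_card (subsetDl _ _)) _.
  by move: cn; rewrite leqn0 => /eqP ->; rewrite /crowd addn1.
have [lt|ge] := ltnP #|~: (D :|: Z) :\: PP| crowd; first by exists D, f, U.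
have [Q [QR Qi cQ dQ]] := independent_bunch ge.
have QDZ : Q \subset ~: (D :|: Z) := subset_trans QR (subsetDl _ _).
have dQ' : #|Q| <= d by rewrite cQ.
have [|f' [U' [bal' cU' r']]] := place_bunch bal QDZ Qi dQ' dQ.
  by apply: leq_trans cW; rewrite !leq_add2r; apply: leq_trans cU; apply: leq_addr.
have eC : ~: (D :|: Q :|: Z) = ~: (D :|: Z) :\: Q.
  by rewrite setDE -setCU setUAC.
have cC : #|~: (D :|: Q :|: Z)| + d = #|~: (D :|: Z)|.
  by rewrite eC cardsD (setIidPr QDZ) cQ subnK // -cQ subset_leq_card.
have [||||D' [f2 [U2 [h1 [DD' h2] h3 h4 h5]]]] := IH (D :|: Q) f' U' _ bal'.
- by move: cC cn d_gt0; lia_cards.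
- rewrite setUAC disjoint_subset; apply/subsetP => x xP; rewrite inE /= in_setU negb_or.
  move: dPP; rewrite disjoint_subset => /subsetP /(_ x xP); rewrite inE /= => -> /=.
  by apply: contraL xP => /(subsetP QR); rewrite inE => /andP[].
- by move: cC cU cU'; rewrite cQ; lia_cards.
- exact: cW.
by exists D', f2, U2; split; rewrite ?h5 //; split=> //; apply: subset_trans DD'; apply: subsetUl.
Qed.

Hypothesis gam_dvd : #|gam| %| #|edges G|.

(* The last vertices R go to one homogeneous set, where the deviations of the
   edges inside R add up to a multiple of [d]. *)
Lemma final_copy D Z f U A (R P : {set G}) (Y : {set T}) (a dl : gam) (m e : nat) :
  balanced D Z f U A -> (forall x, (x - rho Z f)%R \in H -> x \in A) ->
  R = ~: (D :|: Z) -> Y \subset W :\: U -> #|R| <= #|Y| -> Y != set0 ->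
  {in Y, forall y, h y = a} ->
  {in D & R, forall x q, adj x q -> {in Y, forall y, good (f x) y}} ->
  {in Y &, forall x y, x != y -> (k x y - (h x + h y + c) - dl)%R \in H} ->
  (dl *+ d)%R \in H -> d %| m + e ->
  P \subset R -> #|P| = e -> {in P, forall z, #|nbrs z :&: (R :\: P)| = 1} ->
  {in P &, forall z z', ~~ adj z z'} ->
  m = #|[set p in edge_pairs G | (p.1 \in R :\: P) && (p.2 \in R :\: P)]| ->
  zero_copy G k.
Proof.
move=> [[st UW] hs dD ZS] Afull RE YW cR Y0 Ya Dg Ydl dld dme PR cP Pn Pi mE.
have [Sd _ _] := SP.
have [[finj fU] [DZ ZD] fgood fA] := st.
(* The requirement of goodness is dropped because pairs inside the clique may be bad; inside [D] it
   survives as [fgood]. *)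
have st1 : state k (fun _ _ => true) D Z f U A by split.
have QDZ : R \subset ~: (D :|: Z) by rewrite RE.
have [|//|||f' [U' [f'D f'R st' _]]] := place_into st1 QDZ (Y := Y).
- by apply/subsetP => y /(subsetP YW); rewrite !inE => /andP[].
- by [].
- by [].
have RD : R \subset ~: D by apply: subset_trans QDZ _; rewrite setCS subsetUl.
have D5 : D :|: R = ~: Z.
  apply/setP => x; rewrite RE !inE negb_or; case xD: (x \in D) => //=.
  by move: DZ; rewrite disjoint_subset => /subsetP /(_ x xD); rewrite inE /= => ->.
apply: (state_copy ksym st' D5); apply: Afull.
have rE : rho Z f' = rho Z f.
  by apply: (sum_centers_eq (fun _ s => h s + c)%R ZD f'D).
have ZD5 : {in Z, forall z, nbrs z \subset D :|: R}.
  by move=> z /ZD zD; apply: subset_trans zD (subsetUl _ _).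
pose phi (x y : G) : gam := if (x \in R) && (y \in R) then dl else 0%R.
(* There are [m] edges inside [R :\: P], each vertex of [P] adds exactly one, and [P] is
   independent: the total deviation is [dl] times [m + e]. *)
have phiH : (esum (D :|: R) phi)%R \in H.
  have phis x y : phi x y = phi y x by rewrite /phi andbC.
  have PD : {in P, forall z, nbrs z \subset ~: P}.
    move=> z zP; apply/subsetP => y; rewrite in_nbrs inE => zy.
    by apply/negP => yP; have := Pi z y zP yP; rewrite zy.
  have -> : esum (D :|: R) phi = (\sum_(p in edge_pairs G) phi p.1 p.2)%R.
    rewrite /esum big_mkcondr; apply: eq_bigr => -[x y] /= _.
    by rewrite /phi !inE; case: (x \in R); case: (y \in R); rewrite ?orbT //= ?andbF //; case: ifP.
  rewrite (esum_split phis (erefl _) PD).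
  have -> : esum (~: P) phi = (dl *+ m)%R.
    rewrite mE -sumr_const /esum big_mkcondr [RHS]big_mkcond [LHS]big_mkcond /=.
    apply: eq_bigr => -[x y] _; rewrite [in RHS]inE /phi !inE /=.
    by case: (adj x y && _); case: (x \in P); case: (x \in R); case: (y \in P); case: (y \in R).
  have -> : (\sum_(z in P) \sum_(y in nbrs z) phi z y)%R = (dl *+ e)%R.
    rewrite -cP -sumr_const; apply: eq_bigr => z zP.
    rewrite -[RHS]mulr1n -(Pn z zP) -sumr_const big_mkcond [RHS]big_mkcond /=.
    apply: eq_bigr => y _; rewrite in_setI in_setD; case zy: (y \in nbrs z) => //=.
    have yP : y \notin P by have := subsetP (PD z zP) y zy; rewrite inE.
    by rewrite /phi (subsetP PR z zP) yP.
  rewrite -mulrnDr; case/dvdnP: dme => u ->; rewrite mulnC mulrnA.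
  exact: groupMnr.
pose psi (x y : G) : gam := (h (f' x) + h (f' y) + c)%R.
have devH : (esum (D :|: R) (fun x y => k (f' x) (f' y)) - esum (D :|: R) psi
    - esum (D :|: R) phi)%R \in H.
  rewrite /esum -!sumrB; apply: group_sumr => -[x y] /=; rewrite inE /= => /andP[/andP[xy _]].
  have fW z : z \in D -> f z \in W by move=> zD; rewrite (subsetP UW) // (subsetP fU) // imset_f.
  have YW' z : z \in Y -> z \in W by move/(subsetP YW); rewrite inE => /andP[].
  have RN z : z \in D -> (z \in R) = false by move=> zD; rewrite RE !inE zD.
  rewrite !inE /psi /phi; case xD: (x \in D); case yD: (y \in D) => /=.
  - by move=> _; rewrite !RN //= subr0 !f'D // h_good ?fW ?fgood.
  - move=> yR; rewrite (RN _ xD) /= subr0 f'D // h_good ?fW ?YW' ?f'R //.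
    by apply: (Dg x y) => //; apply: f'R.
  - rewrite andbT => xR; rewrite (RN _ yD) andbF subr0 (f'D y) // ksym [(h (f' x) + _)%R]addrC.
    rewrite h_good ?fW ?YW' ?f'R //.
    by apply: (Dg y x) => //; [rewrite adj_sym|apply: f'R].
  - move=> /andP[xR yR]; rewrite xR yR /=; apply: Ydl; rewrite ?f'R //.
    have [[f'inj _] _ _ _] := st'.
    apply: contraTneq xy => /f'inj e'; rewrite e' ?adj_irrefl // inE ?xR ?yR orbT //.
have aH : (a *+ d)%R \in H.
  case/set0Pn: Y0 => y yY; rewrite -(Ya y yY) h_d //.
  exact: subsetP (subset_trans YW (subsetDl _ _)) _ yY.
have cE : #|edge_pairs G| = #|edges G| := card_edge_pairs G.
(* All degrees add up to twice the number of edges, which kills [a]. The parts over [Z] and [D] are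
   divisible by [d], so the part over [R] is harmless although its degree sum was never arranged. *)
have aR : (a *+ \sum_(x in R) degree x)%R \in H.
  have tot : (\sum_(x in Z) a *+ degree x + (\sum_(x in D) a *+ degree x +
      \sum_(x in R) a *+ degree x) = 0)%R.
    rewrite -(sum_setU_disj _ RD) D5.
    transitivity (\sum_(x : G) a *+ degree x)%R; last first.
      by rewrite -(handshake (fun=> a)) sumr_const cE mulrn_card.
    rewrite [RHS](bigID [pred x in Z]) /=; congr (_ + _)%R.
    by apply: eq_big => // x; rewrite inE.
  have Zs : (\sum_(x in Z) a *+ degree x)%R \in H.
    by apply: group_sumr => z zZ; rewrite Sd // (subsetP ZS).
  have Ds : (\sum_(x in D) a *+ degree x)%R \in H.
    by rewrite sumrMnr; case/dvdnP: dD => u ->; rewrite mulnC mulrnA groupMnr.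
  rewrite -sumrMnr -groupNr; apply: (mem_eq (groupDr Zs Ds)).
  by apply/eqP; rewrite eq_sym -subr_eq0 opprK -addrA tot.
(* Handshake with weight 0 on [Z]: the edges at the centres then give exactly [rho], and [c]
   disappears because it is added once for every edge. *)
have psiE : (esum (D :|: R) psi + rho Z f' = hsum (D :|: R) f')%R.
  pose w (x : G) : gam := if x \in Z then 0%R else h (f' x).
  pose Phi x y := (w x + w y + c)%R.
  have Phis x y : Phi x y = Phi y x by rewrite /Phi [(w x + _)%R]addrC.
  have := esum_split Phis D5 ZD5.
  have -> : (\sum_(p in edge_pairs G) Phi p.1 p.2 = hsum (D :|: R) f')%R.
    rewrite big_split /= handshake sumr_const cE mulrn_card // addr0 /hsum D5.
    rewrite [RHS]big_mkcond; apply: eq_bigr => x _; rewrite inE /w.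
    by case: (x \in Z); rewrite ?mul0rn.
  have -> : esum (D :|: R) Phi = esum (D :|: R) psi.
    apply: eq_bigr => -[x y] /= /andP[_ /andP[xD yD]].
    by move: xD yD; rewrite D5 !inE /Phi /psi /w => /negPf -> /negPf ->.
  have -> : (\sum_(z in Z) \sum_(y in nbrs z) Phi z y = rho Z f')%R.
    apply: eq_bigr => z zZ; apply: eq_bigr => y yz; rewrite /Phi /w zZ add0r.
    have := subsetP (ZD5 z zZ) y yz; rewrite D5 inE => /negPf -> //.
  by move=> ->.
have hH : hsum (D :|: R) f' \in H.
  rewrite (hsum_place (a := a) (f := f)) // ?groupDr // => x xR.
  by rewrite Ya ?f'R.
rewrite -rE -opprD groupNr.
apply: (mem_eq (groupDr (groupDr devH phiH) hH)).
by rewrite -psiE; zmod_eq.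
Qed.

Variable M : nat.
Hypothesis M_gt0 : 0 < M.
Let r1 := crowd + 2 * d.
Hypothesis homogeneous : forall (Y : {set T}) (x1 : T) (a : gam),
  x1 \in W -> Y \subset W -> {in Y, forall y, good x1 y /\ h y = a} -> M <= #|Y| ->
  homogeneous_clique k d H h c r1 Y.

Lemma complete D Z f U A Su :
  inv D Z f U A Su -> (forall x, (x - rho Z f)%R \in H -> x \in A) ->
  #|Su| + d <= #|S| ->
  #|U| + #|G| + (d * Dl + r1 * Dl + 1) * b + #|gam| * (d + M) <= #|W| ->
  zero_copy G k.
Proof.
move=> [[st UW] [SuS cov] hs [dD ZS]] Afull cSu cW.
have [Sd Styp Sfar] := SP.
have bal0 : balanced D Z f U A by split.
have [Pd PdS cPd] : exists2 Pd : {set G}, Pd \subset S :\: Su & #|Pd| = d.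
  by apply: subset_of_card; rewrite cardsD (setIidPr SuS); move: cSu; lia_cards.
have PS z : z \in Pd -> z \in S by move/(subsetP PdS); rewrite inE => /andP[].
have PNSu z : z \in Pd -> z \notin Su by move/(subsetP PdS); rewrite inE => /andP[].
have far x z x' : x \in D :|: Z -> z \in Pd -> x' \in ball z -> x != x'.
  move=> /(subsetP cov) /bigcupP [s sSu xs] zP x'z.
  have ne : s != z by apply: contraNneq (PNSu z zP) => <-.
  by have [] := Sfar s z (subsetP SuS _ sSu) (PS z zP) ne x x' xs x'z.
have bfar z z' x x' : z \in Pd -> z' \in Pd -> x \in ball z -> x' \in ball z' -> z != z' ->
    x != x' /\ ~~ adj x x'.
  by move=> zP z'P xz x'z' ne; apply: (Sfar z z') => //; apply: PS.
have nball z (j : 'I_d) : z \in Pd -> nbr z j \in ball z.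
  by move=> zP; rewrite in_setU1 (nbr_in) ?orbT // PS.
have cball (z : G) : z \in ball z by rewrite !inE eqxx.
have nbr_z z (j : 'I_d) : z \in Pd -> nbr z j != z.
  move=> zP; have := nbr_in j (PS z zP); rewrite in_nbrs.
  by apply: contraTneq => ->; rewrite adj_irrefl.
have ninj z z' (j j' : 'I_d) : z \in Pd -> z' \in Pd -> nbr z j = nbr z' j' -> z = z' /\ j = j'.
  move=> zP z'P e; have [ez|ne] := eqVneq z z'.
    by split=> //; move: e; rewrite ez => /(nbr_inj (PS _ z'P)).
  by have [] := bfar z z' _ _ zP z'P (nball _ j zP) (nball _ j' z'P) ne; rewrite e eqxx.
pose Q (j : 'I_d) := [set nbr z j | z in Pd].
have cQ j : #|Q j| = d by rewrite card_in_imset // => z z' zP z'P /ninj [].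
have Qi j : {in Q j &, forall x y, ~~ adj x y}.
  move=> _ _ /imsetP [z zP ->] /imsetP [z' z'P ->]; have [->|ne] := eqVneq z z'.
    by rewrite adj_irrefl.
  by have [] := bfar z z' _ _ zP z'P (nball _ j zP) (nball _ j z'P) ne.
have dQ j : d %| \sum_(x in Q j) degree x.
  rewrite big_imset /=; last by move=> z z' zP z'P /ninj [].
  rewrite (eq_bigr (fun=> t j)) => [|z zP]; first by rewrite sum_nat_const cPd dvdn_mulr.
  by apply: Styp; apply: PS.
pose L n := [set x | [exists z in Pd, [exists j : 'I_d, (0 < j < n) && (x == nbr z j)]]].
have LP n x : reflect (exists z (j : 'I_d), [/\ z \in Pd, 0 < j < n & x = nbr z j]) (x \in L n).
  rewrite inE; apply: (iffP exists_inP) => [[z zP /existsP [j /andP[jn /eqP ->]]]|[z [j [zP jn ->]]]].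
    by exists z, j.
  by exists z => //; apply/existsP; exists j; rewrite jn eqxx.
have LDZ n : [disjoint L n & D :|: Z].
  rewrite disjoint_subset; apply/subsetP => x /LP [z [j [zP _ ->]]]; rewrite inE /=.
  by apply/negP => xD; have := far _ _ _ xD zP (nball z j zP); rewrite eqxx.
have cLU n : #|L n| + #|~: (D :|: L n :|: Z)| <= #|G|.
  have dj : [disjoint L n & ~: (D :|: L n :|: Z)].
    by rewrite disjoint_subset; apply/subsetP => x xL; rewrite [X in is_true X]inE /= in_setC negbK in_setU in_setU xL orbT.
  by rewrite -cardsUI (disjoint_setI0 dj) cards0 addn0 max_card.
have cW1 u : u <= #|U| + #|G| -> u + d * Dl * b + #|gam| * d <= #|W|.
  move=> uu; apply: leq_trans cW; rewrite -!addnA !mulnDl !mulnDr.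
  by move: uu; set A1 := #|gam| * d; clear; lia.
have leaves n : n <= d -> exists f' U', [/\ balanced (D :|: L n) Z f' U' A,
    #|U'| <= #|U| + #|L n| & rho Z f' = rho Z f].
  elim: n => [_|n IH nd].
    have -> : L 0 = set0 by apply/setP => x; rewrite in_set0; apply/negbTE/negP => /LP [z [j [_]]]; rewrite ltn0 andbF.
    by exists f, U; rewrite setU0 cards0 addn0.
  have [f' [U' [bal' cU' r']]] := IH (ltnW nd).
  case: n IH nd bal' cU' => [|n] IH nd bal' cU'.
    have -> : L 1 = L 0.
      by apply/setP => x; apply/LP/LP => -[z [[[|j] jd] [zP jn ->]]].
    by exists f', U'.
  pose jn := Ordinal nd.
  have LS : L n.+2 = L n.+1 :|: Q jn.
    apply/setP => x; rewrite in_setU; apply/LP/orP.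
      move=> [z [j [zP jn' ->]]]; case: (ltngtP j n.+1) => jlt.
      - by left; apply/LP; exists z, j; split=> //; case/andP: jn' => -> _.
      - by move: jn'; rewrite !ltnS [j <= _]leqNgt jlt andbF.
      - by right; apply/imsetP; exists z => //; congr nbr; apply: val_inj.
    case=> [/LP [z [j [zP jn' ->]]]|/imsetP [z zP ->]].
      by exists z, j; split=> //; case/andP: jn' => -> /= => /leqW.
    by exists z, jn; split=> //=; rewrite ltnSn.
  have QL : Q jn \subset ~: (D :|: L n.+1 :|: Z).
    apply/subsetP => x /imsetP [z zP ->]; rewrite in_setC setUAC in_setU negb_or; apply/andP; split.
      by apply/negP => xD; have := far _ _ _ xD zP (nball z jn zP); rewrite eqxx.
    by apply/LP => -[z' [j [z'P jlt e]]]; have [_ ej] := ninj _ _ _ _ zP z'P e; move: jlt; rewrite -ej /= ltnn.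
  have cQL : #|L n.+1| + d = #|L n.+2|.
    rewrite LS -(cQ jn) -cardsUI (eqP (_ : L n.+1 :&: Q jn == set0)) ?cards0 ?addn0 //.
    rewrite setI_eq0 disjoint_sym disjoint_subset; apply/subsetP => x /(subsetP QL).
    by rewrite !in_setC !in_setU !negb_or => /andP[/andP[_ xL] _]; apply: xL.
  have [||f2 [U2 [bal2 cU2 r2]]] := place_bunch bal' QL (Qi jn) _ (dQ jn).
  - by rewrite cQ.
  - by apply: cW1; apply: leq_trans cU' _; rewrite leq_add2l max_card.
  exists f2, U2; rewrite LS setUA; split=> //; last by rewrite r2.
  by rewrite -LS -cQL; move: cU2 cU'; rewrite cQ; lia_cards.
have [f1 [U1 [bal1 cU1 r1E]]] := leaves d (leqnn d).
pose j0 := Ordinal d_gt0.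
pose PP := Pd :|: Q j0.
have PPD : [disjoint PP & D :|: L d :|: Z].
  rewrite disjoint_subset; apply/subsetP => x xP; rewrite inE /= setUAC in_setU negb_or.
  case/setUP: xP => [xP|/imsetP [z zP ->]]; apply/andP; split.
  - by apply/negP => xD; have := far _ _ _ xD xP (cball x); rewrite eqxx.
  - apply/LP => -[z [j [zP _ e]]]; have [ez|ne] := eqVneq x z.
      by have := nbr_z z j zP; rewrite -e ez eqxx.
    by have [] := bfar x z _ _ xP zP (cball x) (nball z j zP) ne; rewrite e eqxx.
  - by apply/negP => xD; have := far _ _ _ xD zP (nball z j0 zP); rewrite eqxx.
  - by apply/LP => -[z' [j [z'P jn e]]]; have [_ ej] := ninj _ _ _ _ zP z'P e; rewrite -ej in jn.
have [||D3 [f3 [U3 [bal3 [DD3 PP3] cU3 cR0 r3]]]] :=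
  place_most (u0 := #|U| + #|G|) bal1 PPD.
- by apply: leq_trans (leq_add cU1 (leqnn _)) _; rewrite -addnA leq_add2l cLU.
- exact: cW1.
set R0 := ~: (D3 :|: Z) :\: PP in cR0.
pose R1 := R0 :|: Q j0.
pose m := #|[set p in edge_pairs G | (p.1 \in R1) && (p.2 \in R1)]|.
(* This lies between 1 and [d]; it is [d], not 0, when [d] divides [m]. *)
pose e := d - m %% d.
have [Pj PjP cPj] : exists2 Pj : {set G}, Pj \subset Pd & #|Pj| = e.
  by apply: subset_of_card; rewrite cPd leq_subr.
have dme : d %| m + e.
  by rewrite {1}(divn_eq m d) -addnA subnKC ?dvdn_add ?dvdn_mull // ltnW ?ltn_mod.
have PPN x : x \in PP -> x \notin D3 :|: Z.
  by move: PP3; rewrite disjoint_subset => /subsetP H3 /H3.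
have Pdi : {in Pd &, forall x y, ~~ adj x y}.
  move=> x y xP yP; have [->|ne] := eqVneq x y; first by rewrite adj_irrefl.
  by have [] := bfar x y _ _ xP yP (cball x) (cball y) ne.
pose Q4 := Pd :\: Pj.
have Q4P x : x \in Q4 -> x \in Pd by rewrite inE => /andP[].
have [||||| f4 [U4 [bal4 cU4 r4]]] := place_bunch (Q := Q4) bal3.
- by apply/subsetP => x /Q4P xP; rewrite inE PPN // inE xP.
- by move=> x y /Q4P xP /Q4P yP; apply: Pdi.
- by rewrite -cPd subset_leq_card // subsetDl.
- rewrite (eq_bigr (fun=> d)) ?sum_nat_const ?dvdn_mull // => x /Q4P /PS; exact: Sd.
- by apply: cW1; apply: leq_trans cU3; apply: leq_addr.
pose R := ~: (D3 :|: Q4 :|: Z).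
have Pdj z : z \in Pd -> z \notin Q j0.
  move=> zP; apply/imsetP => -[z' z'P e']; have [ez|ne] := eqVneq z z'.
    by have := nbr_z z' j0 z'P; rewrite -e' ez eqxx.
  by have [] := bfar z z' _ _ zP z'P (cball z) (nball z' j0 z'P) ne; rewrite e' eqxx.
have R1E : R :\: Pj = R1.
  apply/setP => x; rewrite /R /R1 /R0 /PP /Q4 !inE.
  case xPj: (x \in Pj); case xPd: (x \in Pd); case xQ: (x \in Q j0); case xD: (x \in D3); case xZ: (x \in Z) => //=;
  have := PPN x; have := Pdj x; rewrite !inE ?xPd ?xQ ?xD ?xZ //= => h1 h2;
  try (by have := h1 isT); try (by have := h2 isT);
  by have := subsetP PjP x xPj; rewrite xPd.
have PjR : Pj \subset R.
  apply/subsetP => x xPj; have xP := subsetP PjP _ xPj.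
  have := PPN x; rewrite /R /PP /Q4 !inE xP xPj /= => /(_ isT).
  by rewrite orbF.
have cR : #|R| <= r1.
  have : #|R| <= #|R1| + #|Pj|.
    by rewrite -R1E -(cardsID Pj R) (setIidPr PjR) addnC.
  have := card_setU_le R0 (Q j0); rewrite -/R1 cQ cPj.
  have : e <= d by apply: leq_subr.
  by rewrite /r1; move: cR0; lia_cards.
have [[st4 UW4] hs4 dD4 _] := bal4.
have cU4' : #|U4| <= #|U| + #|G|.
  have : #|Q4| <= #|~: (D3 :|: Z)|.
    by apply/subset_leq_card/subsetP => x /Q4P xP; rewrite inE PPN // inE xP.
  by move: cU4 cU3; lia_cards.
have [x1 x1W] : exists x1, x1 \in W.
  apply/set0Pn; rewrite -card_gt0; apply: leq_trans cW; apply: leq_trans (leq_addl _ _).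
  by rewrite muln_gt0 addn_gt0 d_gt0 andbT; apply/card_gt0P; exists 0%R.
have [||a [Y [YU cY Ya Yg Y1]]] := @allowed_class _ _ _ _ _ R [set x1] M st4 UW4 _ M_gt0.
- by rewrite sub1set (subsetP WW0).
- apply: leq_trans cW; rewrite cards1; apply: leq_add.
    apply: leq_add => //; rewrite leq_mul2r; apply/orP; right.
    by rewrite leq_add2r; apply: leq_trans (leq_addl _ _); rewrite leq_mul2r cR orbT.
  by rewrite leq_mul2l leq_addl orbT.
have YW : Y \subset W := subset_trans YU (subsetDl _ _).
have [|P [dl [PY cP dld Pdl]]] := @homogeneous Y x1 a x1W YW _ cY.
  by move=> y yY; split; [apply: Y1; rewrite ?inE|apply: Ya].
have Pn : {in Pj, forall z, #|nbrs z :&: (R :\: Pj)| = 1}.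
  move=> z zPj; have zP := subsetP PjP _ zPj.
  suff -> : nbrs z :&: (R :\: Pj) = [set nbr z j0] by rewrite cards1.
  rewrite R1E; apply/setP => y; rewrite in_setI in_set1 (nbrsE (PS z zP)); apply/andP/eqP.
    move=> [/imsetP [j _ ->]]; case: (eqVneq j j0) => [-> //|jj].
    rewrite /R1 in_setU => /orP[|/imsetP [z' z'P e']].
      rewrite /R0 in_setD in_setC in_setU negb_or => /andP[_ /andP[/negP xD _]]; case: xD.
      apply: (subsetP DD3); rewrite in_setU; apply/orP; right; apply/LP; exists z, j; split=> //.
      by rewrite ltn_ord andbT lt0n; apply: contra jj => j_0; apply/eqP/val_inj/eqP.
    by have [_ ej] := ninj _ _ _ _ zP z'P e'; rewrite ej eqxx in jj.
  move=> ->; split; first exact: (imset_f (nbr z)).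
  by rewrite /R1 in_setU (imset_f (fun z => nbr z j0) zP) orbT.
apply: (@final_copy (D3 :|: Q4) Z f4 U4 A R Pj P a dl m e bal4) => //.
- by rewrite r4 r3 r1E.
- exact: subset_trans PY YU.
- by rewrite cP.
- by rewrite -card_gt0 cP /r1 addn_gt0 muln_gt0 d_gt0 orbT.
- by move=> y /(subsetP PY) /Ya.
- by move=> x q xD qR ad y /(subsetP PY); apply: (Yg x q).
- by move=> z z' zP z'P; apply: Pdi; apply: (subsetP PjP).
- by rewrite /m R1E.
Qed.

End Finish.
End Sites.

(** * Assembly of filling and completion *)

Section Assembly.
Variables (G : sgraph) (d Dl : nat) (S : {set G}) (t : 'I_d -> nat).
Hypothesis SP : sites S t.
Hypothesis degG : max_degree G <= Dl.
Hypothesis d_gt0 : 0 < d.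
Variables (T : finType) (gam : finZmodType) (k : T -> T -> gam).
Hypothesis ksym : forall x y, k x y = k y x.
Hypothesis gam_dvd : #|gam| %| #|edges G|.
Let r1 := crowd d Dl + 2 * d.

(** The multiple of [#|gam|] covers the deletions of the descent, the filling, and [d + M] positions
    in each class of [h]; the last term covers the positions excluded by bad pairs. *)
Definition host_size (kappa b M : nat) : nat :=
  (2 * budget d kappa + usage d kappa + d + M) * #|gam| + #|G| +
  (d * Dl + r1 * Dl + r1 + d * d + d + 12) * b.+1.

Lemma card_gidx_le (H : {group gam}) : #|H| + gidx H <= 2 * #|gam|.
Proof.
rewrite mul2n -addnn leq_add ?max_card //.
by rewrite -[X in _ <= X](card_gidx H) leq_pmull // cardG_gt0.
Qed.

Lemma zero_sum_fill (good : rel T) (b kappa s M : nat) (W0 : {set T}) (gam1 : {group gam})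
    (p : T -> gam) :
  symmetric good -> irreflexive good -> 0 < kappa ->
  {in W0, forall x, #|[set y in W0 | ~~ good x y]| <= b} ->
  {in W0 &, forall x y, good x y -> (k x y - p x - p y)%R \in gam1} ->
  {in W0, forall x, (p x *+ d)%R \in gam1} ->
  kappa = 1 \/ (forall X : {set T}, #|X| <= 4 * budget d kappa * #|gam| ->
    rich_star k good d (2 * kappa) (W0 :\: X)) ->
  0 < M ->
  (forall (H : {group gam}) (W : {set T}) (h : T -> gam) (c : gam), W \subset W0 ->
    rigid k good d gam1 H W -> {in W, forall x, (h x *+ d)%R \in H} ->
    {in W &, forall x y, good x y -> (k x y - (h x + h y + c))%R \in H} ->
    (d * d.+1 + r1) * b + r1 < #|W| ->
    forall (Y : {set T}) (x1 : T) (a : gam), x1 \in W -> Y \subset W ->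
    {in Y, forall y, good x1 y /\ h y = a} -> M <= #|Y| ->
    homogeneous_clique k d H h c r1 Y) ->
  s + d <= #|S| -> (d * d).+1 * (d * #|gam1| + kappa * kappa) <= kappa * s ->
  host_size kappa b M < #|W0| ->
  zero_copy G k.
Proof.
move=> good_sym good_irr kappa_gt0 bad_le good_p p_d rich M_gt0 homog sS ks cW0.
have [H [W [[WW0 H1] rg cW rob]]] := minimal_rigid k good d W0 gam1 (budget d kappa).
have cHi := card_gidx_le H.
have cWc : #|W0 :\: W| <= 2 * budget d kappa * #|gam|.
  apply: leq_trans (leq_addr _ _) (leq_trans cW _).
  rewrite [2 * _]mulnC -mulnA leq_mul2l; apply/orP; right.
  by move: cHi (max_card (mem H)) (cardG_gt0 H) (card_gidx H); case: (gidx H) => [|i]; nia.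
have cWW : #|W0| <= #|W| + #|W0 :\: W| by rewrite -(cardsID W W0) leq_add2r subset_leq_card ?subsetIr.
have cW' : usage d kappa * #|gam| + (d + M) * #|gam| + #|G| +
    (d * Dl + r1 * Dl + r1 + d * d + d + 12) * b.+1 < #|W|.
  rewrite -(ltn_add2r (2 * budget d kappa * #|gam|)); apply: leq_trans (leq_trans cWW _).
    by move: cW0; rewrite /host_size !mulnDl; lia_cards.
  by rewrite leq_add2l.
have cWb e : e <= d * Dl + r1 * Dl + r1 + d * d + d + 12 -> e * b.+1 < #|W|.
  move=> le; apply: leq_ltn_trans cW'; apply: leq_trans (leq_addl _ _).
  by rewrite leq_mul2r le orbT.
have [|h0 [c [h0d h0g]]] := rigid_potential ksym good_sym good_irr d_gt0 bad_le good_p p_d WW0 rg.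
  by apply: cWb; lia.
have [h [hd hg hv]] := normalize_potential h0d h0g.
have [x0 x0W] : exists x, x \in W by apply/set0Pn; rewrite -card_gt0; apply: leq_trans cW'.
have Hgam : #|H| <= #|gam| by apply: max_card.
have richW : kappa = 1 \/ (forall X : {set T}, #|X| <= budget d kappa * (#|H| + gidx H) ->
    rich_star k good d (2 * kappa) (W :\: X)).
  case: rich => [->|rich]; [by left|right=> X cX].
  have sub : W0 :\: (X :|: (W0 :\: W)) \subset W :\: X.
    by apply/subsetP => x; rewrite !inE negb_or negb_and negbK => /andP[/andP[-> /orP[->|/negPf ->]]].
  have [|u [O [h1 h2 h3 [h4 h5] h6]]] := rich (X :|: (W0 :\: W)).
    apply: leq_trans (card_setU_le _ _) _.
    have : budget d kappa * (#|H| + gidx H) <= budget d kappa * (2 * #|gam|) by rewrite leq_mul2l cHi orbT.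
    by move: cX cWc; set B := budget d kappa; rewrite mulnCA -!mulnA; lia_cards.
  exists u, O; split=> // [j|]; last by split=> //; apply: subset_trans h4 sub.
  by move: (h3 j); rewrite in_setD => /andP[uO /(subsetP sub)]; rewrite [in X in _ -> X]in_setD uO.
have ksH : (d * d).+1 * (d * #|H| + kappa * kappa) <= kappa * s.
  apply: leq_trans ks; rewrite leq_mul2l; apply/orP; right.
  by rewrite leq_add2r leq_mul2l subset_leq_card ?orbT.
have sS' : s <= #|S| := leq_trans (leq_addr _ _) sS.
have [D [Z [f [U [A [Su [iv Afull cU cSu]]]]]]] :=
  fill SP d_gt0 hd hg kappa_gt0 hv rob richW sS' ksH (fun=> x0).
apply: (complete SP good_sym d_gt0 hd hg degG ksym bad_le WW0 gam_dvd M_gt0 _ iv Afull).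
- by apply: homog => //; rewrite -/r1; apply: leq_ltn_trans (cWb (d * d.+1 + r1) _); rewrite -?/r1; lia.
- by apply: leq_trans sS; rewrite leq_add2r.
- have : usage d kappa * #|H| <= usage d kappa * #|gam| by rewrite leq_mul2l Hgam orbT.
  have : (d * Dl + r1 * Dl + 1) * b <= (d * Dl + r1 * Dl + r1 + d * d + d + 12) * b.+1.
    by rewrite leq_mul //; lia.
  by move: cU cW'; rewrite -/r1 [#|gam| * _]mulnC; set B := _ * b; set B' := _ * b.+1; move: B B' => B B'; lia_cards.
Qed.

Lemma zero_sum_of_rich_stars (kappa s : nat) (W0 : {set T}) :
  0 < kappa ->
  (forall X : {set T}, #|X| <= 4 * budget d kappa * #|gam| ->
    rich_star k (fun x y => x != y) d (2 * kappa) (W0 :\: X)) ->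
  s + d <= #|S| -> (d * d).+1 * (d * #|gam| + kappa * kappa) <= kappa * s ->
  host_size kappa 1 r1 < #|W0| ->
  zero_copy G k.
Proof.
move=> kappa_gt0 rich sS ks cW0.
apply: (@zero_sum_fill (fun x y => x != y) 1 kappa s r1 W0 [set: gam]%G (fun=> 0%R)) => //.
- by move=> x y; rewrite eq_sym.
- by move=> x; rewrite eqxx.
- move=> x _; apply: leq_trans (_ : #|[set x]| <= 1); last by rewrite cards1.
  by apply/subset_leq_card/subsetP => y; rewrite !inE negbK eq_sym => /andP[].
- by move=> x y _ _ _; rewrite inE.
- by move=> x _; rewrite inE.
- by right.
- by rewrite /r1 addn_gt0 muln_gt0 d_gt0 orbT.
- move=> H W h c _ _ _ hg _ Y x1 a _ YW _ cY.
  (* Here all pairs of distinct vertices are good, so any subset of the class is a clique with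
     deviation 0. *)
  have [P PY cP] := subset_of_card cY; exists P, 0%R; split=> //; first by rewrite mul0rn group0r.
  by move=> x y xP yP ne; rewrite subr0; apply: hg => //; apply/(subsetP YW)/(subsetP PY).
- by rewrite cardsT.
Qed.

(** With [kappa = 1] gadgets alone drive the filling and may gain only one value per step. This is
    affordable since [H] lies inside [gam1], which is assumed small compared with the number of
    sites. *)
Lemma zero_sum_of_local_palette (good : rel T) (b q N s : nat) (W0 : {set T})
    (gam1 : {group gam}) (p : T -> gam) :
  local_ramsey q r1 N T ->
  symmetric good -> irreflexive good ->
  {in W0, forall x, #|[set y in W0 | ~~ good x y]| <= b} ->
  {in W0 &, forall x y, good x y -> (k x y - p x - p y)%R \in gam1} ->
  {in W0, forall x, (p x *+ d)%R \in gam1} ->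
  (forall a : gam, (a *+ d)%R \in gam1) ->
  {in W0, forall x, #|[set (k x y - p x - p y)%R | y in W0]| <= q} ->
  s + d <= #|S| -> (d * d).+1 * (d * #|gam1| + 1) <= s ->
  host_size 1 b (q * N).+1 < #|W0| ->
  zero_copy G k.
Proof.
move=> ramsey good_sym good_irr bad_le good_p p_d gam1_d loc sS ks cW0.
apply: (@zero_sum_fill good b 1 s (q * N).+1 W0 gam1 p) => //.
- by left.
- move=> H W h c WW0 rg hd hg cW Y x1 a x1W YW Yx cY.
  by apply: (homogeneous_set ksym good_sym good_irr d_gt0 bad_le good_p gam1_d WW0 rg hd hg
    ramsey loc x1W YW Yx cY) => //; rewrite /r1 leq_addl.
- by rewrite !mul1n.
Qed.
End Assembly.

(** * Existence of sites *)

Lemma independent_subset (T : finType) (near : rel T) (m : nat) (C : {set T}) :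
  symmetric near -> reflexive near -> (forall x, #|[set y | near x y]| <= m) ->
  exists S : {set T}, [/\ S \subset C, {in S &, forall x y, x != y -> ~~ near x y} &
    #|C| <= m * #|S|].
Proof.
move=> sym rfl le; pose indep (S : {set T}) := (S \subset C) &&
  [forall x in S, forall y in S, (x != y) ==> ~~ near x y].
have indepP (S : {set T}) : reflect (S \subset C /\ {in S &, forall x y, x != y -> ~~ near x y}) (indep S).
  apply: (iffP andP) => [[SC /forall_inP h]|[SC h]]; split=> //.
    by move=> x y xS yS ne; have /forall_inP/(_ y yS)/implyP := h x xS; apply.
  by apply/forall_inP => x xS; apply/forall_inP => y yS; apply/implyP; apply: h.
have i0 : indep set0 by apply/indepP; split; [apply: sub0set|move=> x y; rewrite inE].
case: (@arg_maxnP _ set0 indep (fun S : {set T} => #|S|) i0) => S /indepP [SC Si] Smax.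
exists S; split=> //.
have cov : C \subset \bigcup_(x in S) [set y | near x y].
  apply/subsetP => c cC; apply/bigcupP; case: (boolP (c \in S)) => [cS|cS].
    by exists c; rewrite // inE.
  case: (boolP [exists x in S, near x c]) => [/exists_inP [x xS nx]|/exists_inPn far].
    by exists x; rewrite // inE.
  have : #|c |: S| <= #|S|.
    apply: Smax; apply/indepP; split; first by rewrite subUset sub1set cC.
    move=> x y; rewrite !in_setU1 => /orP[/eqP ->|xS] /orP[/eqP ->|yS] ne.
    - by rewrite eqxx in ne.
    - by rewrite sym far.
    - exact: far.
    - exact: Si.
  by rewrite cardsU1 cS ltnn.
apply: leq_trans (subset_leq_card cov) _; by rewrite mulnC card_bigcup_le.
Qed.

Section SitesExist.
Variables (G : sgraph) (Dl : nat).
Hypothesis degG : max_degree G <= Dl.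

Definition site_density : nat :=
  Dl * (#|{: 'I_Dl.+1 * {ffun 'I_Dl -> 'I_Dl.+1}}| * (Dl.+1 * (Dl.+1 * Dl.+1))).

Lemma degree_le (x : G) : degree x <= Dl.
Proof. exact: leq_trans (card_nbrs x) degG. Qed.

Lemma card_ball (x : G) : #|ball x| <= Dl.+1.
Proof. by rewrite cardsU1 -add1n leq_add ?degree_le // leq_b1. Qed.

Lemma mem_ball_sym (x y : G) : (x \in ball y) = (y \in ball x).
Proof. by rewrite !in_setU1 !in_nbrs eq_sym adj_sym. Qed.

(** The type of a vertex records its degree and the degrees of its ordered neighbours, which leaves
    boundedly many types. Among the nonisolated vertices of a popular type, a set with pairwise
    distances above 3 is kept. *)
Lemma sites_exist : 0 < #|edges G| -> exists (d : nat) (t : 'I_d -> nat) (S : {set G}),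
  [/\ 0 < d, d <= Dl, sites S t & #|edges G| <= site_density * #|S|].
Proof.
move=> e0; pose N := [set x : G | 0 < degree x].
have eN : #|edges G| <= Dl * #|N|.
  rewrite -card_edge_pairs mulnC.
  apply: (@leq_trans #|\bigcup_(x in N) [set (x, y) | y in nbrs x]|).
    apply/subset_leq_card/subsetP => -[x y]; rewrite inE => /andP[/= xy _].
    apply/bigcupP; exists x; last by rewrite imset_f // in_nbrs.
    by rewrite inE; apply/card_gt0P; exists y; rewrite inE.
  apply: card_bigcup_le => x _; apply: leq_trans (leq_imset_card _ _) _; exact: degree_le.
have N0 : N != set0 by rewrite -card_gt0; move: e0 eN; case: #|N| => // ; rewrite muln0; lia_cards.
pose typ (x : G) : 'I_Dl.+1 * {ffun 'I_Dl -> 'I_Dl.+1} :=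
  (inord (degree x), [ffun j : 'I_Dl => inord (degree (nth x (enum (nbrs x)) j))]).
have [//|[d tau] _ cC] := @pigeonhole _ _ N typ setT N0.
set C := [set x in N | _] in cC.
pose near (x y : G) := [exists x' in ball x, exists y' in ball y, x' \in ball y'].
have nearP x y : reflect (exists x' y', [/\ x' \in ball x, y' \in ball y & x' \in ball y']) (near x y).
  apply: (iffP exists_inP) => [[x' x1 /exists_inP [y' y1 xy]]|[x' [y' [h1 h2 h3]]]].
    by exists x', y'.
  by exists x' => //; apply/exists_inP; exists y'.
have [|||S [SC Sfar cS]] := @independent_subset G near (Dl.+1 * (Dl.+1 * Dl.+1)) C.
- move=> x y; apply/nearP/nearP => -[x' [y' [h1 h2 h3]]]; exists y', x'; split=> //;
  by rewrite mem_ball_sym.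
- by move=> x; apply/nearP; exists x, x; rewrite !in_setU1 eqxx.
- move=> x; apply: (@leq_trans #|\bigcup_(x' in ball x) \bigcup_(y' in ball x') ball y'|).
    apply/subset_leq_card/subsetP => y; rewrite inE => /nearP [x' [y' [h1 h2 h3]]].
    apply/bigcupP; exists x' => //; apply/bigcupP; exists y'; first by rewrite mem_ball_sym.
    by rewrite mem_ball_sym.
  have le (F : G -> {set G}) (n : nat) z : (forall x, #|F x| <= n) ->
      #|\bigcup_(y in ball z) F y| <= Dl.+1 * n.
    move=> Fn; apply: (@leq_trans (#|ball z| * n)); first exact: card_bigcup_le.
    by rewrite leq_mul2r card_ball orbT.
  apply: (le (fun x' => \bigcup_(y' in ball x') ball y')) => z.
  by apply: (le (fun y' => ball y')) => z'; apply: card_ball.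
have dDl : d <= Dl by rewrite -ltnS.
have CP x : x \in S -> [/\ 0 < degree x, degree x = d & forall j : 'I_Dl, degree (nth x (enum (nbrs x)) j) = tau j].
  move/(subsetP SC); rewrite !inE => /andP[dx /eqP [e1 e2]]; split=> //.
    by rewrite -e1 inordK // ltnS degree_le.
  by move=> j; rewrite -e2 ffunE inordK // ltnS degree_le.
exists d, (fun j => nat_of_ord (tau (widen_ord dDl j))), S; split=> //.
- have : 0 < #|S|.
    move: N0 cC cS; rewrite -card_gt0; case: #|S| => // + le; rewrite muln0 leqn0 => N1 /eqP C0.
    by move: le N1; rewrite C0 muln0; case: #|N|.
  by case/card_gt0P => x /CP [+ e _]; rewrite e.
- split.
  + by move=> z /CP [].
  + by move=> z zS j; have [_ _ <-] := CP z zS.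
  + move=> z z' zS z'S ne x x' xz x'z'; have /negP nn := Sfar z z' zS z'S ne.
    split; [apply/negP => /eqP e|apply/negP => ad]; apply: nn; apply/nearP; exists x, x'; split=> //.
      by rewrite e in_setU1 eqxx.
    by rewrite in_setU1 in_nbrs adj_sym ad orbT.
- rewrite /site_density -!mulnA; apply: leq_trans eN _; rewrite leq_mul2l; apply/orP; right.
  by apply: leq_trans cC _; rewrite cardsT leq_mul2l; apply/orP; right; rewrite -!mulnA in cS.
Qed.
End SitesExist.

Lemma injective_preimage (T V : finType) (f : T -> V) (A : {set T}) (m : nat) :
  m <= #|f @: A| -> exists O : {set T}, [/\ O \subset A, #|O| = m & {in O &, injective f}].
Proof.
move=> /subset_of_card [B BA cB]; case: (set_0Vmem B) => [B0|[v0 v0B]].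
  exists set0; split; [exact: sub0set|by rewrite -cB B0 !cards0|by move=> x; rewrite inE].
have /imsetP [x0 _ _] := subsetP BA _ v0B.
pose s v := odflt x0 [pick x in A | f x == v].
have sP v : v \in B -> s v \in A /\ f (s v) = v.
  move=> /(subsetP BA) /imsetP [x xA ->]; rewrite /s.
  by case: pickP => [y /andP[yA /eqP ->]//|/(_ x)]; rewrite xA eqxx.
have sinj : {in B &, injective s}.
  by move=> v w vB wB e; rewrite -(proj2 (sP v vB)) e (proj2 (sP w wB)).
exists (s @: B); split; last 1 first.
- by move=> _ _ /imsetP [v vB ->] /imsetP [w wB ->]; rewrite !(proj2 (sP _ _)) // => ->.
- by apply/subsetP => _ /imsetP [v vB ->]; apply: (proj1 (sP v vB)).
- by rewrite card_in_imset.
Qed.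

Lemma pigeonhole_family (T K : finType) (I : eqType) (F : I -> T -> K) (q : nat) (A : {set T}) (s : seq I) :
  0 < q -> {in s, forall i, #|[set F i x | x in A]| <= q} ->
  exists B : {set T}, [/\ B \subset A, #|A| <= q ^ size s * #|B| &
    {in s, forall i, {in B &, forall x y, F i x = F i y}}].
Proof.
move=> q0; elim: s => [|i s IH] cF.
  by exists A; rewrite expn0 mul1n; split=> // i; rewrite in_nil.
have [|B [BA cB FB]] := IH; first by move=> j js; apply: cF; rewrite in_cons js orbT.
case: (set_0Vmem B) => [B0|[x0 x0B]].
  exists set0; split; first exact: sub0set.
    by move: cB; rewrite B0 cards0 !muln0.
  by move=> j _ x y; rewrite inE.
have Bn : B != set0 by apply/set0Pn; exists x0.
have [|a _ ca] := @pigeonhole _ _ B (F i) (F i @: A) Bn.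
  by move=> x xB; apply: imset_f; apply: (subsetP BA).
exists [set x in B | F i x == a]; split.
- by apply: subset_trans BA; apply/subsetP => x; rewrite inE => /andP[].
- apply: leq_trans cB _; rewrite /= expnS [q * _]mulnC -mulnA leq_mul2l; apply/orP; right.
  by apply: leq_trans ca _; rewrite leq_mul2r cF ?orbT // mem_head.
- move=> j; rewrite in_cons => /orP[/eqP ->|js] x y.
    by rewrite !inE => /andP[_ /eqP ->] /andP[_ /eqP ->].
  by rewrite !inE => /andP[xB _] /andP[yB _]; apply: FB.
Qed.

(** * Hosts without rich stars *)

Section PopularGroup.
Local Open Scope ring_scope.
Variable gam : finZmodType.

Lemma group_set_adjoin (E : {group gam}) (a : gam) (d : nat) : (0 < d)%N -> a *+ d \in E ->
  group_set [set x + a *+ i | x : gam in E, i : 'I_d in 'I_d].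
Proof.
move=> d0 aE; apply/group_setP; split.
  by apply/imset2P; exists (0 : gam) (Ordinal d0); rewrite ?group0r // mulr0n addr0.
move=> _ _ /imset2P [x i xE _ ->] /imset2P [y j yE _ ->].
apply/imset2P; exists (x + y + a *+ d *+ ((i + j) %/ d)) (Ordinal (ltn_pmod (i + j) d0)) => //=.
  by apply: groupDr (groupDr xE yE) (groupMnr _ aE).
change (x + a *+ i + (y + a *+ j) = x + y + a *+ d *+ ((i + j) %/ d) + a *+ ((i + j) %% d)).
by rewrite -mulrnA -[RHS]addrA -mulrnDr [(d * _)%N]mulnC -divn_eq mulrnDr addrACA.
Qed.

Lemma adjoin_group (E : {group gam}) (a : gam) (d : nat) : (0 < d)%N -> a *+ d \in E ->
  exists E' : {group gam}, [/\ E \subset E', a \in E' & (#|E'| <= d * #|E|)%N].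
Proof.
move=> d0 aE; have d2 : (0 < d * 2)%N by rewrite muln_gt0 d0.
exists (Group (group_set_adjoin d0 aE)); split=> /=.
- apply/subsetP => x xE; apply/imset2P; exists x (Ordinal d0) => //.
  by rewrite mulr0n addr0.
(* For [d = 1] the coefficient 1 is out of range, but then [a] already lies in [E]. *)
- case: (ltngtP d 1) => [|d1|d1]; first by case: (d) d0.
    by apply/imset2P; exists (0 : gam) (Ordinal d1); rewrite ?group0r // mulr1n add0r.
  apply/imset2P; exists a (Ordinal d0); rewrite ?mulr0n ?addr0 //.
  by move: aE; rewrite d1 mulr1n.
- apply: (@leq_trans #|[set p.1 + a *+ nat_of_ord p.2 | p : gam * 'I_d in setX E [set: 'I_d]]|).
    apply/subset_leq_card/subsetP => _ /imset2P [x i xE _ ->].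
    by apply/imsetP; exists (x, i); rewrite // inE /= xE inE.
  apply: leq_trans (leq_imset_card _ _) _.
  by rewrite cardsX cardsT card_ord mulnC.
Qed.

(* While some vertex sees many colours outside E, adjoin to E a popular one of
   them: it lies in the palette of every vertex that is kept, so this happens at
   most r times. *)
Lemma popular_group (T : finType) (c : T -> T -> gam) (W2 : {set T}) (d D q r : nat)
    (E : {group gam}) (W : {set T}) :
  (0 < d)%N -> (forall x y, c x y = c y x) ->
  {in W2, forall x, (#|[set c x y | y in W2]| <= q)%N} ->
  (forall a : gam, a *+ d \in E) -> W \subset W2 ->
  {in W, forall x, (#|[set c x y | y in W2] :\: E| <= r)%N} ->
  exists (E' : {group gam}) (W' : {set T}), [/\ E \subset E', W' \subset W,
    (#|E'| <= d ^ r * #|E|)%N, (#|W| <= (D * q).+1 ^ r * #|W'|)%N &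
    {in W', forall x, (D * #|[set y in W' | c x y \notin E']| <= #|W'|)%N}].
Proof.
move=> d0 csym loc; elim: r E W => [|r IH] E W Ed WW2 cP.
  exists E, W; rewrite !expn0 !mul1n; split=> // x xW.
  suff -> : [set y in W | c x y \notin E] = set0 by rewrite cards0 muln0.
  apply/setP => y; rewrite inE in_set0; apply/negP => /andP[yW nE].
  have := cP x xW; rewrite leqn0 cards_eq0 => /eqP/setP/(_ (c x y)).
  by rewrite in_set0 in_setD nE imset_f // (subsetP WW2).
case: (boolP [forall x in W, D * #|[set y in W | c x y \notin E]| <= #|W|]%N).
  move/forall_inP => ok; exists E, W; split=> //.
  - by rewrite leq_pmull // expn_gt0 d0.
  - by rewrite leq_pmull // expn_gt0.
case/forall_inPn => x xW; rewrite -ltnNge => big.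
set B := [set y in W | _] in big.
have Bn : B != set0 by rewrite -card_gt0; move: big; case: #|B| => //; rewrite muln0.
have BW : B \subset W by apply/subsetP => y; rewrite inE => /andP[].
have [|a _ ca] := @pigeonhole _ _ B (c x) [set c x y | y in W2] Bn.
  by move=> y /(subsetP BW) /(subsetP WW2); apply: imset_f.
set B' := [set y in B | _] in ca.
have B'n : B' != set0.
  by rewrite -card_gt0; move: ca Bn; rewrite -card_gt0; case: #|B'| => //; rewrite muln0 leqn0 => /eqP ->.
have aE : a \notin E.
  by case/set0Pn: B'n => y; rewrite !inE => /andP[/andP[_ nE] /eqP <-].
have [E1 [EE1 aE1 cE1]] := adjoin_group d0 (Ed a).
have B'W : B' \subset W by apply: subset_trans BW; apply/subsetP => y; rewrite inE => /andP[].
have [|||E' [W' [h1 h2 h3 h4 h5]]] := IH E1 B'.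
- by move=> b; apply: (subsetP EE1).
- exact: subset_trans WW2.
- move=> y yB'; rewrite -ltnS; apply: leq_trans (cP y (subsetP B'W _ yB')).
  apply: proper_card; apply/properP; split.
    by apply: setDS.
  exists a; last by rewrite in_setD aE1.
  rewrite in_setD aE /=; apply/imsetP; exists x; first exact: (subsetP WW2).
  by move: yB'; rewrite inE csym => /andP[_ /eqP].
exists E', W'; split=> //.
- exact: subset_trans h1.
- exact: subset_trans h2 B'W.
- apply: leq_trans h3 _; rewrite expnS [(d * _)%N]mulnC -mulnA leq_mul2l; apply/orP; right.
  exact: cE1.
- apply: leq_trans (ltnW big) _; rewrite expnS -mulnA.
  have cB' : (#|B| <= q * #|B'|)%N by apply: leq_trans ca _; rewrite leq_mul2r loc ?orbT // (subsetP WW2).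
  apply: (@leq_trans (D * q * #|B'|)%N); first by rewrite -mulnA leq_mul2l cB' orbT.
  by rewrite leq_mul // leqnSn.
Qed.
End PopularGroup.

Section PoorHost.
Local Open Scope ring_scope.
Variables (T : finType) (gam : finZmodType) (k : T -> T -> gam) (d K : nat) (W : {set T}).
Hypothesis ksym : forall x y, k x y = k y x.
Hypothesis d_gt0 : (0 < d)%N.
Hypothesis poor : ~ rich_star k (fun x y => x != y) d K W.

(** Differences of two star sums, with an allowance for the vertices that belong to the two
    stars. *)
Definition row_palette := (K * K + 2 * d)%N.

Lemma star_values (u : 'I_d -> T) : injective u -> (forall j, u j \in W) ->
  (#|[set star_sum k x u | x in W :\: u @: 'I_d]| <= K)%N.
Proof.
move=> uinj uW; rewrite leqNgt; apply/negP => /ltnW /injective_preimage [O [OA cO Oi]].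
have uO j : u j \notin O by apply/negP => /(subsetP OA); rewrite in_setD imset_f.
apply: poor; exists u, O; split=> //.
- by move=> j j'; apply: contra_neq => /uinj.
- by move=> j; rewrite in_setD uO uW.
- by split=> //; apply: subset_trans OA (subsetDl _ _).
- by split=> // x xO j; apply: contraTneq xO => ->.
Qed.

(* Exchanging one leaf of a star changes its sum by a row difference. *)
Lemma row_differences v w : v \in W -> w \in W -> (d + 2 <= #|W|)%N ->
  (#|[set (k x v - k x w)%R | x in W]| <= row_palette)%N.
Proof.
move=> vW wW cW.
have [|g [ginj gW]] := @inj_into 'I_d T (W :\: [set v; w]).
  rewrite card_ord; have := cardsID [set v; w] W.
  have : (#|W :&: [set v; w]| <= 2)%N.
    by apply: leq_trans (subset_leq_card (subsetIr _ _)) _; rewrite cards2; case: (_ != _).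
  by move: cW; lia_cards.
have gP j : [/\ g j \in W, g j != v & g j != w].
  by have := gW j; rewrite !inE negb_or => /andP[/andP[-> ->] ->].
pose j0 := Ordinal d_gt0.
pose u y j := if j == j0 then y else g j.
have uinj y : (y == v) || (y == w) -> injective (u y).
  move=> yvw i j; rewrite /u; case: eqP => [->|_]; case: eqP => [->|_] //; last exact: ginj.
  - by move=> e; have [_] := gP j; move: yvw; rewrite -e => /orP[]->.
  - by move=> e; have [_] := gP i; move: yvw; rewrite e => /orP[]->.
have uW y j : y \in W -> u y j \in W by rewrite /u; case: ifP => // _ _; have [] := gP j.
pose V y := [set star_sum k x (u y) | x in W :\: u y @: 'I_d].
have cV y : (y == v) || (y == w) -> (#|V y| <= K)%N.
  move=> yvw; apply: star_values; first exact: uinj.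
  by move=> j; apply: uW; case/orP: yvw => /eqP ->.
have cI y : (#|u y @: 'I_d| <= d)%N by rewrite (leq_trans (leq_imset_card _ _)) ?card_ord.
pose B := u v @: 'I_d :|: u w @: 'I_d.
have sub : [set (k x v - k x w)%R | x in W] \subset
    [set (q.1 - q.2)%R | q in setX (V v) (V w)] :|: [set (k x v - k x w)%R | x in B].
  apply/subsetP => _ /imsetP [x xW ->]; rewrite in_setU; apply/orP.
  case: (boolP (x \in B)) => [xB|]; first by right; apply: imset_f.
  rewrite in_setU negb_or => /andP[xv xw]; left.
  apply/imsetP; exists (star_sum k x (u v), star_sum k x (u w)).
    by rewrite in_setX !imset_f // in_setD ?xv ?xw.
  rewrite /star_sum /= (bigD1 j0) //= [X in _ = _ - X](bigD1 j0) //= /u eqxx.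
  rewrite (eq_bigr (fun j => k x (g j))) => [|j /negPf -> //].
  rewrite [X in _ = _ - (_ + X)](eq_bigr (fun j => k x (g j))) => [|j /negPf -> //].
  by set s := \sum_(j < d | _) _; rewrite opprD addrACA subrr addr0.
apply: leq_trans (subset_leq_card sub) _; apply: leq_trans (card_setU_le _ _) _.
rewrite /row_palette; apply: leq_add.
  by apply: leq_trans (leq_imset_card _ _) _; rewrite cardsX leq_mul // cV ?eqxx ?orbT.
apply: leq_trans (leq_imset_card _ _) _; apply: leq_trans (card_setU_le _ _) _.
by rewrite mul2n -addnn leq_add.
Qed.

(** Fix a star and keep the vertices with equal star sum and equal differences between its columns,
    [d.+1] functions of bounded range. On them [d] times the entry in the first column is constant,
    so that entry minus its value at a base vertex serves as [p]. Subtracting it turns a row into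
    row differences, of which there are few. *)
Lemma poor_potential : (d + 2 <= #|W|)%N -> exists (W2 : {set T}) (p : T -> gam),
  [/\ W2 \subset W, (#|W| <= d + row_palette ^ d.+1 * #|W2|)%N, {in W2, forall x, p x *+ d = 0} &
    {in W2, forall x, (#|[set (k x y - p x - p y)%R | y in W2]| <= row_palette)%N}].
Proof.
move=> cW; have [|u [uinj uW]] := @inj_into 'I_d T W.
  by rewrite card_ord (leq_trans _ cW) // leq_addr.
pose j0 := Ordinal d_gt0.
pose F (o : option 'I_d) x := if o is Some j then k x (u j) - k x (u j0) else star_sum k x u.
pose A := W :\: u @: 'I_d.
have AW : A \subset W := subsetDl _ _.
have Kq : (K <= row_palette)%N.
  by rewrite /row_palette; case: (K) => // n; rewrite (leq_trans _ (leq_addr _ _)) ?leq_pmulr.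
have [||W2 [W2A cA FW2]] := @pigeonhole_family T gam _ F row_palette A (enum {: option 'I_d}).
- by rewrite /row_palette addn_gt0 !muln_gt0 d_gt0 orbT.
- move=> [j|] _ /=; last exact: leq_trans (star_values uinj uW) Kq.
  apply: leq_trans (row_differences (uW j) (uW j0) cW).
  by apply/subset_leq_card/imsetS.
have W2W := subset_trans W2A AW.
have Fc o : {in W2 &, forall x y, F o x = F o y} by apply: FW2; rewrite mem_enum.
have pd x y : x \in W2 -> y \in W2 -> k x (u j0) *+ d = k y (u j0) *+ d.
  move=> xW yW; have e z : k z (u j0) *+ d = F None z - \sum_j F (Some j) z.
    by rewrite /F /star_sum sumrB subKr sumr_const card_ord.
  rewrite !e (Fc None x y xW yW); congr (_ - _).
  by apply: eq_bigr => j _; apply: Fc.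
have cW' : (#|W| <= d + row_palette ^ d.+1 * #|W2|)%N.
  rewrite -cardE card_option card_ord in cA.
  rewrite -(cardsID (u @: 'I_d) W); apply: leq_add cA.
  apply: leq_trans (subset_leq_card (subsetIr _ _)) _.
  by rewrite (leq_trans (leq_imset_card _ _)) ?card_ord.
case: (set_0Vmem W2) => [e|[x2 x2W]].
  by exists W2, (fun=> 0); split=> //; rewrite e => x; rewrite in_set0.
pose p x := k x (u j0) - k x2 (u j0); exists W2, p; split=> //.
  by move=> x xW; rewrite /p mulrnBl (pd x x2) // subrr.
move=> x xW.
have -> : [set k x y - p x - p y | y in W2] =
    [set z + (k x2 (u j0) - p x) | z in [set k y x - k y (u j0) | y in W2]].
  rewrite -imset_comp; apply: eq_imset => y /=; rewrite /p (ksym y x).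
  by zmod_eq.
apply: leq_trans (leq_imset_card _ _) _.
apply: leq_trans (row_differences (subsetP W2W _ xW) (uW j0) cW).
by apply/subset_leq_card/imsetS.
Qed.
End PoorHost.

(** * The case distinction and its constants *)

Lemma zero_copy_of_palette (Dl q : nat) : exists C : nat,
  forall (G : sgraph) (T : finType) (gam : finZmodType) (k : T -> T -> gam) (W : {set T}),
  (forall x y, k x y = k y x) -> max_degree G <= Dl -> 0 < #|G| -> #|gam| %| #|edges G| ->
  C * #|G| <= #|W| -> {in W, forall x, #|[set k x y | y in W]| <= q} -> zero_copy G k.
Proof.
have [C HC] := linear_local_ramsey Dl q.
exists C => G T gam k W ksym degG G0 dvd cW loc.
have [F [Finj _ [h Fh]]] := HC G T gam k W ksym degG G0 cW loc.
exists F => //; rewrite (eq_bigr (fun=> h)) => [|p].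
  by rewrite sumr_const card_edge_pairs mulrn_card.
by rewrite inE => /andP[ad _]; apply: Fh.
Qed.

(** Kernel and image of multiplication by [d]: a section [s] of this map, added to elements of the
    kernel, is injective on pairs. *)
Lemma multiples_group (gam : finZmodType) (d : nat) : exists E : {group gam},
  (forall a : gam, (a *+ d)%R \in E) /\ #|E| * #|[set a : gam | (a *+ d == 0)%R]| <= #|gam|.
Proof.
pose E := [set (a *+ d)%R | a : gam].
have EP (a : gam) : (a *+ d)%R \in E by apply: imset_f.
have Eg : group_set E.
  apply/group_setP; split; first by have := EP 0%R; rewrite mul0rn.
  by move=> _ _ /imsetP [a _ ->] /imsetP [b _ ->]; rewrite -[(_ * _)%g](mulrnDl d a b).
exists (Group Eg); split=> //=.
pose s (e : gam) := odflt 0%R [pick a : gam | (a *+ d == e)%R].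
have sE e : e \in E -> (s e *+ d)%R = e.
  by move=> /imsetP [a _ ->]; rewrite /s; case: pickP => [b /eqP //|/(_ a)]; rewrite eqxx.
rewrite -cardsX -(card_in_imset (f := fun q : gam * gam => (s q.1 + q.2)%R)); first exact: max_card.
move=> [e a] [e' a']; rewrite !inE /= => /andP[eE /eqP a0] /andP[eE' /eqP a0'] eq.
have ee : e = e' by move: (congr1 (fun z => z *+ d)%R eq); rewrite !mulrnDl !sE // a0 a0' !addr0.
by move: eq; rewrite ee => /addrI ->.
Qed.

Lemma zero_copy_of_potential (d Dl M1 q : nat) : 0 < d -> exists C s0 : nat,
  forall (G : sgraph) (S : {set G}) (t : 'I_d -> nat) (T : finType) (gam : finZmodType)
    (k : T -> T -> gam) (W : {set T}) (p : T -> gam) (s : nat),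
  sites S t -> max_degree G <= Dl -> 0 < #|G| -> (forall x y, k x y = k y x) ->
  #|gam| %| #|edges G| -> s + d <= #|S| -> s0 <= s -> #|gam| <= M1 * (s + d) ->
  {in W, forall x, (p x *+ d = 0)%R} ->
  {in W, forall x, #|[set (k x y - p x - p y)%R | y in W]| <= q} ->
  C * #|G| < #|W| -> zero_copy G k.
Proof.
(* If more than [K5] elements are killed by [d], the multiples of [d] number at most [#|gam|] over
   [K5]. Adjoining popular values costs a factor of at most [d ^ q], and the filling needs [c1 * d]
   sites per element; this then uses at most half of [s + d]. *)
move=> d0; pose c1 := (d * d).+1; pose K5 := 2 * M1 * c1 * d * d ^ q.
have [C2 pal] := zero_copy_of_palette Dl q.
pose r1 := crowd d Dl + 2 * d.
have [N ramsey] := local_clique q r1.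
pose A1 := 2 * budget d 1 + usage d 1 + d + (q * N).+1.
pose A2 := d * Dl + r1 * Dl + r1 + d * d + d + 12.
pose Y := 2 * (A1 * M1 + 1 + 2 * A2).
(* The number of bad vertices at a vertex is here a fraction of the host and not a constant; this
   choice keeps their total cost at about half of the host. *)
pose D := 2 * A2.
have D0 : 0 < D by rewrite /D /A2 muln_gt0 addn_gt0 orbT.
exists (K5 * C2 + (D * q).+1 ^ q * Y), (d + 2 * c1).
move=> G S t T gam k W p s SP degG G0 ksym dvd sS s0 nM p0 loc cW.
have Wn : W != set0 by rewrite -card_gt0; apply: leq_trans cW.
pose c x y := (k x y - p x - p y)%R.
have csym x y : c x y = c y x by rewrite /c ksym -!addrA [(- p x - _)%R]addrC.
have [E [Ed cE]] := multiples_group gam d.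
set Tor := [set a : gam | _] in cE.
case: (leqP #|Tor| K5) => [small|large].
  have [|a _ ca] := @pigeonhole _ _ W p Tor Wn.
    by move=> x xW; rewrite inE p0.
  set W3 := [set x in W | _] in ca.
  have W3W : W3 \subset W by apply/subsetP => x; rewrite inE => /andP[].
  have W3p x : x \in W3 -> p x = a by rewrite inE => /andP[_ /eqP].
  apply: (pal G T gam k W3) => //.
    have : K5 * (C2 * #|G|) < K5 * #|W3|.
      apply: leq_trans (leq_trans ca _); last by rewrite leq_mul2r small orbT.
      by apply: leq_trans cW; rewrite ltnS mulnDl mulnA leq_addr.
    by rewrite ltn_mul2l => /andP[_ /ltnW].
  move=> x xW3; have xW := subsetP W3W _ xW3.
  have -> : [set k x y | y in W3] = [set (z + (a + a))%R | z in [set c x y | y in W3]].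
    rewrite -imset_comp; apply: eq_in_imset => y yW3; rewrite /= /c !W3p //.
    by zmod_eq.
  apply: leq_trans (leq_imset_card _ _) (leq_trans _ (loc x xW)).
  by apply/subset_leq_card/imsetS.
have [|E' [W3 [EE W3W cE' cW3 bad]]] := @popular_group gam T c W d D q q E W d0 csym loc Ed (subxx W).
  by move=> x xW; apply: leq_trans (loc x xW); apply/subset_leq_card/subsetDl.
have cW3' : Y * #|G| < #|W3|.
  have : (D * q).+1 ^ q * (Y * #|G|) < (D * q).+1 ^ q * #|W3|.
    by apply: leq_trans cW3; apply: leq_trans cW; rewrite ltnS mulnDl mulnA leq_addl.
  by rewrite ltn_mul2l => /andP[].
have nG : #|gam| <= M1 * #|G|.
  by apply: leq_trans nM _; rewrite leq_mul2l (leq_trans sS) ?orbT ?max_card.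
pose good x y := (x != y) && (c x y \in E').
pose b := (#|W3| %/ D).+1.
have cK5 : K5 * #|E| <= #|gam|.
  by apply: leq_trans cE; rewrite mulnC leq_mul2l (ltnW large) orbT.
have M10 : 0 < M1.
  by move: nM; case: (M1) => // ; rewrite mul0n leqn0 => /eqP/card0_eq/(_ 0%R).
apply: (@zero_sum_of_local_palette G d Dl S t SP degG d0 T gam k ksym dvd good b q N s W3 E' p) => //.
- by move=> x y; rewrite /good eq_sym csym.
- by move=> x; rewrite /good eqxx.
- move=> x xW3; apply: (@leq_trans #|x |: [set y in W3 | c x y \notin E']|).
    apply/subset_leq_card/subsetP => y; rewrite !inE /good negb_and negbK eq_sym.
    by case/andP => -> /orP[->|->]; rewrite ?orbT.
  rewrite cardsU1 /b -add1n leq_add ?leq_b1 // leq_divRL // mulnC.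
  exact: bad.
- by move=> x y _ _ /andP[].
- by move=> x /(subsetP W3W) /p0 ->; rewrite group0r.
- by move=> a; apply: (subsetP EE).
- move=> x xW3; apply: leq_trans (loc x (subsetP W3W _ xW3)).
  by apply/subset_leq_card/imsetS.
- have h1 : K5 * #|E| = 2 * M1 * (c1 * (d * (d ^ q * #|E|))).
    by rewrite /K5 -!mulnA.
  have h2 : c1 * (d * #|E'|) <= c1 * (d * (d ^ q * #|E|)) by rewrite !leq_mul2l cE' !orbT.
  have h3 : 2 * M1 * (c1 * (d * #|E'|)) <= M1 * (s + d).
    by apply: leq_trans (leq_trans cK5 nM); rewrite h1 leq_mul2l h2 orbT.
  rewrite mulnDr muln1 -/c1; move: h3; rewrite [2 * M1]mulnC -mulnA leq_pmul2l //.
  by move: s0; set x := c1 * (d * _); clear; lia.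
- rewrite /host_size -/r1 -/A1 -/A2.
  have h1 : A1 * #|gam| <= A1 * M1 * #|G| by rewrite -mulnA leq_mul2l nG orbT.
  have h2 : 2 * (A2 * (#|W3| %/ D)) <= #|W3| by rewrite mulnA mulnC leq_trunc_div.
  have h3 : A2 <= A2 * #|G| by rewrite leq_pmulr.
  have h4 : A2 * b.+1 = A2 * (#|W3| %/ D) + 2 * A2 by rewrite /b !mulnS; lia.
  rewrite h4; move: h1 h2 h3 cW3'; rewrite /Y.
  set x := A2 * (_ %/ _); move: (A1) (A2) x => a1 a2 x; clear.
  by rewrite !mulnDr !mulnDl -!mulnA; lia_cards.
Qed.

Definition linear_host (Dl d C : nat) : Prop :=
  forall (G : sgraph) (S : {set G}) (t : 'I_d -> nat) (T : finType) (gam : finZmodType)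
    (k : T -> T -> gam),
  sites S t -> max_degree G <= Dl -> 0 < #|edges G| -> #|edges G| <= site_density Dl * #|S| ->
  (forall x y, k x y = k y x) -> #|gam| %| #|edges G| -> C * #|G| <= #|T| -> zero_copy G k.

Lemma zero_copy_of_sites (d Dl : nat) : 0 < d -> exists C : nat, linear_host Dl d C.
Proof.
move=> d0; set M1 := site_density Dl; pose c1 := (d * d).+1.
(* The group has at most [M1 * (s + d)] elements, and an element costs [c1 * d] sites divided by
   [kappa]. The factor 2 and the successor leave room for the additive constants once [s] is at
   least [s1]. *)
pose kappa := (2 * (c1 * d * M1)).+1.
pose q := row_palette d (2 * kappa).
have [C1 [s0 pot]] := zero_copy_of_potential Dl M1 q d0.
pose s1 := s0 + 2 * (c1 * d * d * M1 + c1 * (kappa * kappa)).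
pose e0 := M1 * (s1 + d).
have [C2 pal] := zero_copy_of_palette Dl e0.
pose r1 := crowd d Dl + 2 * d.
pose A1 := 2 * budget d kappa + usage d kappa + d + r1.
pose A2 := d * Dl + r1 * Dl + r1 + d * d + d + 12.
pose B := 4 * budget d kappa.
pose H1 := A1 * M1 + 2 + A2 * 2.
pose H2 := B * M1 + 2 * d + 3 + q ^ d.+1 * C1.
exists (C2 + H1 + H2) => G S t T gam k SP degG eG eS ksym dvd cT.
rewrite -/M1 in eS.
have ne : #|gam| <= #|edges G| := dvdn_leq eG dvd.
have M10 : 0 < M1 by move: eS; case: (M1) => //; rewrite mul0n leqNgt eG.
have S0 : 0 < #|S| by move: eS; case: #|S| => //; rewrite muln0 leqNgt eG.
have G0 : 0 < #|G| := leq_trans S0 (max_card _).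
have cT' e : e <= C2 + H1 + H2 -> e * #|G| <= #|T|.
  by move=> le; apply: leq_trans cT; rewrite leq_mul2r le orbT.
have nG : #|gam| <= M1 * #|G|.
  by apply: leq_trans ne (leq_trans eS _); rewrite leq_mul2l max_card orbT.
(* Few edges force a group of bounded order, so that all palettes are bounded trivially. *)
have [small|large] := ltnP #|edges G| e0.
  apply: (pal G T gam k [set: T]) => //.
    by rewrite cardsT; apply: cT'; rewrite -addnA leq_addr.
  move=> x _; apply: leq_trans (max_card _) _.
  exact: leq_trans ne (ltnW small).
have sS : s1 + d <= #|S| by have := leq_trans large eS; rewrite leq_pmul2l.
pose s := #|S| - d.
have sd : s + d = #|S| by rewrite subnK // (leq_trans _ sS) ?leq_addl.
have s1s : s1 <= s by rewrite -(leq_add2r d) sd.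
have ns : #|gam| <= M1 * (s + d) by rewrite sd (leq_trans ne).
have ks : c1 * (d * #|gam| + kappa * kappa) <= kappa * s.
  have h1 : c1 * (d * #|gam|) <= c1 * d * M1 * s + c1 * d * d * M1.
    rewrite -[c1 * d * d * M1]mulnA -[c1 * d * M1 * s]mulnA -mulnDr mulnA leq_mul2l.
    by rewrite [d * M1]mulnC -mulnDr ns orbT.
  have h2 : kappa * s = 2 * (c1 * d * M1 * s) + s by rewrite /kappa mulSn addnC !mulnA.
  rewrite h2 mulnDr; move: h1 s1s; rewrite /s1.
  move: (c1 * d * d * M1) (c1 * (kappa * kappa)) (c1 * d * M1 * s) => a b c; clear; lia.
have [rich|nrich] := classic (forall X : {set T}, #|X| <= B * #|gam| ->
    rich_star k (fun x y => x != y) d (2 * kappa) ([set: T] :\: X)).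
  apply: (zero_sum_of_rich_stars SP degG d0 ksym dvd _ rich _ ks) => //.
    by rewrite sd.
  rewrite cardsT /host_size -/r1 -/A1 -/A2; have := cT' H1 _; rewrite addnAC leq_addl => /(_ isT).
  apply: leq_trans; rewrite /H1.
  have h1 : A1 * #|gam| <= A1 * M1 * #|G| by rewrite -mulnA leq_mul2l nG orbT.
  have h2 : A2 * 2 <= A2 * 2 * #|G| by rewrite leq_pmulr.
  by move: h1 h2 G0; move: (A1) (A2) => a1 a2; rewrite !mulnDl; lia_cards.
have [X nX] := not_all_ex_not _ _ nrich.
have [cX poor] := imply_to_and _ _ nX.
pose W := [set: T] :\: X.
have cW : (2 * d + 3 + q ^ d.+1 * C1) * #|G| <= #|W|.
  rewrite -(leq_add2r #|X|); have -> : #|W| + #|X| = #|T|.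
    by rewrite /W setTD addnC cardsC.
  apply: leq_trans (cT' H2 (leq_addl _ _)); rewrite /H2 -!addnA [(B * M1 + _) * _]mulnDl addnC leq_add2r.
  by apply: leq_trans cX _; rewrite -mulnA leq_mul2l nG orbT.
have cW2 : d + d + 3 + q ^ d.+1 * (C1 * #|G|) <= #|W|.
  apply: leq_trans cW; rewrite mulnDl mulnA leq_add2r addnn -mul2n.
  by rewrite leq_pmulr.
have [|W2 [p [_ cW3 p0 loc]]] := poor_potential ksym d0 poor.
  by apply: leq_trans cW2; move: (q ^ _ * _) => a; clear; lia.
apply: (pot G S t T gam k W2 p s) => //.
- by rewrite sd.
- by apply: leq_trans s1s; apply: leq_addr.
- have : q ^ d.+1 * (C1 * #|G|) < q ^ d.+1 * #|W2|.
    move: cW3 cW2; rewrite -/q; move: (q ^ _ * _) (q ^ _ * _) => a b; lia_cards.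
  by rewrite ltn_mul2l => /andP[].
Qed.

(** The degree of the sites depends on the graph, so one constant has to serve all degrees up to the
    maximum. *)
Lemma bounded_choice (P : nat -> nat -> Prop) (m : nat) :
  (forall d C C', C <= C' -> P d C -> P d C') -> (forall d, 0 < d -> exists C, P d C) ->
  exists C, forall d, 0 < d -> d <= m -> P d C.
Proof.
move=> mono ex; elim: m => [|m [C HC]]; first by exists 0 => -[].
have [C' HC'] := ex m.+1 isT; exists (C + C') => d d0.
rewrite leq_eqVlt => /orP[/eqP ->|dm]; first by apply: mono HC'; apply: leq_addl.
by apply: mono (HC d d0 dm); apply: leq_addr.
Qed.

Lemma linear_zero_copy (Dl : nat) : exists C : nat,
  forall (G : sgraph) (T : finType) (gam : finZmodType) (k : T -> T -> gam),
  max_degree G <= Dl -> 0 < #|edges G| -> (forall x y, k x y = k y x) ->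
  #|gam| %| #|edges G| -> C * #|G| <= #|T| -> zero_copy G k.
Proof.
have [|d d0|C HC] := @bounded_choice (linear_host Dl) Dl.
- move=> d C C' le H G S t T gam k h1 h2 h3 h4 h5 h6 h7; apply: (H G S t) => //.
  by apply: leq_trans h7; rewrite leq_mul2r le orbT.
- exact: zero_copy_of_sites.
exists C => G T gam k degG eG ksym dvd cT.
have [d [t [S [d0 dDl SP eS]]]] := sites_exist degG eG.
exact: (HC d d0 dDl G S t).
Qed.

(** * Passage to the zero-sum Ramsey number *)

Lemma least_nat (P : nat -> Prop) (n : nat) : P n -> exists r, [/\ P r, r <= n & forall t, P t -> r <= t].
Proof.
elim/ltn_ind: n => n IH Pn; have [[m [mn Pm]]|no] := classic (exists m, m < n /\ P m).
  by have [r [Pr rm rmin]] := IH m mn Pm; exists r; split=> //; apply: leq_trans rm (ltnW mn).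
by exists n; split=> // t Pt; rewrite leqNgt; apply/negP => tn; apply: no; exists t.
Qed.

Lemma zero_sum_arrow_of_zero_copy (G : sgraph) (gam : finZmodType) (n : nat) :
  (forall k : 'I_n -> 'I_n -> gam, (forall x y, k x y = k y x) -> zero_copy G k) ->
  zero_sum_arrow G gam n.
Proof.
(* A colouring is defined on edges only. The default value 0 is taken on singletons, and these never
   occur in the sum because [F] is injective. *)
move=> H c; pose g (A : {set 'I_n}) : gam :=
  if insub A is Some d then c (d : edge (complete_graph n)) else 0%R.
have [|F Finj sum0] := H (fun x y => g [set x; y]); first by move=> x y; rewrite setUC.
exists F; split.
  split=> // x y ad; apply: contraTneq ad => /Finj ->; by rewrite adj_irrefl.
pose h (p : G * G) : {set complete_graph n} := [set F p.1; F p.2].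
have copyE : copy_edges (H := complete_graph n) F = h @: edge_pairs G.
  rewrite /copy_edges edges_pairs -imset_comp; apply: eq_imset => p /=.
  by rewrite imsetU !imset_set1.
have hinj : {in edge_pairs G &, injective h}.
  move=> p p' pE p'E e; apply: pair_set_inj => //; apply: (imset_inj Finj).
  by rewrite !imsetU !imset_set1.
have sub : {subset copy_edges (H := complete_graph n) F <= edges (complete_graph n)}.
  rewrite copyE => _ /imsetP [[x y] xy ->]; apply/imsetP; exists (F x, F y) => //.
  rewrite inE /=; apply: contraTneq xy => /Finj ->.
  by rewrite inE /= adj_irrefl.
transitivity (\sum_(A in edges (complete_graph n) | A \in copy_edges (H := complete_graph n) F) g A)%R.
  rewrite big_sub_cond; apply: eq_bigr => d _.
  by rewrite /g valK.
rewrite (eq_bigl (mem (h @: edge_pairs G))) => [|A].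
  by rewrite big_imset.
by rewrite -copyE /=; apply/andP/idP => [[]//|AC]; split=> //; apply: sub.
Qed.

Theorem theorem1p2 (Delta : nat) (hDelta : 0 < Delta) :
  exists C : nat, forall (G : sgraph) (Gamma0 : finZmodType),
    max_degree G = Delta ->
    #|Gamma0| %| #|edges G| ->
    exists r : nat, is_zero_sum_ramsey G Gamma0 r /\ r <= C * #|G|.
Proof.
have [C HC] := linear_zero_copy Delta.
(* The successor makes [n] positive even if [C] is 0. *)
exists C.+1 => G gam degG dvd.
have [x0 dx] : exists x : G, 0 < degree x.
  apply/existsP; apply: contraLR hDelta; rewrite negb_exists -leqNgt -degG => /forallP le.
  by apply/bigmax_leqP => x _; rewrite leqNgt le.
(* Without an edge, divisibility would not bound the order of the group. *)
have eG : 0 < #|edges G|.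
  case/card_gt0P: dx => y; rewrite inE => xy; apply/card_gt0P; exists [set x0; y].
  by apply/imsetP; exists (x0, y); rewrite ?inE.
pose n := C.+1 * #|G|.
have n0 : 0 < n by rewrite muln_gt0; apply/card_gt0P; exists x0.
have arrow : zero_sum_arrow G gam n.
  apply: zero_sum_arrow_of_zero_copy => k ksym; apply: HC => //; first by rewrite degG.
  by rewrite card_ord leq_mul2r leqnSn orbT.
have [r [[r0 ar] rn rmin]] := @least_nat (fun t => 0 < t /\ zero_sum_arrow G gam t) n (conj n0 arrow).
by exists r; split=> //; split=> // t t0 at'; apply: rmin.
Qed.
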